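(* Every $\boxplus$-stable probability distribution on $\mathbf{R}$ is unimodal.
   Context: $\mathcal{M}$ is the set of Borel probability measures on $\mathbf{R}$. For $\mu\in\mathcal{M}$ let $G_\mu(z)=\int_{-\infty}^\infty \frac{1}{z-t}\,d\mu(t)$ and $F_\mu(z)=1/G_\mu(z)$ for $z\in\mathbf{C}^+=\{\Im z>0\}$. For $\eta,M>0$ let $\Gamma_{\eta,M}=\{x+iy: y>M,\ |x|<\eta y\}$. For every $\eta>0$ there is $M>0$ such that $F_\mu$ has an analytic inverse $F_\mu^{-1}:\Gamma_{\eta,M}\to\mathbf{C}^+$, meaning $F_\mu(F_\mu^{-1}(z))=z$ and $F_\mu^{-1}(z)/z\to1$ as $z\to\infty$ in $\Gamma_{\eta,M}$. The Voiculescu transform of $\mu$ is $\phi_\mu(z)=F_\mu^{-1}(z)-z$; it determines $\mu$. The free additive convolution $\mu\boxplus\nu$ is the unique measure in $\mathcal{M}$ with $\phi_{\mu\boxplus\nu}=\phi_\mu+\phi_\nu$ on any truncated cone where all three are defined. Measures $\mu,\nu\in\mathcal{M}$ are equivalent, $\mu\sim\nu$, if there are real $a>0$, $b$ with $\mu(S)=\nu(aS+b)$ for every Borel set $S$. A measure $\nu\in\mathcal{M}$ which is not a point mass is $\boxplus$-stable if $\mu_1\boxplus\mu_2\sim\nu$ whenever $\mu_1\sim\nu\sim\mu_2$. It is known that a measure is $\boxplus$-stable if and only if it is equivalent to a measure whose Voiculescu transform is one of: $z^{-1}$; $e^{i(\alpha-2)\rho\pi}z^{1-\alpha}$ with $1<\alpha<2$,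 $0\le\rho\le1$; $-2\rho i+\frac{2(2\rho-1)}{\pi}\log z$ with $0\le\rho\le1$; $-e^{i\alpha\rho\pi}z^{1-\alpha}$ with $0<\alpha<1$, $0\le\rho\le1$ (principal branches on $\mathbf{C}^+$). A probability distribution on $\mathbf{R}$ with a density with respect to Lebesgue measure is called unimodal if this density has a unique local maximum. Here the density is taken to be its continuous version, and local maxima are considered within the interior of the support. *)

(* Defs.v *)
(* MathComp-Analysis, over an arbitrary real type R, with complex numbers R[i]. *)
From mathcomp Require Export all_boot all_order all_algebra.
From mathcomp Require Export all_classical all_reals all_analysis.
From mathcomp Require Export complex.
Export numFieldNormedType.Exports.
Set Implicit Arguments.
Unset Strict Implicit.
Unset Printing Implicit Defensive.
Import Order.TTheory GRing.Theory Num.Theory.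
Local Open Scope classical_set_scope.
Local Open Scope ring_scope.
Local Open Scope complex_scope.

Notation borel_probability R := (probability (measurableTypeR R) R).

Definition upper_half_plane (R : realType) : set R[i] :=
  [set z | 0 < complex.Im z].

(* The integral of a complex function is taken componentwise. *)
Definition cauchy_transform (R : realType) (mu : borel_probability R)
    (z : R[i]) : R[i] :=
  Rintegral mu setT (fun t : R => complex.Re (1 / (z - t%:C))) +i*
  Rintegral mu setT (fun t : R => complex.Im (1 / (z - t%:C))).

Definition reciprocal_cauchy_transform (R : realType)
    (mu : borel_probability R) (z : R[i]) : R[i] :=
  (cauchy_transform mu z)^-1.

Definition truncated_cone (R : realType) (eta M : R) : set R[i] :=
  [set z | M < complex.Im z /\ `|complex.Re z| < eta * complex.Im z].

(* [f] is complex differentiable at every point of [D], which for an open set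
   [D] is analyticity.  Seeing R[i] as the regular module over itself, and not
   as a real vector space, is what makes [derivable] the complex notion. *)
Definition analytic_on (R : realType) (D : set R[i]) (f : R[i] -> R[i]) :=
  forall z : R[i], D z -> derivable (f : R[i]^o -> R[i]^o) z 1.

(* [g z / z] tends to 1 as [z] tends to infinity inside [D].  The norm of R[i]
   has its values in R[i], hence the injections of the real bounds. *)
Definition asymptotic_to_id (R : realType) (D : set R[i]) (g : R[i] -> R[i]) :=
  forall e : R, 0 < e -> exists K : R, forall z : R[i],
    D z -> K%:C < `|z| -> `|g z / z - 1| < e%:C.

(* [g] is (on the cone) the inverse of F_mu; its values off the cone are
   irrelevant. *)
Definition is_F_inverse (R : realType) (mu : borel_probability R) (eta M : R)
    (g : R[i] -> R[i]) : Prop :=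
  let Gamma := truncated_cone eta M in
  [/\ analytic_on Gamma g,
      forall z, Gamma z -> upper_half_plane (g z),
      forall z, Gamma z -> reciprocal_cauchy_transform mu (g z) = z
    & asymptotic_to_id Gamma g].

Definition is_voiculescu_transform (R : realType) (mu : borel_probability R)
    (eta M : R) (phi : R[i] -> R[i]) : Prop :=
  exists2 g : R[i] -> R[i], is_F_inverse mu eta M g &
    forall z, truncated_cone eta M z -> phi z = g z - z.

(* [lam] is the free additive convolution of [mu] and [nu]: for any truncated
   cone on which the three Voiculescu transforms are defined, that of [lam] is
   the sum of the other two.  A Voiculescu transform exists on some truncated
   cone of every aperture and is determined by the measure and the cone, so
   that this relation is not vacuous and determines [lam]. *)
Definition is_free_convolution (R : realType)
    (mu nu lam : borel_probability R) : Prop :=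
  forall (eta M : R) (phi_mu phi_nu phi_lam : R[i] -> R[i]),
    0 < eta -> 0 < M ->
    is_voiculescu_transform mu eta M phi_mu ->
    is_voiculescu_transform nu eta M phi_nu ->
    is_voiculescu_transform lam eta M phi_lam ->
    forall z, truncated_cone eta M z -> phi_lam z = phi_mu z + phi_nu z.

Definition measure_equiv (R : realType) (mu nu : borel_probability R) : Prop :=
  exists a b : R, 0 < a /\
    forall S : set (measurableTypeR R), measurable S ->
      mu S = nu [set a * x + b | x in S].

Definition point_mass (R : realType) (mu : borel_probability R) : Prop :=
  exists x : R, forall S : set (measurableTypeR R), measurable S ->
    mu S = dirac (x : measurableTypeR R) S.

Definition free_stable (R : realType) (nu : borel_probability R) : Prop :=
  ~ point_mass nu /\
  forall mu1 mu2 : borel_probability R,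
    measure_equiv mu1 nu -> measure_equiv nu mu2 ->
    exists2 lam : borel_probability R,
      is_free_convolution mu1 mu2 lam & measure_equiv lam nu.

Definition measure_support (R : realType) (mu : borel_probability R) : set R :=
  [set x | forall U : set R, open U -> U x -> (0 < mu U)%E].

Definition is_density (R : realType) (mu : borel_probability R) (f : R -> R) :
    Prop :=
  [/\ measurable_fun setT (f : measurableTypeR R -> measurableTypeR R),
      forall x, 0 <= f x
    & forall S : set (measurableTypeR R), measurable S ->
        mu S = (\int[lebesgue_measure]_(x in S) (f x)%:E)%E].

(* Local maxima are not required to be strict. *)
Definition local_max (R : realType) (f : R -> R) (x : R) : Prop :=
  \forall y \near x, f y <= f x.

Definition unimodal (R : realType) (mu : borel_probability R) : Prop :=
  exists f : R -> R,
    [/\ continuous f, is_density mu f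
      & exists! x : R, (measure_support mu)° x /\ local_max f x].

(* Main.v *)
(** Let F = 1/G.  Unless nu is a point mass, Im F(w) > Im w on the upper half
plane.  Stability of nu, applied to nu and a dilate of it, gives for every
a > 0 some c > 0 with k(z) + k(az) = k(cz), where k(z) = - Im phi(z) / |z|:
taking imaginary parts removes the unknown translations.  Hence
k(c_n z) = n k(z) for suitable c_n, the ratios t_n = c_{n+1} / c_n tend to 1
and k(t_n z) = (1 + 1/n) k(z), so that Im (z phi' - (1 - al) phi) = 0 for some
al > 0.  No classification of stable laws is needed: in terms of F this reads
(al F + (1 - al) w + s) F' = F with s real, first on a cone and then on the
half plane.

The equation makes F Hoelder up to the real line, with continuous boundary
values u + i v that never vanish; by Stieltjes inversion nu has the density
f = v / (pi (u^2 + v^2)).  On the interval {v > 0} the derivative of f has the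
sign of - P, where P = 2 al u + (1 - al) x + s.  For a suitable positive weight
m, (m P)' has the sign of 4 v^2 - (1 + al) (u^2 + v^2), and u / v is increasing.
A zero of P where this sign is not positive would force f to be monotone all
the way to an end of its support, which is impossible for an integrable
continuous density; so all zeros of P are upward crossings, and there is
exactly one. *)

From HB Require Import structures.
Require Import Defs.
From mathcomp Require Import ring lra zify measurable_realfun.
Set Implicit Arguments.
Unset Strict Implicit.
Unset Printing Implicit Defensive.
Import Order.TTheory GRing.Theory Num.Theory.
Local Open Scope classical_set_scope.
Local Open Scope ring_scope.
Local Open Scope complex_scope.
Import ComplexField.Normc.

Local Notation Re := complex.Re.
Local Notation Im := complex.Im.

(** * Complex differentiation *)

Section ComplexModulus.
Variable R : realType.
Implicit Types z w : R[i].

(** Stability gives some [c] for each [a], with no control on how [c] depends on [a]. Regularity is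
    replaced by rigidity: [k] is positive and tends to 0 at infinity, so no dilation by a factor
    above 1 can multiply [k] by a constant [>= 1]. This alone makes the scaling factors and their
    ratios monotone. The exponent appears as [1 - al], the limit of [(N t - 1) / (t - 1)] with
    [N = 1 + 1/n] and [t = t_n]: it is the logarithmic derivative of [- Im phi] along rays, the same
    for all rays. The constant [s] is the value of an analytic function whose imaginary part
    vanishes. The passage from the cone to the half plane is an identity theorem, obtained from a
    maximum principle for functions with a second-order expansion; Cauchy transforms have such
    expansions explicitly. At the real line the obstacle is that F' may be unbounded. The
    coefficient [D = al F + (1 - al) w + s] of F' satisfies that [D D'] is affine in [D] and [w], so
    [D^2] is Lipschitz and [D] is Hoelder of exponent 1/2. That F has no boundary zero takes two
    different arguments, according to whether [D] vanishes at the point. *)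

Lemma ReD z w : Re (z + w) = Re z + Re w. Proof. by case: z w => [a b] [c d]. Qed.
Lemma ImD z w : Im (z + w) = Im z + Im w. Proof. by case: z w => [a b] [c d]. Qed.
Lemma ReN z : Re (- z) = - Re z. Proof. by case: z. Qed.
Lemma ImN z : Im (- z) = - Im z. Proof. by case: z. Qed.
Lemma ReB z w : Re (z - w) = Re z - Re w. Proof. by rewrite ReD ReN. Qed.
Lemma ImB z w : Im (z - w) = Im z - Im w. Proof. by rewrite ImD ImN. Qed.
Lemma ReM z w : Re (z * w) = Re z * Re w - Im z * Im w.
Proof. by case: z w => [a b] [c d]. Qed.
Lemma ImM z w : Im (z * w) = Re z * Im w + Im z * Re w.
Proof. by case: z w => [a b] [c d]. Qed.

Lemma complexP z w : Re z = Re w -> Im z = Im w -> z = w.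
Proof. by case: z w => [a b] [c d] /= -> ->. Qed.

Lemma normc_sqr z : normc z ^+ 2 = Re z ^+ 2 + Im z ^+ 2.
Proof. by case: z => a b /=; rewrite sqr_sqrtr// addr_ge0// sqr_ge0. Qed.

Lemma normc_ge0 z : 0 <= normc z. Proof. by case: z => a b; exact: sqrtr_ge0. Qed.

Lemma normc_eq0 z : (normc z == 0) = (z == 0).
Proof. by apply/eqP/eqP => [/eq0_normc//|->]; rewrite normc0. Qed.

Lemma normc_gt0 z : (0 < normc z) = (z != 0).
Proof. by rewrite lt_def normc_ge0 andbT normc_eq0. Qed.

Lemma ger0_ler_sqr (a b : R) : 0 <= b -> a ^+ 2 <= b ^+ 2 -> a <= b.
Proof.
move=> b0 ab; have [a0|/ltW a0] := leP 0 a; last exact: le_trans b0.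
by rewrite -(@ler_pXn2r _ 2)// nnegrE.
Qed.

Lemma normc_ge_Re z : `|Re z| <= normc z.
Proof.
apply: ger0_ler_sqr; first exact: normc_ge0.
by rewrite real_normK ?num_real// normc_sqr lerDl sqr_ge0.
Qed.

Lemma normc_ge_Im z : `|Im z| <= normc z.
Proof.
apply: ger0_ler_sqr; first exact: normc_ge0.
by rewrite real_normK ?num_real// normc_sqr lerDr sqr_ge0.
Qed.

Lemma normc_le_ReIm z : normc z <= `|Re z| + `|Im z|.
Proof.
apply: ger0_ler_sqr; first by rewrite addr_ge0.
rewrite normc_sqr sqrrD !real_normK ?num_real// lerD2r lerDl mulrn_wge0// mulr_ge0//.

Qed.

Lemma normcR (x : R) : normc x%:C = `|x|.
Proof. by rewrite /= expr0n /= addr0 sqrtr_sqr. Qed.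

Lemma normcX z n : normc (z ^+ n) = normc z ^+ n.
Proof. by elim: n => [|n IH]; rewrite ?expr0 ?normc1// !exprS normcM IH. Qed.

Lemma normcD_le z w : normc (z + w) <= normc z + normc w.
Proof. exact: le_normcD. Qed.

Lemma normcNE z : normc (- z) = normc z.
Proof. exact: normcN. Qed.

Lemma normcB z w : normc (z - w) = normc (w - z).
Proof. by rewrite -normcNE opprB. Qed.

Lemma normc_leB z w : normc (z - w) <= normc z + normc w.
Proof. by rewrite (le_trans (normcD_le _ _))// normcNE. Qed.

Lemma normc_geB z w : normc z - normc w <= normc (z - w).
Proof. by rewrite lerBlDr -{1}(subrK w z) normcD_le. Qed.

Lemma normc_triangle w z1 z2 : normc (z1 - z2) <= normc (z1 - w) + normc (w - z2).
Proof. by rewrite -(subrKA w) normcD_le. Qed.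

Lemma normC_normc z : `|z| = (normc z)%:C.
Proof. by case: z. Qed.

Lemma Re_inv z : Re z^-1 = Re z / normc z ^+ 2.
Proof. by rewrite normc_sqr; case: z. Qed.

Lemma Im_inv z : Im z^-1 = - Im z / normc z ^+ 2.
Proof. by rewrite normc_sqr mulNr; case: z. Qed.

(** Rotating [z] onto the positive axis turns its modulus into a real part. Real arguments, such as
    the mean value theorem or monotonicity of the integral, thus bound complex quantities without
    loss in the constants. *)
Lemma normc_le_rot z (B : R) : 0 <= B ->
  (forall u, normc u = 1 -> Re (u * z) <= B) -> normc z <= B.
Proof.
move=> B0 h; have [->|z0] := eqVneq z 0; first by rewrite normc0.
have n0 : 0 < normc z by rewrite normc_gt0.
have nC0 : (normc z)%:C != 0 :> R[i] by rewrite eq_complex/= negb_and lt0r_neq0.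
have nu : normc (conjc z / (normc z)%:C) = 1.
  rewrite normcM normcV normcR ger0_norm ?normc_ge0//.
  have -> : normc (conjc z) = normc z by case: (z) => a b /=; rewrite sqrrN.
  by rewrite divff// lt0r_neq0.
apply: le_trans (h _ nu).
suff -> : conjc z / (normc z)%:C * z = (normc z)%:C by [].
apply: (mulIf nC0); rewrite mulrAC divfK// -rmorphM/= -expr2 normc_sqr.
by case: (z) => a b; apply: complexP => /=; ring.
Qed.

Lemma Im_gt0_neq0 z : 0 < Im z -> z != 0.
Proof. by move=> h; rewrite eq_complex negb_and (gt_eqF h) orbT. Qed.

End ComplexModulus.

Section ComplexDerivative.
Variable R : realType.
Implicit Types (z w h d : R[i]) (f g : R[i] -> R[i]).

(** First-order expansion with a non-strict error bound: no division, so [h = 0] is no exception,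
    and a modulus with values in [R]. The link with [derivable] is made once, in
    [cder_derivable]. *)
Definition cder f z d := forall e : R, 0 < e -> exists2 r : R, 0 < r &
  forall h, normc h < r -> normc (f (z + h) - f z - d * h) <= e * normc h.

Lemma cder_cst c z : cder (fun=> c) z 0.
Proof.
move=> e e0; exists 1 => // h _.
by rewrite subrr mul0r subr0 normc0 mulr_ge0 ?normc_ge0// ltW.
Qed.

Lemma cder_id z : cder id z 1.
Proof.
move=> e e0; exists 1 => // h _.
have -> : id (z + h) - id z - 1 * h = 0 by rewrite /=; ring.
by rewrite normc0 mulr_ge0 ?normc_ge0// ltW.
Qed.

Lemma cder_eq f z d d' : cder f z d -> d = d' -> cder f z d'.
Proof. by move=> ? <-. Qed.

Lemma cderD f g z d d' : cder f z d -> cder g z d' ->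
  cder (fun w => f w + g w) z (d + d').
Proof.
move=> df dg e e0; have e20 : 0 < e / 2 by rewrite divr_gt0.
have [r1 r10 H1] := df _ e20; have [r2 r20 H2] := dg _ e20.
exists (Num.min r1 r2); first by rewrite lt_min r10.
move=> h; rewrite lt_min => /andP[/H1 {}H1 /H2 {}H2].
have -> : f (z + h) + g (z + h) - (f z + g z) - (d + d') * h =
   (f (z + h) - f z - d * h) + (g (z + h) - g z - d' * h) by ring.
apply: le_trans (normcD_le _ _) _; lra.
Qed.

Lemma cder_lip f z d : cder f z d -> exists K r : R, [/\ 0 <= K, 0 < r &
  forall h, normc h < r -> normc (f (z + h) - f z) <= K * normc h].
Proof.
move=> /(_ 1 ltr01)[r r0 H]; exists (normc d + 1), r; split => //.
  by rewrite addr_ge0 ?normc_ge0.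
move=> h /H; rewrite mul1r => {}H.
rewrite -(subrK (d * h) (f (z + h) - f z)) (le_trans (normcD_le _ _))//.
by rewrite normcM; lra.
Qed.

Lemma cder_cts f z d : cder f z d -> forall e : R, 0 < e -> exists2 r : R, 0 < r &
  forall h, normc h < r -> normc (f (z + h) - f z) < e.
Proof.
move=> /cder_lip[K [r [K0 r0 H]]] e e0.
have K1 : 0 < K + 1 by rewrite ltr_wpDl.
exists (Num.min r (e / (K + 1))); first by rewrite lt_min r0 divr_gt0.
move=> h; rewrite lt_min => /andP[/H hr]; rewrite ltr_pdivlMr// => h2.
apply: le_lt_trans hr _; apply: le_lt_trans h2.
by have := normc_ge0 h; nra.
Qed.

Lemma cderM f g z d d' : cder f z d -> cder g z d' ->
  cder (fun w => f w * g w) z (d * g z + f z * d').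
Proof.
move=> df dg e e0.
set A := normc (f z) + normc (g z) + 1.
have A0 : 0 < A by rewrite /A ltr_wpDl// addr_ge0 ?normc_ge0.
have [K [r0 [K0 r00 H0]]] := cder_lip df.
have [K' [r0' [K0' r00' H0']]] := cder_lip dg.
have e1 : 0 < e / (2 * A) by rewrite divr_gt0// mulr_gt0.
have [r1 r10 H1] := df _ e1; have [r2 r20 H2] := dg _ e1.
set r3 := e / (2 * (K * K' + 1)).
have KK : 0 <= K * K' by rewrite mulr_ge0.
have r30 : 0 < r3 by rewrite divr_gt0// mulr_gt0// ltr_wpDl.
exists (Num.min (Num.min (Num.min r0 r0') (Num.min r1 r2)) r3).
  by rewrite !lt_min r00 r00' r10 r20.
move=> h; rewrite !lt_min => /andP[/andP[/andP[/H0 {}H0 /H0' {}H0'] /andP[/H1 {}H1 /H2 {}H2]] h3].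
have -> : f (z + h) * g (z + h) - f z * g z - (d * g z + f z * d') * h =
  (f (z + h) - f z - d * h) * g z + f z * (g (z + h) - g z - d' * h)
  + (f (z + h) - f z) * (g (z + h) - g z) by ring.
apply: le_trans (normcD_le _ _) _; rewrite normcM.
have b1 : normc (f (z + h) - f z) * normc (g (z + h) - g z) <= e / 2 * normc h.
  apply: (@le_trans _ _ (K * normc h * (K' * normc h))); first by rewrite ler_pM ?normc_ge0.
  have : normc h * (2 * (K * K' + 1)) < e by rewrite -ltr_pdivlMr// mulr_gt0// ltr_wpDl.
  have := normc_ge0 h; set n := normc h => n0 ?.
  have -> : K * n * (K' * n) = K * K' * n * n by ring.
  by apply: ler_wpM2r => //; lra.
suff : normc ((f (z + h) - f z - d * h) * g z + f z * (g (z + h) - g z - d' * h))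
   <= e / 2 * normc h by lra.
apply: le_trans (normcD_le _ _) _; rewrite !normcM.
have n0 := normc_ge0 (f z); have n1 := normc_ge0 (g z); have n2 := normc_ge0 h.
apply: (@le_trans _ _ (e / (2 * A) * normc h * (normc (f z) + normc (g z)))).
  have X1 := ler_wpM2r n1 H1; have X2 := ler_wpM2l n0 H2.
  by rewrite (le_trans (lerD X1 X2))// le_eqVlt; apply/orP; left; apply/eqP; ring.
apply: (@le_trans _ _ (e / (2 * A) * normc h * A)).
  by apply: ler_wpM2l; [rewrite mulr_ge0// ltW|rewrite /A lerDl].
rewrite le_eqVlt; apply/orP; left; apply/eqP; field; exact: lt0r_neq0.
Qed.

Lemma cderV f z d : f z != 0 -> cder f z d -> cder (fun w => (f w)^-1) z (- d / (f z) ^+ 2).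
Proof.
move=> fz0 df e e0.
have n0 : 0 < normc (f z) by rewrite normc_gt0.
have [K [r0 [K0 r00 H0]]] := cder_lip df.
set n := normc (f z) in n0.
have n20 : 0 < n / 2 by rewrite divr_gt0.
have [r4 r40 H4] := cder_cts df n20.
have e1 : 0 < e * n ^+ 2 / 4 by rewrite divr_gt0// mulr_gt0// exprn_gt0.
have [r1 r10 H1] := df _ e1.
set r3 := e * n ^+ 3 / (4 * (K * K + 1)).
have KK : 0 <= K * K by rewrite mulr_ge0.
have r30 : 0 < r3 by rewrite divr_gt0// ?mulr_gt0// ?exprn_gt0// ltr_wpDl.
exists (Num.min (Num.min r0 r1) (Num.min r4 r3)).
  by rewrite !lt_min r00 r40 r10 r30.
move=> h; rewrite !lt_min => /andP[/andP[/H0 {}H0 /H1 {}H1] /andP[/H4 {}H4 h3]].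
have m0 : n / 2 < normc (f (z + h)).
  have := normc_geB (f z) (f (z + h)); rewrite normcB -/n => ?; lra.
have fh0 : f (z + h) != 0 by rewrite -normc_gt0 (lt_trans n20).
(* With [k] the increment of [f], [1 / (f + k) = 1 / f - k / f^2 + k^2 / (f^2 (f + k))]; only the
   last term calls for the lower bound on [f (z + h)]. *)
have -> : (f (z + h))^-1 - (f z)^-1 - - d / f z ^+ 2 * h =
   - (f (z + h) - f z - d * h) / (f z) ^+ 2 + (f (z + h) - f z) ^+ 2 / ((f z)^+ 2 * f (z + h)).
  by field; rewrite ?fz0 ?fh0.
apply: le_trans (normcD_le _ _) _.
rewrite [in X in X + _ <= _]normcM normcNE [in X in _ + X <= _]normcM !normcV [normc (f z ^+ 2 * _)]normcM !normcX -/n.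
have n2 := normc_ge0 h; set m := normc (f (z + h)) in m0 *.
have nn : 0 < n ^+ 2 by rewrite exprn_gt0.
have b1 : normc (f (z + h) - f z - d * h) / n ^+ 2 <= e / 4 * normc h.
  by rewrite ler_pdivrMr// (le_trans H1)// le_eqVlt; apply/orP; left; apply/eqP; field.
have b2 : normc (f (z + h) - f z) ^+ 2 / (n ^+ 2 * m) <= e / 2 * normc h.
  have mm : 0 < m by exact: lt_trans m0.
  rewrite ler_pdivrMr; last by rewrite mulr_gt0.
  apply: (@le_trans _ _ ((K * normc h) ^+ 2)).
    by rewrite ler_pXn2r// nnegrE ?normc_ge0// mulr_ge0 ?normc_ge0.
  have h3' : normc h * (4 * (K * K + 1)) < e * n ^+ 3 by rewrite -ltr_pdivlMr// mulr_gt0// ltr_wpDl.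
  apply: (@le_trans _ _ (e / 2 * normc h * (n ^+ 2 * (n / 2)))); last first.
    apply: ler_wpM2l; first by rewrite mulr_ge0// ltW// divr_gt0.
    by apply: ler_wpM2l; exact: ltW.
  have -> : (K * normc h) ^+ 2 = normc h * (K * K * normc h) by ring.
  have -> : e / 2 * normc h * (n ^+ 2 * (n / 2)) = normc h * (e * n ^+ 3 / 4) by field.
  by apply: ler_wpM2l => //; nra.
by rewrite (le_trans (lerD b1 b2))//; nra.
Qed.

Lemma cderN f z d : cder f z d -> cder (fun w => - f w) z (- d).
Proof.
move=> df e /df[r r0 H]; exists r => // h /H.
by rewrite -[X in X <= _]normcNE; congr (normc _ <= _); ring.
Qed.

Lemma cderB f g z d d' : cder f z d -> cder g z d' ->
  cder (fun w => f w - g w) z (d - d').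
Proof. by move=> df dg; apply: cderD => //; exact: cderN. Qed.

Lemma cderZ c f z d : cder f z d -> cder (fun w => c * f w) z (c * d).
Proof.
by move=> df; apply: cder_eq (cderM (cder_cst c z) df) _; rewrite mul0r add0r.
Qed.

Lemma is_derive_eps (f : R -> R) (x d : R) :
  (forall e : R, 0 < e -> exists2 r : R, 0 < r & forall h : R, `|h| < r ->
     `|f (x + h) - f x - d * h| <= e * `|h|) -> is_derive x 1 f d.
Proof.
move=> H.
have C : h^-1 *: ((f \o shift x) (h *: (1 : R)) - f x) @[h --> (0:R)^'] --> (d : R).
  apply/cvgrPdist_le => e e0; have [r r0 Hr] := H e e0.
  near=> h.
  have h0 : h != 0 by near: h; exact: nbhs_dnbhs_neq.
  have hr : `|h| < r.
    near: h; apply: dnbhs0_lt => //.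
  have := Hr h hr; rewrite /= /GRing.scale/= mulr1 (addrC h) => {}Hr.
  rewrite distrC -(ler_pM2r (_ : 0 < `|h|)) ?normr_gt0// -normrM mulrBl.
  by rewrite mulrAC mulVf// mul1r.
by apply: DeriveDef; [apply: cvgP C|apply: cvg_lim C].
Unshelve. all: by end_near. Qed.

(** Chain rule on the line through [z] with direction [e]. Horizontal and vertical lines, rays and
    segments are all reached by a choice of [z] and [e]. *)
Lemma cder_is_derive_Re f z e t d : cder f (z + t%:C * e) d ->
  is_derive t 1 (fun t : R => Re (f (z + t%:C * e))) (Re (d * e)).
Proof.
move=> df; apply: is_derive_eps => eps eps0.
have e1 : 0 < normc e + 1 by rewrite ltr_wpDl ?normc_ge0.
have [r r0 H] := df _ (divr_gt0 eps0 e1).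
exists (r / (normc e + 1)); first by rewrite divr_gt0.
move=> h; rewrite ltr_pdivlMr// => hr.
have nh : normc (h%:C * e) = `|h| * normc e by rewrite normcM normcR.
have : normc (h%:C * e) < r.
  rewrite nh; apply: le_lt_trans hr; have := normr_ge0 h; nra.
move=> /H; have -> : z + t%:C * e + h%:C * e = z + (t + h)%:C * e.
  by rewrite rmorphD/=; ring.
move=> {}H; have := le_trans (normc_ge_Re _) H; rewrite nh !ReB => {}H.
have -> : Re (d * e) * h = Re (d * (h%:C * e)).
  by case: (d) (e) => [a b] [a' b'] /=; ring.
apply: (le_trans H); rewrite mulrAC ler_pdivrMr//.
have := normr_ge0 h; have := normc_ge0 e; nra.
Qed.

Lemma cder_is_derive_Im f z e t d : cder f (z + t%:C * e) d ->
  is_derive t 1 (fun t : R => Im (f (z + t%:C * e))) (Im (d * e)).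
Proof.
move=> /(cderZ (- 'i)) /cder_is_derive_Re.
have E w : Re (- 'i * w) = Im w by case: w => a b /=; ring.
under eq_fun do rewrite E.
by rewrite -mulrA E.
Qed.

Lemma MVT_deriv (f df : R -> R) (a b : R) : a <= b ->
  (forall x, a <= x <= b -> is_derive x 1 f (df x)) ->
  exists2 c, a <= c <= b & f b - f a = df c * (b - a).
Proof.
move=> ab H; have [||c cab ->] := @MVT_segment R f df a b ab.
- by move=> x; rewrite in_itv/= => /andP[? ?]; apply: H; rewrite !ltW.
- apply: derivable_within_continuous => x; rewrite in_itv/= => xab.
  by case: (H x xab).
by exists c => //; move: cab; rewrite in_itv.
Qed.

Definition seg z w (t : R) : R[i] := z + t%:C * (w - z).

(** The mean value theorem has no complex form, so it is applied to the real part of [u (f w - c w)]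
    for every unimodular [u]. The free constant [c] measures the distance to an affine function;
    [c = 0] gives a Lipschitz estimate. *)
Lemma cder_segment_bound f (f' : R[i] -> R[i]) z w c (B : R) :
  (forall t : R, 0 <= t <= 1 -> cder f (seg z w t) (f' (seg z w t))) ->
  (forall t : R, 0 <= t <= 1 -> normc (f' (seg z w t) - c) <= B) ->
  normc (f w - f z - c * (w - z)) <= B * normc (w - z).
Proof.
move=> df bf.
have B0 : 0 <= B by rewrite (le_trans (normc_ge0 _) (bf 0 _))// lexx ler01.
apply: normc_le_rot => [|u nu]; first by rewrite mulr_ge0 ?normc_ge0.
pose F w := u * (f w - c * w).
have dF (t : R) : 0 <= t <= 1 -> cder F (seg z w t) (u * (f' (seg z w t) - c)).
  move=> t01; apply: cderZ; apply: cderB; first exact: df.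
  by apply: cder_eq (cderZ c (cder_id _)) _; rewrite mulr1.
have [t t01|t t01] := @MVT_deriv (fun t => Re (F (seg z w t)))
  (fun t => Re (u * (f' (seg z w t) - c) * (w - z))) 0 1 ler01.
  by apply: cder_is_derive_Re; exact: dF.
have -> : seg z w 1 = w by rewrite /seg mul1r addrC subrK.
have -> : seg z w 0 = z by rewrite /seg mul0r addr0.
rewrite subr0 mulr1 => E.
have -> : u * (f w - f z - c * (w - z)) = F w - F z by rewrite /F; ring.
rewrite ReB E (le_trans (ler_norm _))// (le_trans (normc_ge_Re _))//.
by rewrite !normcM nu mul1r ler_wpM2r ?normc_ge0// bf.
Qed.

End ComplexDerivative.

(** * Cauchy transforms and their reciprocals *)

Section ComplexIntegral.
Variables (R : realType) (mu : borel_probability R).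
Local Notation T := (measurableTypeR R).
Implicit Types (f g : T -> R[i]) (p q : T -> R).

(** Boundedness gives integrability against a probability measure and, unlike integrability, is kept
    by products. *)
Definition bmeas p := measurable_fun setT p /\ exists B : R, forall t, `|p t| <= B.

Lemma prob1 : mu setT = 1%E.
Proof. exact: probability_setT. Qed.

Lemma bmeas_integrable p : bmeas p -> mu.-integrable setT (EFin \o p).
Proof.
move=> [mp [B pB]]; apply: measurable_bounded_integrable => //.
  by have := ltry (1 : R); rewrite -prob1.
exists B; split; first exact: num_real.
by move=> C BC t _; exact: le_trans (pB t) (ltW BC).
Qed.

Lemma bmeas_cst (c : R) : bmeas (fun=> c).
Proof. by split; [exact: measurable_cst|exists `|c|]. Qed.

Lemma bmeasD p q : bmeas p -> bmeas q -> bmeas (fun t => p t + q t).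
Proof.
move=> [mp [A pA]] [mq [B qB]]; split; first exact: measurable_funD.
by exists (A + B) => t; rewrite (le_trans (ler_normD _ _))// lerD.
Qed.

Lemma bmeasM p q : bmeas p -> bmeas q -> bmeas (fun t => p t * q t).
Proof.
move=> [mp [A pA]] [mq [B qB]]; split; first exact: measurable_funM.
by exists (A * B) => t; rewrite normrM ler_pM.
Qed.

Lemma bmeasN p : bmeas p -> bmeas (fun t => - p t).
Proof.
move=> [mp [A pA]]; split; first exact: measurableT_comp.
by exists A => t; rewrite normrN.
Qed.

Lemma bmeasB p q : bmeas p -> bmeas q -> bmeas (fun t => p t - q t).
Proof. by move=> mp mq; apply: bmeasD => //; exact: bmeasN. Qed.

Lemma Rint_cst (c : R) : Rintegral mu setT (fun=> c) = c.
Proof.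
by rewrite Rintegral_cst//; rewrite -[RHS]mulr1; congr (_ * _); rewrite -[RHS]/(fine 1%E) -prob1.
Qed.

(** A vanishing integral would make [p] zero almost everywhere, hence the whole line a null set. *)
Lemma Rint_gt0 p : bmeas p -> (forall t, 0 < p t) -> 0 < Rintegral mu setT p.
Proof.
move=> bp p0; rewrite lt_def Rintegral_ge0 ?andbT => [|t _]; last exact: ltW.
apply/eqP => I0.
have ip := bmeas_integrable bp.
have : (\int[mu]_(t in setT) `|(EFin \o p) t| = 0)%E.
  under eq_integral do rewrite /= gtr0_norm//.
  have fp := integrable_fin_num measurableT ip.
  by rewrite -(fineK fp); congr EFin.
move/(ae_eq_integral_abs mu measurableT (measurable_int _ ip)) => [N [mN N0 HN]].
have : (mu setT <= mu N)%E.
  apply: le_measure; rewrite ?inE// => t _; apply: HN => /= /(_ I) [] pt0.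
  by have := p0 t; rewrite pt0 ltxx.
by rewrite N0; have := prob1 => /= ->; rewrite lee_fin ler10.
Qed.

Definition cint f : R[i] :=
  Rintegral mu setT (fun t => Re (f t)) +i* Rintegral mu setT (fun t => Im (f t)).

Definition cbm f := bmeas (fun t => Re (f t)) /\ bmeas (fun t => Im (f t)).

Lemma cbm_cst c : cbm (fun=> c). Proof. by split; exact: bmeas_cst. Qed.

Lemma cbmD f g : cbm f -> cbm g -> cbm (fun t => f t + g t).
Proof.
move=> [rf jf] [rg jg]; split.
  by under eq_fun do rewrite ReD; exact: bmeasD.
by under eq_fun do rewrite ImD; exact: bmeasD.
Qed.

Lemma cbmN f : cbm f -> cbm (fun t => - f t).
Proof.
move=> [rf jf]; split.
  by under eq_fun do rewrite ReN; exact: bmeasN.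
by under eq_fun do rewrite ImN; exact: bmeasN.
Qed.

Lemma cbmB f g : cbm f -> cbm g -> cbm (fun t => f t - g t).
Proof. by move=> mf mg; apply: cbmD => //; exact: cbmN. Qed.

Lemma cbmM f g : cbm f -> cbm g -> cbm (fun t => f t * g t).
Proof.
move=> [rf jf] [rg jg]; split.
  by under eq_fun do rewrite ReM; apply: bmeasB; exact: bmeasM.
by under eq_fun do rewrite ImM; apply: bmeasD; exact: bmeasM.
Qed.

Lemma cbmX f n : cbm f -> cbm (fun t => f t ^+ n).
Proof.
move=> mf; elim: n => [|n IH].
  by under eq_fun do rewrite expr0; exact: cbm_cst.
by under eq_fun do rewrite exprS; exact: cbmM.
Qed.

Lemma bmeas_normc_sqr f : cbm f -> bmeas (fun t => normc (f t) ^+ 2).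
Proof.
move=> [rf jf]; under eq_fun do rewrite normc_sqr !expr2.
by apply: bmeasD; exact: bmeasM.
Qed.

Lemma cintD f g : cbm f -> cbm g -> cint (fun t => f t + g t) = cint f + cint g.
Proof.
move=> [rf jf] [rg jg]; apply: complexP; rewrite ?ReD ?ImD /cint/=.
  by under eq_Rintegral do rewrite ReD; rewrite RintegralD//; exact: bmeas_integrable.
by under eq_Rintegral do rewrite ImD; rewrite RintegralD//; exact: bmeas_integrable.
Qed.

Lemma cintZ c f : cbm f -> cint (fun t => c * f t) = c * cint f.
Proof.
move=> [rf jf]; have mc b := bmeas_cst b.
have ib := bmeas_integrable.
apply: complexP; rewrite ?ReM ?ImM /cint/=.
  under eq_Rintegral do rewrite ReM.
  rewrite RintegralB//; try by apply: bmeas_integrable; exact: bmeasM.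
  by rewrite !RintegralZl//; exact: bmeas_integrable.
under eq_Rintegral do rewrite ImM.
rewrite RintegralD//; try by apply: bmeas_integrable; exact: bmeasM.
by rewrite !RintegralZl//; exact: bmeas_integrable.
Qed.

Lemma cint_cst c : cint (fun=> c) = c.
Proof. by rewrite /cint !Rint_cst; case: c. Qed.

Lemma cintN f : cbm f -> cint (fun t => - f t) = - cint f.
Proof.
move=> mf; rewrite -mulN1r -cintZ//; congr cint.
by apply/funext => t; rewrite mulN1r.
Qed.

Lemma cintB f g : cbm f -> cbm g -> cint (fun t => f t - g t) = cint f - cint g.
Proof. by move=> mf mg; rewrite cintD ?cintN//; exact: cbmN. Qed.

Lemma normc_cint_le f p : cbm f -> bmeas p -> (forall t, normc (f t) <= p t) ->
  normc (cint f) <= Rintegral mu setT p.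
Proof.
move=> mf mp fp; apply: normc_le_rot.
  by apply: Rintegral_ge0 => t _; exact: le_trans (normc_ge0 _) (fp t).
move=> u nu; rewrite -cintZ//=; apply: le_Rintegral => //.
- by apply: bmeas_integrable; case: (cbmM (cbm_cst u) mf).
- exact: bmeas_integrable.
move=> t _; rewrite (le_trans (ler_norm _))// (le_trans (normc_ge_Re _))//.
by rewrite normcM nu mul1r.
Qed.

Lemma normc_cint_bound f (B : R) : cbm f -> (forall t, normc (f t) <= B) ->
  normc (cint f) <= B.
Proof. by move=> mf fB; rewrite -[leRHS]Rint_cst normc_cint_le//; exact: bmeas_cst. Qed.

End ComplexIntegral.

Section CauchyKernel.
Variable R : realType.
Implicit Types (z w h : R[i]) (t : R).

(** The Cauchy kernel, written with [1 /] so that its integral is [cauchy_transform] by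
    conversion. *)
Definition ck w t : R[i] := 1 / (w - t%:C).

Lemma ck_den w t : 0 < Im w -> w - t%:C != 0.
Proof. by move=> w0; apply: Im_gt0_neq0; rewrite ImB/= subr0. Qed.

Lemma ck_neq0 w t : 0 < Im w -> ck w t != 0.
Proof. by move=> w0; rewrite /ck mul1r invr_eq0 ck_den. Qed.

Lemma normc_sub_ge_Im w t : 0 < Im w -> Im w <= normc (w - t%:C).
Proof.
by move=> w0; apply: le_trans (normc_ge_Im _); rewrite ImB/= subr0 ler_norm.
Qed.

Lemma normc_ck_le w t : 0 < Im w -> normc (ck w t) <= (Im w)^-1.
Proof.
move=> w0; rewrite /ck mul1r normcV lef_pV2 ?posrE ?normc_sub_ge_Im//.
by rewrite normc_gt0 ck_den.
Qed.

Lemma Im_ck w t : 0 < Im w -> Im (ck w t) = - Im w * normc (ck w t) ^+ 2.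
Proof. by move=> w0; rewrite /ck mul1r Im_inv normcV exprVn ImB/= subr0. Qed.

Lemma Re_ck w t : 0 < Im w -> Re (ck w t) = (Re w - t) * normc (ck w t) ^+ 2.
Proof. by move=> w0; rewrite /ck mul1r Re_inv normcV exprVn ReB/=. Qed.

Lemma bmeas_normc_ck w : 0 < Im w ->
  bmeas ((fun t => normc (ck w t) ^+ 2) : measurableTypeR R -> R).
Proof.
move=> w0; split; last first.
  exists ((Im w)^-1 ^+ 2) => t; rewrite ger0_norm ?sqr_ge0//.
  by rewrite ler_pXn2r ?nnegrE ?normc_ge0 ?invr_ge0 ?(ltW w0)// normc_ck_le.
apply: continuous_measurable_fun => t.
rewrite (_ : (fun _ => _) = fun t => ((Re w - t) ^+ 2 + Im w ^+ 2)^-1); last first.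
  by apply/funext => s; rewrite /ck mul1r normcV exprVn normc_sqr ReB ImB/= subr0.
apply: (@continuousV R R (fun t => (Re w - t) ^+ 2 + Im w ^+ 2)).
  by rewrite gt_eqF// ltr_wpDl ?sqr_ge0// exprn_gt0.
apply: continuousD; last exact: cst_continuous.
by apply: continuousM; (apply: continuousB; [exact: cst_continuous|exact: cvg_id]).
Qed.

Lemma cbm_ck w : 0 < Im w -> cbm (ck w : measurableTypeR R -> R[i]).
Proof.
move=> w0; have [mn _] := bmeas_normc_ck w0; split; last first.
  by under eq_fun do rewrite Im_ck//; apply: bmeasM; [exact: bmeas_cst|exact: bmeas_normc_ck].
split; last first.
  by exists (Im w)^-1 => t; rewrite (le_trans (normc_ge_Re _))// normc_ck_le.
under eq_fun do rewrite Re_ck//.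
apply: measurable_funM => //.
by apply: continuous_measurable_fun => t; apply: continuousB; [exact: cst_continuous|exact: cvg_id].
Qed.

End CauchyKernel.

(** * Second-order expansions of complex functions *)

Section Jets.
Variable R : realType.
Implicit Types (z w h c : R[i]) (f g : R[i] -> R[i]).

(** Second-order expansion with cubic remainder. This is all the analyticity that the maximum
    principle below uses: it can be written down explicitly for Cauchy transforms, and it passes to
    sums and products. *)
Definition jet2 f z c1 c2 := exists K r : R, [/\ 0 <= K, 0 < r &
  forall h, normc h < r ->
    normc (f (z + h) - (f z + c1 * h + c2 * h ^+ 2)) <= K * normc h ^+ 3].

Lemma jet2_cder f z c1 c2 : jet2 f z c1 c2 -> cder f z c1.
Proof.
move=> [K [r [K0 r0 H]]] e e0.
set A := K + normc c2 + 1.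
have A0 : 0 < A by rewrite /A ltr_wpDl// addr_ge0 ?normc_ge0.
exists (Num.min (Num.min r 1) (e / A)); first by rewrite !lt_min r0 ltr01 divr_gt0.
move=> h; rewrite !lt_min ltr_pdivlMr// => /andP[/andP[/H {}H h1] h2].
have -> : f (z + h) - f z - c1 * h =
  (f (z + h) - (f z + c1 * h + c2 * h ^+ 2)) + c2 * h ^+ 2 by ring.
apply: le_trans (normcD_le _ _) _; rewrite normcM normcX.
have := normc_ge0 h; have := normc_ge0 c2.
move: H h1 h2; set n := normc h; set b := normc c2 => H h1 h2 b0 n0.
apply: (@le_trans _ _ (n * A * n)); last by nra.
apply: (@le_trans _ _ (K * n ^+ 3 + b * n ^+ 2)); first by lra.
have n20 := sqr_ge0 n.
have n32 : n ^+ 3 <= n ^+ 2 by rewrite exprS; nra.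
by rewrite (_ : n * A * n = A * n ^+ 2) /A -?/b; [nra|ring].
Qed.

Lemma jet2_cst c z : jet2 (fun=> c) z 0 0.
Proof.
exists 0, 1; split => // h _.
by rewrite !mul0r !addr0 subrr normc0.
Qed.

Lemma jet2_id z : jet2 id z 1 0.
Proof.
exists 0, 1; split => // h _.
by rewrite !mul0r !addr0 mul1r subrr normc0.
Qed.

Lemma jet2D f g z a1 a2 b1 b2 : jet2 f z a1 a2 -> jet2 g z b1 b2 ->
  jet2 (fun w => f w + g w) z (a1 + b1) (a2 + b2).
Proof.
move=> [K [r [K0 r0 H]]] [K' [r' [K0' r0' H']]].
exists (K + K'), (Num.min r r'); rewrite addr_ge0// lt_min r0 r0'; split => // h.
rewrite lt_min => /andP[/H {}H /H' {}H'].
have -> : f (z + h) + g (z + h) - (f z + g z + (a1 + b1) * h + (a2 + b2) * h ^+ 2) =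
  (f (z + h) - (f z + a1 * h + a2 * h ^+ 2)) + (g (z + h) - (g z + b1 * h + b2 * h ^+ 2)).
  by ring.
by rewrite (le_trans (normcD_le _ _))// mulrDl lerD.
Qed.

Lemma jet2_bound (f0 a1 a2 h : R[i]) : normc h <= 1 ->
  normc (f0 + a1 * h + a2 * h ^+ 2) <= normc f0 + normc a1 + normc a2.
Proof.
move=> h1; rewrite (le_trans (normcD_le _ _))//; apply: lerD.
  rewrite (le_trans (normcD_le _ _))// lerD2l normcM.
  by have := normc_ge0 a1; have := normc_ge0 h; nra.
rewrite normcM normcX; have := normc_ge0 a2.
have : normc h ^+ 2 <= 1 by rewrite exprn_ile1 ?normc_ge0.
nra.
Qed.

Lemma jet2M f g z a1 a2 b1 b2 : jet2 f z a1 a2 -> jet2 g z b1 b2 ->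
  jet2 (fun w => f w * g w) z (a1 * g z + f z * b1) (a2 * g z + a1 * b1 + f z * b2).
Proof.
move=> [K [r [K0 r0 H]]] [K' [r' [K0' r0' H']]].
set A := normc (f z) + normc a1 + normc a2.
set B := normc (g z) + normc b1 + normc b2.
have A0 : 0 <= A by rewrite !addr_ge0 ?normc_ge0.
have B0 : 0 <= B by rewrite !addr_ge0 ?normc_ge0.
set E := normc (a1 * b2 + a2 * b1) + normc (a2 * b2).
have E0 : 0 <= E by rewrite !addr_ge0 ?normc_ge0.
exists (A * K' + K * (B + K') + E), (Num.min (Num.min r r') 1); split.
- by apply: addr_ge0 => //; apply: addr_ge0; apply: mulr_ge0 => //; exact: addr_ge0.
- by rewrite !lt_min r0 r0' ltr01.
move=> h; rewrite !lt_min => /andP[/andP[/H {}H /H' {}H'] /ltW h1].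
set pf := f z + a1 * h + a2 * h ^+ 2 in H *.
set pg := g z + b1 * h + b2 * h ^+ 2 in H' *.
(* Three sources of error are kept apart: the remainder of [g], that of [f], and the terms of degree
   above 2 in the product of the two polynomials, bounded by [E]. *)
have -> : f (z + h) * g (z + h) - (f z * g z + (a1 * g z + f z * b1) * h
    + (a2 * g z + a1 * b1 + f z * b2) * h ^+ 2) =
  pf * (g (z + h) - pg) + (f (z + h) - pf) * (pg + (g (z + h) - pg))
  + ((a1 * b2 + a2 * b1) + a2 * b2 * h) * h ^+ 3 by rewrite /pf /pg; ring.
have h0 := normc_ge0 h.
have n30 : 0 <= normc h ^+ 3 by rewrite exprn_ge0.
have n31 : normc h ^+ 3 <= 1 by rewrite exprn_ile1.
have pfA : normc pf <= A by exact: jet2_bound.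
have pgB : normc pg <= B by exact: jet2_bound.
rewrite (le_trans (normcD_le _ _))// [leRHS]mulrDl lerD//; last first.
  rewrite normcM normcX ler_wpM2r// (le_trans (normcD_le _ _))// lerD2l normcM.
  have := normc_ge0 (a2 * b2); nra.
rewrite (le_trans (normcD_le _ _))// [leRHS]mulrDl; apply: lerD; rewrite normcM.
  by rewrite -mulrA; apply: ler_pM; rewrite ?normc_ge0.
rewrite mulrAC; apply: ler_pM; rewrite ?normc_ge0//.
by rewrite (le_trans (normcD_le _ _))// lerD// (le_trans H')// ler_piMr.
Qed.

Lemma jet2_inv z c : z != c ->
  jet2 (fun w => (w - c)^-1) z (- (z - c)^-1 ^+ 2) ((z - c)^-1 ^+ 3).
Proof.
rewrite -subr_eq0; set v := z - c => v0.
have n0 : 0 < normc v by rewrite normc_gt0.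
exists (2 * (normc v)^-1 ^+ 4), (normc v / 2); split => [||h hv].
- by rewrite mulr_ge0// exprn_ge0// invr_ge0 normc_ge0.
- by rewrite divr_gt0.
have m : normc v / 2 <= normc (v + h).
  by have := normc_geB v (- h); rewrite opprK normcNE; lra.
have vh0 : v + h != 0 by rewrite -normc_gt0; lra.
have -> : (z + h - c)^-1 - (v^-1 + - v^-1 ^+ 2 * h + v^-1 ^+ 3 * h ^+ 2)
   = - (v^-1 ^+ 3 * (v + h)^-1) * h ^+ 3.
  by rewrite (_ : z + h - c = v + h) /v; [field|ring]; rewrite ?v0 -?/v ?vh0.
rewrite normcM normcX normcNE normcM normcX !normcV ler_wpM2r ?exprn_ge0 ?normc_ge0//.
rewrite (_ : 2 * _ = (normc v)^-1 ^+ 3 * (normc v / 2)^-1); last by rewrite invfM invrK; ring.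
apply: ler_wpM2l; first by rewrite exprn_ge0 ?invr_ge0 ?normc_ge0.
by rewrite lef_pV2 ?posrE ?normc_gt0// divr_gt0.
Qed.

End Jets.

Section CauchyTransform.
Variables (R : realType) (mu : borel_probability R).
Implicit Types (z w h c : R[i]).

(** Multiplied by [(-1)^(n-1) (n-1)!], this is the derivative of order [n - 1] of the Cauchy
    transform, for [n >= 1]. *)
Definition Gn n w : R[i] := cint mu (fun t => ck w t ^+ n).
Local Notation G := (cauchy_transform mu).

Lemma GE w : G w = Gn 1 w. Proof. by []. Qed.

Lemma cbm_ckX w n : 0 < Im w -> cbm ((fun t => ck w t ^+ n) : measurableTypeR R -> R[i]).
Proof. by move=> w0; apply: cbmX; exact: cbm_ck. Qed.

Lemma Im_half w h : 0 < Im w -> normc h < Im w / 2 -> Im w / 2 < Im (w + h).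
Proof.
move=> w0 hw; rewrite ImD; have := normc_ge_Im h.
by have := ler_norm (- Im h); rewrite normrN; lra.
Qed.

Lemma normc_ck_half w h t : 0 < Im w -> normc h < Im w / 2 ->
  normc (ck (w + h) t) <= 2 / Im w.
Proof.
move=> w0 hw; have hi := Im_half w0 hw; have i0 : 0 < Im (w + h) by lra.
apply: le_trans (normc_ck_le t i0) _.
rewrite -(invrK 2) -invfM lef_pV2 ?posrE ?mulr_gt0 ?invr_gt0//; lra.
Qed.

(** A remainder bound uniform in [t] survives integration against a probability measure with the
    same constant, so that differentiation under the integral takes no limit theorem. *)
Lemma cint_jet (f : R[i] -> measurableTypeR R -> R[i]) (g1 g2 : measurableTypeR R -> R[i]) z (K r : R) :
  0 <= K -> 0 < r ->
  (forall h, normc h < r -> cbm (f (z + h))) -> cbm g1 -> cbm g2 ->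
  (forall h t, normc h < r ->
    normc (f (z + h) t - (f z t + g1 t * h + g2 t * h ^+ 2)) <= K * normc h ^+ 3) ->
  jet2 (fun w => cint mu (f w)) z (cint mu g1) (cint mu g2).
Proof.
move=> K0 r0 mf m1 m2 H; exists K, r; split => // h hr.
have mfz : cbm (f z) by rewrite -[z]addr0; apply: mf; rewrite normc0.
have mfh := mf h hr.
rewrite [cint mu g1 * h]mulrC [cint mu g2 * _]mulrC -!cintZ//.
have mh1 : cbm (fun t => h * g1 t) by apply: cbmM => //; exact: cbm_cst.
have mh2 : cbm (fun t => h ^+ 2 * g2 t) by apply: cbmM => //; exact: cbm_cst.
have mD := cbmD mfz mh1.
rewrite -cintD// -cintD// -cintB//; last exact: cbmD.
apply: normc_cint_bound => [|t]; first by apply: cbmB => //; exact: cbmD.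
by have := H h t hr; rewrite ![h * _]mulrC ![h ^+ 2 * _]mulrC.
Qed.

(** The geometric series of the kernel, cut after three terms, has the exact remainder
    [- ck w t ^+ 3 * ck (w + h) t * h ^+ 3]; it is bounded uniformly in [t] while [|h|] stays below
    half the height of [w]. *)
Lemma jet2_G1 w : 0 < Im w -> jet2 (Gn 1) w (- Gn 2 w) (Gn 3 w).
Proof.
move=> w0; have i0 : 0 <= (Im w)^-1 by rewrite invr_ge0 ltW.
have mk n := cbm_ckX n w0.
rewrite -cintN//; apply: (@cint_jet (fun w t => ck w t ^+ 1) _ _ w ((Im w)^-1 ^+ 3 * (2 / Im w)) (Im w / 2)).
- by rewrite mulr_ge0 ?exprn_ge0 ?mulr_ge0.
- by rewrite divr_gt0.
- by move=> h hw; apply: cbm_ckX; have := Im_half w0 hw; lra.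
- exact: cbmN.
- exact: mk.
move=> h t hw; have whi : 0 < Im (w + h) by have := Im_half w0 hw; lra.
have -> : ck (w + h) t ^+ 1 - (ck w t ^+ 1 + - ck w t ^+ 2 * h + ck w t ^+ 3 * h ^+ 2)
   = - (ck w t ^+ 3 * ck (w + h) t) * h ^+ 3.
  rewrite /ck !expr1; have := ck_den t w0; have := ck_den t whi.
  by move=> a b; field; rewrite a b.
rewrite normcM normcX normcNE normcM normcX.
by rewrite ler_pM ?mulr_ge0 ?exprn_ge0 ?normc_ge0// ler_pM ?exprn_ge0 ?normc_ge0 ?normc_ck_half//
  ler_pXn2r ?nnegrE ?normc_ge0// normc_ck_le.
Qed.

Lemma jet2_G2 w : 0 < Im w -> jet2 (Gn 2) w (- 2 * Gn 3 w) (3 * Gn 4 w).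
Proof.
move=> w0; have i0 : 0 <= (Im w)^-1 by rewrite invr_ge0 ltW.
have mk n := cbm_ckX n w0.
rewrite -!cintZ//; apply: (@cint_jet (fun w t => ck w t ^+ 2) _ _ w
   ((2 / Im w) ^+ 2 * (6 * (Im w)^-1 ^+ 3)) (Im w / 2)).
- by rewrite mulr_ge0 ?exprn_ge0 ?mulr_ge0 ?exprn_ge0.
- by rewrite divr_gt0.
- by move=> h hw; apply: cbm_ckX; have := Im_half w0 hw; lra.
- by apply: cbmM => //; exact: cbm_cst.
- by apply: cbmM => //; exact: cbm_cst.
move=> h t hw; have whi : 0 < Im (w + h) by have := Im_half w0 hw; lra.
have -> : ck (w + h) t ^+ 2 - (ck w t ^+ 2 + - 2 * ck w t ^+ 3 * h + 3 * ck w t ^+ 4 * h ^+ 2)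
   = - (ck (w + h) t ^+ 2 * (4 * ck w t ^+ 3 + 3 * (h * ck w t) * ck w t ^+ 3)) * h ^+ 3.
  rewrite /ck; have := ck_den t w0; have := ck_den t whi.
  by move=> a b; field; rewrite a b.
have nck := normc_ck_le t w0; have nck0 := normc_ge0 (ck w t).
have c3 : normc (ck w t) ^+ 3 <= (Im w)^-1 ^+ 3 by rewrite ler_pXn2r ?nnegrE.
have hc : normc (h * ck w t) <= 1 / 2.
  rewrite normcM (le_trans (ler_pM _ _ (ltW hw) nck)) ?normc_ge0//.
  by rewrite mulrAC divff ?gt_eqF.
rewrite normcM [normc (h ^+ 3)]normcX normcNE normcM [normc (_ ^+ 2)]normcX.
rewrite ler_pM ?mulr_ge0 ?exprn_ge0 ?normc_ge0// ler_pM ?exprn_ge0 ?normc_ge0//.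
  by rewrite ler_pXn2r ?nnegrE ?normc_ge0 ?normc_ck_half// mulr_ge0.
have n4 : normc (4 : R[i]) = 4.
  by rewrite (_ : 4 = (4 : R)%:C) ?normcR ?ger0_norm// rmorph_nat.
have n3 : normc (3 : R[i]) = 3.
  by rewrite (_ : 3 = (3 : R)%:C) ?normcR ?ger0_norm// rmorph_nat.
apply: le_trans (normcD_le _ _) _.
rewrite [normc (4 * _)]normcM [normc (3 * _ * _)]normcM [normc (3 * _)]normcM n3 n4 normcX.
have := exprn_ge0 3 nck0; nra.
Qed.

End CauchyTransform.

Section Nevanlinna.
Variables (R : realType) (mu : borel_probability R).
Implicit Types (z w h c : R[i]).
Local Notation G := (cauchy_transform mu).
Local Notation F := (reciprocal_cauchy_transform mu).

Definition ck_energy w : R := Rintegral mu setT (fun t => normc (ck w t) ^+ 2).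

Lemma Im_G w : 0 < Im w -> Im (G w) = - Im w * ck_energy w.
Proof.
move=> w0; rewrite /cauchy_transform/=.
under eq_Rintegral do rewrite Im_ck//.
by rewrite RintegralZl//; apply: bmeas_integrable; exact: bmeas_normc_ck.
Qed.

Lemma ck_energy_gt0 w : 0 < Im w -> 0 < ck_energy w.
Proof.
move=> w0; apply: Rint_gt0 => [|t]; first exact: bmeas_normc_ck.
by rewrite exprn_gt0// normc_gt0 ck_neq0.
Qed.

Lemma Im_G_lt0 w : 0 < Im w -> Im (G w) < 0.
Proof. by move=> w0; rewrite Im_G// mulNr oppr_lt0 mulr_gt0 ?ck_energy_gt0. Qed.

Lemma G_neq0 w : 0 < Im w -> G w != 0.
Proof. by move=> /Im_G_lt0; apply: contraTneq => ->; rewrite ltxx. Qed.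

(** With the kernel seen as a random variable of mean [G w], this is its variance. Since
    [Im F / Im w] is the second moment over the squared mean, the gain of [Im F] over [Im w] is
    governed by it. *)
Lemma ck_variance w : 0 < Im w ->
  Rintegral mu setT (fun t => normc (ck w t - G w) ^+ 2)
  = ck_energy w - normc (G w) ^+ 2.
Proof.
move=> w0; have [br bi] := cbm_ck w0; have bn := bmeas_normc_ck w0.
set m := G w.
have bc (c : R) p : bmeas p -> bmeas (fun t : measurableTypeR R => c * p t).
  by move=> bp; apply: bmeasM => //; exact: bmeas_cst.
have E t : normc (ck w t - m) ^+ 2 = (normc (ck w t) ^+ 2 + normc m ^+ 2) -
   (2 * Re m * Re (ck w t) + 2 * Im m * Im (ck w t)).
  by rewrite !normc_sqr ReB ImB; ring.
under eq_Rintegral do rewrite E.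
rewrite RintegralB//; last 2 first.
  apply: bmeas_integrable; apply: bmeasD => //; exact: bmeas_cst.
  by apply: bmeas_integrable; apply: bmeasD; exact: bc.
rewrite RintegralD//; [|exact: bmeas_integrable|exact/bmeas_integrable/bmeas_cst].
rewrite RintegralD//; [|exact/bmeas_integrable/bc|exact/bmeas_integrable/bc].
rewrite Rint_cst -/(ck_energy w).
rewrite !RintegralZl//; try exact: bmeas_integrable.
have -> : Rintegral mu setT (fun t => Re (ck w t)) = Re m by [].
have -> : Rintegral mu setT (fun t => Im (ck w t)) = Im m by [].
by rewrite normc_sqr; ring.
Qed.

Lemma normc_G_le w : 0 < Im w -> normc (G w) ^+ 2 <= ck_energy w.
Proof.
move=> w0; rewrite -subr_ge0 -ck_variance//.
by apply: Rintegral_ge0 => t _; exact: sqr_ge0.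
Qed.

(** Zero variance makes the kernel almost surely constant, and [t |-> ck w t] is injective: the
    measure charges a single point. *)
Lemma point_mass_of_energy w : 0 < Im w -> normc (G w) ^+ 2 = ck_energy w ->
  point_mass mu.
Proof.
move=> w0 VE; pose p (t : measurableTypeR R) := normc (ck w t - G w) ^+ 2.
have bp : bmeas p.
  by apply: bmeas_normc_sqr; apply: cbmB; [exact: cbm_ck|exact: cbm_cst].
have ip := bmeas_integrable mu bp.
have I0 : (\int[mu]_(t in setT) `|(EFin \o p) t| = 0)%E.
  under eq_integral do rewrite /= ger0_norm ?sqr_ge0//.
  have fp := integrable_fin_num measurableT ip.
  rewrite -(fineK fp); congr EFin; have := ck_variance w0.
  by rewrite -VE subrr.
have [N [mN N0 HN]] := (ae_eq_integral_abs mu measurableT (measurable_int _ ip)).1 I0.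
have ex t : ~ N t -> ck w t = G w.
  move=> nNt; apply/eqP; rewrite -subr_eq0 -normc_eq0 -sqrf_eq0.
  apply/negP => /negP pt; apply: nNt; apply: HN => /= /(_ Logic.I) [] E.
  by rewrite -/(p t) E eqxx in pt.
have [t0 nNt0] : exists t, ~ N t.
  apply/existsNP => NT.
  have : (mu setT <= mu N)%E by apply: le_measure; rewrite ?inE// => t _; exact: NT.
  by rewrite N0; have := prob1 mu => /= ->; rewrite lee_fin ler10.
have inj t : ~ N t -> t = t0.
  move=> /ex; rewrite -(ex _ nNt0) /ck !mul1r => /invr_inj/eqP.
  rewrite (inj_eq (addrI w)) eqr_opp => /eqP; exact: complexI.
exists t0 => S mS; rewrite diracE.
have [St0|nSt0] := boolP (t0 \in S); last first.
  apply/eqP; rewrite -measure_le0 -N0 le_measure ?inE// => t St; apply: contrapT => nNt; have tt0 := inj _ nNt.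
  by move: nSt0; rewrite -tt0 => /negP; apply; rewrite inE.
have : mu (~` S) = 0%E.
  apply/eqP; rewrite -measure_le0 -N0 le_measure ?inE//; first exact: measurableC.
  move=> t nSt; apply: contrapT => nNt; have tt0 := inj _ nNt; apply: nSt; rewrite tt0.
  by rewrite inE in St0.
rewrite probability_setC// => /eqP; rewrite sube_eq ?fin_num_measure//.
by rewrite add0e eq_sym => /eqP.
Qed.

Lemma F_E w : F w = (G w)^-1. Proof. by []. Qed.

Lemma Im_F w : 0 < Im w -> Im (F w) = Im w * (ck_energy w / normc (G w) ^+ 2).
Proof. by move=> w0; rewrite F_E Im_inv Im_G// !mulNr opprK mulrA. Qed.

Lemma normc_G_gt0 w : 0 < Im w -> 0 < normc (G w) ^+ 2.
Proof. by move=> w0; rewrite exprn_gt0// normc_gt0 G_neq0. Qed.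

Lemma Im_F_ge w : 0 < Im w -> Im w <= Im (F w).
Proof.
move=> w0; rewrite Im_F// ler_peMr ?(ltW w0)//.
by rewrite ler_pdivlMr ?normc_G_gt0// mul1r normc_G_le.
Qed.

Lemma Im_F_gt w : ~ point_mass mu -> 0 < Im w -> Im w < Im (F w).
Proof.
move=> npm w0; rewrite Im_F// ltr_pMr// ltr_pdivlMr ?normc_G_gt0// mul1r.
rewrite lt_neqAle normc_G_le// andbT; apply/eqP => /point_mass_of_energy.
by move=> /(_ w0).
Qed.

Lemma cder_G w : 0 < Im w -> cder G w (- Gn mu 2 w).
Proof. by move=> w0; apply: jet2_cder; exact: jet2_G1. Qed.

Lemma cder_G2 w : 0 < Im w -> cder (Gn mu 2) w (- 2 * Gn mu 3 w).
Proof. by move=> w0; apply: jet2_cder; exact: jet2_G2. Qed.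

Definition dF w : R[i] := Gn mu 2 w / (G w) ^+ 2.

Lemma cder_F w : 0 < Im w -> cder F w (dF w).
Proof.
move=> w0; apply: cder_eq (cderV (G_neq0 w0) (cder_G w0)) _.
by rewrite opprK.
Qed.

End Nevanlinna.

(** * Inverting F on a cone *)

Section Cone.
Variables (R : realType) (mu : borel_probability R).
Implicit Types (z w h c : R[i]).
Local Notation G := (cauchy_transform mu).
Local Notation F := (reciprocal_cauchy_transform mu).
Local Notation T := (measurableTypeR R).

(** Bound for [|w ck w t - 1| = |t| / |w - t|] on the cone [cone2] when [rho <= |w|]. The cap 4
    covers large [t], through [1 + 9/4 <= 4]; the factor 3 comes from
    [|w - t| >= Im w >= 4/9 |w|]. *)
Definition tail (rho : R) (t : R) : R := Num.min 4 (3 * `|t| / rho).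

Lemma tail_ge0 rho t : 0 < rho -> 0 <= tail rho t.
Proof. by move=> r0; rewrite le_min ler0n/= divr_ge0// ?mulr_ge0// ltW. Qed.

Lemma bmeas_tail rho : 0 < rho -> bmeas (tail rho : T -> R).
Proof.
move=> r0; split; last first.
  by exists 4 => t; rewrite ger0_norm ?tail_ge0// ge_min lexx.
apply: measurable_minr; first exact: measurable_cst.
by apply: measurable_funM => //; apply: measurable_funM.
Qed.

(** Dominated convergence along the integers, then monotonicity of [tail] in [rho]. *)
Lemma tail_small (e : R) : 0 < e -> exists2 rho0 : R, 0 < rho0 &
  forall rho, rho0 <= rho -> Rintegral mu setT (tail rho) <= e.
Proof.
move=> e0.
have cv : (\int[mu]_(t in setT) (tail n.+1%:R t)%:E @[n --> \oo] --> \int[mu]_(t in setT) 0%:E)%E.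
  apply: (@dominated_cvg _ _ _ mu setT measurableT _ _ (fun=> EFin (4 : R))).
  - by move=> n; apply/measurable_EFinP; case: (@bmeas_tail n.+1%:R _).
  - move=> t _; apply/cvg_EFin; first by near=> n.
    apply/cvgrPdist_le => eps eps0; near=> n.
    rewrite /= sub0r normrN ger0_norm ?tail_ge0// ge_min; apply/orP; right.
    rewrite ler_pdivrMr// [eps * _]mulrC -ler_pdivrMr//.
    near: n; exists (Num.truncn (3 * `|t| / eps)) => // n /= hn.
    by apply: (le_trans (ltW (truncnS_gt _))); rewrite ler_nat ltnS.
  - by [].
  - exact: (bmeas_integrable mu (bmeas_cst (4 : R))).
  - by move=> n t _; rewrite /= lee_fin ger0_norm ?tail_ge0// ge_min lexx.
move: cv; rewrite integral0 => /fine_cvgP[_].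
move/cvgrPdist_le => /(_ _ e0)[N _ HN].
exists N.+1%:R => // rho hr; have r0 : 0 < rho by apply: lt_le_trans hr.
have := HN N (leqnn N); rewrite /= sub0r normrN => /(le_trans (ler_norm _)).
apply: le_trans; apply: le_Rintegral => //.
- by apply: bmeas_integrable; exact: bmeas_tail.
- by apply: bmeas_integrable; exact: bmeas_tail.
move=> t _; rewrite /tail le_min ge_min lexx /= ge_min; apply/orP; right.
by rewrite ler_wpM2l ?mulr_ge0// lef_pV2 ?posrE.
Unshelve. all: by end_near. Qed.

(** Wider than the cone of aperture 1 on which the inverse is built, so that the iteration has room
    to move. *)
Definition cone2 w := 0 < Im w /\ `|Re w| < 2 * Im w.

Lemma cone2_norm w : cone2 w -> normc w <= 9 / 4 * Im w.
Proof.
move=> [y0 xy]; apply: ger0_ler_sqr; first by rewrite mulr_ge0 ?divr_ge0// ltW.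
rewrite normc_sqr -(real_normK (num_real (Re w))).
have := normr_ge0 (Re w); nra.
Qed.

Lemma cone_kernel w rho t : cone2 w -> 0 < rho -> rho <= normc w ->
  normc (w * ck w t - 1) <= tail rho t.
Proof.
move=> cw r0 rw; have [y0 _] := cw.
have nd := normc_sub_ge_Im t y0; have nw := cone2_norm cw.
set n := normc (w - t%:C) in nd; have n0 : 0 < n by exact: lt_le_trans nd.
have -> : w * ck w t - 1 = t%:C * (w - t%:C)^-1.
  by rewrite /ck; field; exact: ck_den.
rewrite normcM normcV normcR -/n /tail le_min; apply/andP; split.
  rewrite ler_pdivrMr//.
  have : `|t| <= n + normc w.
    by rewrite -normcR -(subrK w t%:C) (le_trans (normcD_le _ _))// lerD2r normcB.
  lra.
apply: (@le_trans _ _ (`|t| * (3 / rho))); last by rewrite mulrCA mulrA.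
rewrite ler_wpM2l// -(invrK (3 / rho)) lef_pV2 ?posrE// ?invf_div ?divr_gt0//.
rewrite ler_pdivrMr//; lra.
Qed.

Let ctr w t := w * ck w t.

Lemma cbm_ctr w : 0 < Im w -> cbm (ctr w : T -> R[i]).
Proof. by move=> w0; apply: cbmM; [exact: cbm_cst|exact: cbm_ck]. Qed.

Lemma cone_G w rho : cone2 w -> 0 < rho -> rho <= normc w ->
  normc (w * G w - 1) <= Rintegral mu setT (tail rho).
Proof.
move=> cw r0 rw; have [y0 _] := cw.
have -> : w * G w - 1 = cint mu (fun t => ctr w t - 1).
  have mk := cbm_ck y0.
  by rewrite cintB; [rewrite cint_cst cintZ|exact: cbm_ctr|exact: cbm_cst].
apply: normc_cint_le.
- by apply: cbmB; [exact: cbm_ctr|exact: cbm_cst].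
- exact: bmeas_tail.
by move=> t; exact: cone_kernel.
Qed.

(** Two factors within [tail] of 1 have a product within [2 tail + tail^2] of 1, and [tail <= 4]
    turns this into [6 tail]. *)
Lemma cone_G12 w1 w2 rho : cone2 w1 -> cone2 w2 -> 0 < rho ->
  rho <= normc w1 -> rho <= normc w2 ->
  normc (cint mu (fun t => ctr w1 t * ctr w2 t) - 1) <= 6 * Rintegral mu setT (tail rho).
Proof.
move=> c1 c2 r0 r1 r2; have [y1 _] := c1; have [y2 _] := c2.
have m12 : cbm ((fun t => ctr w1 t * ctr w2 t) : T -> R[i]) by apply: cbmM; exact: cbm_ctr.
have bt := bmeas_tail r0.
rewrite -(cint_cst mu 1) -cintB//; last exact: cbm_cst.
rewrite -RintegralZl//; last exact: bmeas_integrable.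
apply: normc_cint_le.
- by apply: cbmB => //; exact: cbm_cst.
- by apply: bmeasM => //; exact: bmeas_cst.
move=> t; have k1 := cone_kernel t c1 r0 r1; have k2 := cone_kernel t c2 r0 r2.
rewrite -/(ctr w1 t) -/(ctr w2 t) in k1 k2.
have -> : ctr w1 t * ctr w2 t - 1 = (ctr w1 t - 1) + (ctr w2 t - 1) + (ctr w1 t - 1) * (ctr w2 t - 1) by ring.
apply: le_trans (normcD_le _ _) _; rewrite normcM.
have := normcD_le (ctr w1 t - 1) (ctr w2 t - 1).
have t4 : tail rho t <= 4 by rewrite ge_min lexx.
have AB : normc (ctr w1 t - 1) * normc (ctr w2 t - 1) <= 4 * tail rho t.
  by apply: ler_pM; rewrite ?normc_ge0// (le_trans k1).
by rewrite -/(tail rho t); lra.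
Qed.

Lemma G_diff w1 w2 : 0 < Im w1 -> 0 < Im w2 ->
  G w2 - G w1 = (w1 - w2) * cint mu (fun t => ck w1 t * ck w2 t).
Proof.
move=> y1 y2; have k1 := cbm_ck y1; have k2 := cbm_ck y2.
rewrite -cintZ; last exact: cbmM.
rewrite -[LHS]/(cint mu (ck w2) - cint mu (ck w1)) -cintB//.
congr cint; apply/funext => t; rewrite /ck; field.
by rewrite !ck_den.
Qed.

(** Far out in the cone [F] is the identity plus a map that is small relative to [|w|] and has a
    small Lipschitz constant. The second fact, which comes from the resolvent identity [G_diff],
    makes the inversion of [F] a contraction argument. *)
Lemma cone_F (e : R) : 0 < e -> e <= 1 -> exists2 rho : R, 0 < rho &
  (forall w, cone2 w -> rho <= normc w -> normc (F w - w) <= e * normc w) /\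
  (forall w1 w2, cone2 w1 -> cone2 w2 -> rho <= normc w1 -> rho <= normc w2 ->
    normc (F w1 - F w2 - (w1 - w2)) <= e * normc (w1 - w2)).
Proof.
(* 36 makes the numerator of the difference estimate at most [e / 6 + 2 e / 36 + e / 36 = e / 4],
   against a denominator of at least 1/4. *)
move=> e0 e1; have e36 : 0 < e / 36 by rewrite divr_gt0.
have [rho r0 /(_ rho (lexx _))] := tail_small e36.
set I := Rintegral _ _ _ => I1.
have X w : cone2 w -> rho <= normc w ->
    [/\ normc (w * G w - 1) <= e / 36, 1 / 2 <= normc (w * G w) & normc (w * G w) <= 2].
  move=> cw rw; have := cone_G cw r0 rw; rewrite -/I => h.
  split; first lra.
  - by have := normc_geB 1 (w * G w); rewrite normcB normc1; lra.
  - by have := normcD_le (w * G w - 1) 1; rewrite subrK normc1; lra.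
exists rho => //; split => [w cw rw|w1 w2 c1 c2 r1 r2].
  have [x1 x2 x3] := X w cw rw; have [y0 _] := cw.
  have w0 : w != 0 by apply: Im_gt0_neq0.
  have g0 := G_neq0 mu y0.
  have -> : F w - w = - (w * G w - 1) / (w * G w) * w.
    by rewrite F_E; field; rewrite w0 g0.
  rewrite normcM ler_wpM2r ?normc_ge0// normcM normcV normcNE ler_pdivrMr; nra.
have [x1 x2 x3] := X w1 c1 r1; have [x1' x2' x3'] := X w2 c2 r2.
have [y1 _] := c1; have [y2 _] := c2.
have wn1 : w1 != 0 by apply: Im_gt0_neq0.
have wn2 : w2 != 0 by apply: Im_gt0_neq0.
have g1 := G_neq0 mu y1; have g2 := G_neq0 mu y2.
have := cone_G12 c1 c2 r0 r1 r2; rewrite -/I.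
have -> : cint mu (fun t => ctr w1 t * ctr w2 t) = w1 * w2 * cint mu (fun t => ck w1 t * ck w2 t).
  rewrite -cintZ; last by apply: cbmM; exact: cbm_ck.
  by congr cint; apply/funext => t; rewrite /ctr; ring.
set N := _ * cint _ _ => hN.
have -> : F w1 - F w2 - (w1 - w2) =
    (N - (w1 * G w1) * (w2 * G w2)) / ((w1 * G w1) * (w2 * G w2)) * (w1 - w2).
  have E : F w1 - F w2 = (w1 - w2) * cint mu (fun t => ck w1 t * ck w2 t) / (G w1 * G w2).
    by rewrite -G_diff// !F_E; field; rewrite g1 g2.
  by rewrite E /N; field; rewrite wn1 wn2 g1 g2.
rewrite normcM ler_wpM2r ?normc_ge0// normcM normcV.
set X1 := w1 * G w1 in x1 x2 x3 *; set X2 := w2 * G w2 in x1' x2' x3' *.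
have q : 1 / 4 <= normc (X1 * X2) by rewrite normcM; nra.
rewrite ler_pdivrMr; last lra.
have -> : N - X1 * X2 = (N - 1) - ((X1 - 1) * X2 + (X2 - 1)) by ring.
apply: le_trans (normc_leB _ _) _.
have := normcD_le ((X1 - 1) * X2) (X2 - 1); rewrite (normcM (X1 - 1)).
have := normc_ge0 (X1 - 1); have := normc_ge0 X2.
nra.
Qed.

End Cone.

Section LocalInverse.
Variables (R : realType) (mu : borel_probability R).
Implicit Types (z w h k c : R[i]).
Local Notation G := (cauchy_transform mu).
Local Notation F := (reciprocal_cauchy_transform mu).

(** Subtracting [2 C 2^-n] makes the sequence nondecreasing: the correction gains exactly [C 2^-n]
    at each step, the largest possible drop of [u]. *)
Lemma geometric_cvg (u : nat -> R) (B C : R) : 0 <= C ->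
  (forall n, `|u n| <= B) -> (forall n, `|u n.+1 - u n| <= C * 2^-1 ^+ n) ->
  exists l : R, u @ \oo --> l.
Proof.
move=> C0 uB uC; pose a n := u n - 2 * C * 2^-1 ^+ n.
have p0 n : 0 <= 2^-1 ^+ n :> R by rewrite exprn_ge0.
have ca : cvgn a.
  apply: nondecreasing_is_cvgn.
    apply/nondecreasing_seqP => n; rewrite /a exprS.
    by have := uC n; rewrite ler_norml => /andP[+ _]; have := p0 n; lra.
  exists B => _ [n _ <-]; rewrite /a (le_trans _ (uB n))// (le_trans _ (ler_norm _))//.
  by rewrite gerBl mulr_ge0// mulr_ge0.
exists (limn a); have -> : u = (fun n => a n + 2 * C * 2^-1 ^+ n).
  by apply/funext => n; rewrite /a subrK.
rewrite -[X in _ --> X]addr0; apply: cvgD => //.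
rewrite -(mulr0 (2 * C)); apply: cvgMr; apply: cvg_expr.
by rewrite ger0_norm// invf_lt1// ltr1n.
Qed.

Lemma complex_geometric_cvg (u : nat -> R[i]) (B C : R) : 0 <= C ->
  (forall n, normc (u n) <= B) -> (forall n, normc (u n.+1 - u n) <= C * 2^-1 ^+ n) ->
  exists l, forall e : R, 0 < e -> exists N, forall n, (N <= n)%N -> normc (u n - l) <= e.
Proof.
move=> C0 uB uC.
have [a ca] : exists l : R, (fun n => Re (u n)) @ \oo --> l.
  apply: (@geometric_cvg _ B C) => // n; first exact: le_trans (normc_ge_Re _) (uB n).
  by rewrite -ReB; exact: le_trans (normc_ge_Re _) (uC n).
have [b cb] : exists l : R, (fun n => Im (u n)) @ \oo --> l.
  apply: (@geometric_cvg _ B C) => // n; first exact: le_trans (normc_ge_Im _) (uB n).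
  by rewrite -ImB; exact: le_trans (normc_ge_Im _) (uC n).
exists (a +i* b) => e e0; have e20 : 0 < e / 2 by rewrite divr_gt0.
move/cvgrPdist_le : ca => /(_ _ e20)[N1 _ H1].
move/cvgrPdist_le : cb => /(_ _ e20)[N2 _ H2].
exists (maxn N1 N2) => n; rewrite geq_max => /andP[n1 n2].
rewrite (le_trans (normc_le_ReIm _))// ReB ImB/= (splitr e).
by rewrite lerD// distrC; [exact: H1|exact: H2].
Qed.

Lemma normc_lim_le (u : nat -> R[i]) l c (B : R) :
  (forall e : R, 0 < e -> exists N, forall n, (N <= n)%N -> normc (u n - l) <= e) ->
  (forall n, normc (u n - c) <= B) -> normc (l - c) <= B.
Proof.
move=> ul uB; apply/ler_addgt0Pl => e e0; have [N /(_ N (leqnn _)) H] := ul e e0.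
have := normc_triangle (u N) l c; have := uB N; rewrite (normcB l (u N)); lra.
Qed.

Local Notation Gam M := (truncated_cone (1 : R) M).

Lemma cone1_norm z (M : R) : 0 < M -> Gam M z -> [/\ M < Im z, 0 < Im z, `|Re z| < Im z,
  Im z <= normc z & normc z <= 3 / 2 * Im z].
Proof.
move=> M0 [Mz]; rewrite mul1r => xy; have y0 : 0 < Im z by exact: lt_trans Mz.
split => //; first by rewrite (le_trans (ler_norm _))// normc_ge_Im.
apply: ger0_ler_sqr; first by rewrite mulr_ge0 ?divr_ge0// ltW.
by rewrite normc_sqr -(real_normK (num_real (Re z))); have := normr_ge0 (Re z); nra.
Qed.

Lemma cone_ball z w (M : R) : 0 < M -> Gam M z -> normc (w - z) <= normc z / 5 ->
  [/\ cone2 w, M / 2 <= normc w & normc w <= 2 * normc z].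
Proof.
move=> M0 /(cone1_norm M0) [Mz y0 xy yn ny] wz.
have := le_trans (normc_ge_Im _) wz; rewrite ImB ler_norml => /andP[i1 i2].
have := le_trans (normc_ge_Re _) wz; rewrite ReB ler_norml => /andP[r1 r2].
move: xy; rewrite ltr_norml => /andP[x1 x2].
have n1 := normc_triangle 0 z w; rewrite subr0 sub0r normcNE normcB in n1.
split; first by split; [lra|rewrite ltr_norml; apply/andP; split; lra].
  have := normc_geB z (z - w); rewrite (normcB z w) (_ : z - (z - w) = w); [lra|ring].
by have := normcD_le (w - z) z; rewrite subrK; lra.
Qed.

(** Fixed point of [w |-> w - (F w - z)], iterated from [z]. The ball of radius [|z| / 8] about [z]
    is preserved because [|F w - w| <= |w| / 16] and [|w| <= 2 |z|] there; the contraction factor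
    1/16 is weakened to the 1/2 of [complex_geometric_cvg]. *)
Lemma F_inverse_at (rho M : R) z : 0 < rho -> 2 * rho <= M ->
  (forall w, cone2 w -> rho <= normc w -> normc (F w - w) <= 1 / 16 * normc w) ->
  (forall w1 w2, cone2 w1 -> cone2 w2 -> rho <= normc w1 -> rho <= normc w2 ->
    normc (F w1 - F w2 - (w1 - w2)) <= 1 / 16 * normc (w1 - w2)) ->
  Gam M z -> exists2 w, normc (w - z) <= normc z / 8 & F w = z.
Proof.
move=> r0 rM H1 H2 Gz; have M0 : 0 < M by lra.
have n0 := normc_ge0 z.
pose u := fix u n := if n is n'.+1 then u n' - (F (u n') - z) else z.
have uS n : u n.+1 - z = - (F (u n) - u n) by rewrite /=; ring.
have ball w : normc (w - z) <= normc z / 8 -> cone2 w /\ rho <= normc w /\ normc w <= 2 * normc z.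
  by move=> wz; have [|? ? ?] := @cone_ball z w M M0 Gz; [lra|split => //; split => //; lra].
have uB n : normc (u n - z) <= normc z / 8.
  elim: n => [|n IH]; first by rewrite /= subrr normc0; lra.
  rewrite uS normcNE; have [b1 [b2 b3]] := ball _ IH.
  by rewrite (le_trans (H1 _ b1 b2))//; lra.
have uC n : normc (u n.+1 - u n) <= (normc z / 8) * 2^-1 ^+ n.
  elim: n => [|n IH]; first by rewrite expr0 mulr1; exact: (uB 1%N).
  have -> : u n.+2 - u n.+1 = - (F (u n.+1) - F (u n) - (u n.+1 - u n)) by rewrite /=; ring.
  have [b1 [b2 b3]] := ball _ (uB n); have [b1' [b2' b3']] := ball _ (uB n.+1).
  rewrite normcNE (le_trans (H2 _ _ b1' b1 b2' b2))// exprS.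
  have := normc_ge0 (u n.+1 - u n); nra.
have [||n|w cw] := @complex_geometric_cvg u (2 * normc z) (normc z / 8); first by lra.
  by move=> n; have [_ [_]] := ball _ (uB n).
  exact: uC.
have wz : normc (w - z) <= normc z / 8 by exact: normc_lim_le cw uB.
exists w => //; have [b1 [b2 b3]] := ball _ wz.
apply/eqP; rewrite -subr_eq0 -normc_eq0; apply/eqP.
apply: le_anti; rewrite normc_ge0 andbT; apply/ler_addgt0Pl => e e0; rewrite addr0.
have e40 : 0 < e / 4 by rewrite divr_gt0.
have [N HN] := cw _ e40.
have h1 := HN N (leqnn _); have h2 := HN N.+1 (leqnSn _).
have [b1' [b2' b3']] := ball _ (uB N).
have := H2 _ _ b1 b1' b2 b2'.
have -> : F w - F (u N) - (w - u N) = (F w - z) - (w - u N.+1) by rewrite /=; ring.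
move=> h3; have := normcD_le (F w - z - (w - u N.+1)) (w - u N.+1).
by rewrite subrK; rewrite normcB in h1; rewrite normcB in h2; lra.
Qed.

(** The lower Lipschitz bound 15/16 of [F] gives injectivity, a nonzero derivative and the
    derivative of the inverse. The last clause says that [F] maps a narrower and higher cone into
    the domain of [g], which later lets statements about [g] be read in terms of [F]. *)
Lemma F_inverse_exists : exists (M : R) (g : R[i] -> R[i]), 0 < M /\
  [/\ forall z, Gam M z -> dF mu (g z) != 0 /\ cder g z (dF mu (g z))^-1,
      forall z, Gam M z -> 0 < Im (g z),
      forall z, Gam M z -> F (g z) = z,
      forall e : R, 0 < e -> exists K : R, forall z, Gam M z -> K < normc z ->
        normc (g z - z) <= e * normc z
    & forall w, 2 * M < Im w -> `|Re w| < Im w / 2 -> Gam M (F w) /\ g (F w) = w].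
Proof.
have e0 : 0 < 1 / 16 :> R by rewrite divr_gt0.
have [|rho r0 [H1 H2]] := cone_F mu e0; first lra.
pose M := 4 * rho; have M0 : 0 < M by rewrite /M; lra.
have Minv z : Gam M z -> exists2 w, normc (w - z) <= normc z / 8 & F w = z.
  by apply: (@F_inverse_at rho) => //; rewrite /M; lra.
have ex z : exists w, Gam M z -> normc (w - z) <= normc z / 8 /\ F w = z.
  have [Gz|nG] := pselect (Gam M z); last by exists 0.
  by have [w ? ?] := Minv _ Gz; exists w.
have [g gP] := choice ex.
have ball z w : Gam M z -> normc (w - z) <= normc z / 5 ->
    [/\ cone2 w, rho <= normc w & normc w <= 2 * normc z].
  by move=> Gz wz; have [c1 c2 c3] := cone_ball M0 Gz wz; split => //; rewrite /M in c2; lra.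
have gB z : Gam M z -> [/\ cone2 (g z), rho <= normc (g z) & normc (g z) <= 2 * normc z].
  by move=> Gz; apply: ball => //; have [? _] := gP _ Gz; have := normc_ge0 z; lra.
have lip w1 w2 : cone2 w1 -> cone2 w2 -> rho <= normc w1 -> rho <= normc w2 ->
    15 / 16 * normc (w1 - w2) <= normc (F w1 - F w2).
  move=> c1 c2 r1 r2; have h := H2 _ _ c1 c2 r1 r2.
  have := normc_leB (F w1 - F w2) (F w1 - F w2 - (w1 - w2)).
  by rewrite (_ : _ - (_ - (w1 - w2)) = w1 - w2); [lra|ring].
exists M, g; split => //; split.
- move=> z Gz; have [Mz y0 xy yn ny] := cone1_norm M0 Gz.
  have [gz1 gz2] := gP _ Gz; have [c1 c2 c3] := gB _ Gz.
  have dFg := cder_F mu (proj1 c1).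
  have open : exists2 r : R, 0 < r & forall h, normc h < r -> Gam M (z + h).
    exists (Num.min ((Im z - M) / 2) ((Im z - `|Re z|) / 2)).
      by rewrite lt_min; apply/andP; split; lra.
    move=> h; rewrite lt_min => /andP[h1 h2]; rewrite /truncated_cone/= ReD ImD mul1r.
    have := normc_ge_Im h; rewrite ler_norml => /andP[? ?]; split; first lra.
    by rewrite (le_lt_trans (ler_normD _ _))//; have := normc_ge_Re h; lra.
  have [r2 r20 Hr2] := open.
  have n0 : 0 < normc z by lra.
  have lipk k : normc k <= normc z / 16 -> 15 / 16 * normc k <= normc (F (g z + k) - F (g z)).
    move=> kz; have [|c1' c2' c3'] := @ball z (g z + k) Gz.
      have -> : g z + k - z = (g z - z) + k by ring.
      by rewrite (le_trans (normcD_le _ _))//; lra.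
    by have := lip _ _ c1' c1 c2' c2; rewrite (_ : g z + k - g z = k)//; ring.
  (* A vanishing derivative would make [F] shrink small increments by 1/2, against the bound
     15/16. *)
  have d0 : dF mu (g z) != 0.
    apply/eqP => d0; have e12 : 0 < 1 / 2 :> R by rewrite divr_gt0.
    have [r rr0 Hr] := dFg _ e12; pose k := Num.min r (normc z / 16) / 2.
    have m0 : 0 < Num.min r (normc z / 16) by rewrite lt_min rr0/=; lra.
    have k0 : 0 < k by rewrite divr_gt0.
    have km : k < Num.min r (normc z / 16) by rewrite /k; lra.
    move: km; rewrite lt_min => /andP[kr kz].
    have nk : normc (k%:C : R[i]) = k by rewrite normcR gtr0_norm.
    have := Hr k%:C; have := lipk k%:C; rewrite nk d0 mul0r subr0.
    by move=> /(_ (ltW kz)) ? /(_ kr) ?; lra.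
  split => //; have D0 : 0 < normc (dF mu (g z)) by rewrite normc_gt0.
  move=> e ee0; have e10 : 0 < e * normc (dF mu (g z)) / 2 by rewrite divr_gt0// mulr_gt0.
  have [r rr0 Hr] := dFg _ e10.
  exists (Num.min r2 (r / 2)); first by rewrite lt_min r20 divr_gt0.
  move=> h; rewrite lt_min => /andP[/Hr2 Gh hr].
  have [gh1 gh2] := gP _ Gh; have [c1' c2' c3'] := gB _ Gh.
  have := lip _ _ c1' c1 c2' c2; rewrite gh2 gz2 addrAC subrr add0r.
  set k := g (z + h) - g z => kh.
have := Hr k; rewrite (_ : g z + k = g (z + h)); last by rewrite /k; ring.
  rewrite gh2 gz2 (_ : z + h - z - _ = h - dF mu (g z) * k); last by ring.
  move=> hk.
  have {}hk : normc (h - dF mu (g z) * k) <= e * normc (dF mu (g z)) / 2 * normc k by apply: hk; lra.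
  have -> : k - (dF mu (g z))^-1 * h = - ((h - dF mu (g z) * k) / dF mu (g z)) by field.
  rewrite normcNE normcM normcV ler_pdivrMr// (le_trans hk)//.
  have q := mulr_ge0 (ltW ee0) (ltW D0).
  have := ler_wpM2l q kh; have := mulr_ge0 q (normc_ge0 h); lra.
- by move=> z Gz; have [[? _] _ _] := gB _ Gz.
- by move=> z Gz; have [] := gP _ Gz.
- move=> e ee0; have em : 0 < Num.min (e / 2) 1 by rewrite lt_min ltr01 divr_gt0.
  have em1 : Num.min (e / 2) 1 <= 1 by rewrite ge_min lexx orbT.
  have [rho' r0' [H1' _]] := cone_F mu em em1.
  exists (2 * rho') => z Gz Kz; have [gz1 gz2] := gP _ Gz; have [c1 c2 c3] := gB _ Gz.
  have n1 := normc_geB z (z - g z); rewrite (normcB z (g z)) (_ : z - (z - g z) = g z) in n1; last by ring.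
  have := H1' _ c1; rewrite gz2 normcB => H.
  have {}H := H _; apply: (le_trans (H _)); first lra.
  have : Num.min (e / 2) 1 <= e / 2 by rewrite ge_min lexx.
  have := normc_ge0 (g z); nra.
move=> w Mw xy; have y0 : 0 < Im w by lra.
have cw : cone2 w by split => //; lra.
have wn : normc w <= 9 / 8 * Im w.
  apply: ger0_ler_sqr; first by lra.
  by rewrite normc_sqr -(real_normK (num_real (Re w))); have := normr_ge0 (Re w); nra.
have yw : Im w <= normc w by rewrite (le_trans (ler_norm _))// normc_ge_Im.
have rw : rho <= normc w by rewrite /M in Mw; lra.
have h1 := H1 _ cw rw.
have GF : Gam M (F w).
  have := le_trans (normc_ge_Im _) h1; rewrite ImB ler_norml => /andP[i1 i2].
  have := le_trans (normc_ge_Re _) h1; rewrite ReB ler_norml => /andP[q1 q2].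
  move: xy; rewrite ltr_norml => /andP[x1 x2].
  by split; [lra|rewrite mul1r ltr_norml; apply/andP; split; lra].
split => //; have [gz1 gz2] := gP _ GF; have [c1 c2 c3] := gB _ GF.
apply/eqP; rewrite -subr_eq0 -normc_eq0; apply/eqP.
by have := lip _ _ c1 cw c2 rw; rewrite gz2 subrr normc0; have := normc_ge0 (g (F w) - w); lra.
Qed.

End LocalInverse.

(** * The functional equation of a stable law *)

Section Affine.
Variable R : realType.
Local Notation T := (measurableTypeR R).

(** The inverse of [x |-> c x + d], so that preimages under it are the images occurring in
    [measure_equiv]. *)
Definition aff (c d : R) : T -> T := fun t => (t - d) / c.

Lemma measurable_aff c d : measurable_fun [set: T] (aff c d).
Proof.
apply: continuous_measurable_fun => t; rewrite /aff.
by apply: cvgM; [apply: cvgB; [exact: cvg_id|exact: cvg_cst]|exact: cvg_cst].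
Qed.

HB.instance Definition _ c d := isMeasurableFun.Build _ _ _ _ (aff c d) (measurable_aff c d).

Definition affine_image (nu : borel_probability R) c d : borel_probability R :=
  distribution nu (aff c d).

Lemma aff_preimage c d (S : set T) : 0 < c -> aff c d @^-1` S = [set c * x + d | x in S].
Proof.
move=> c0; have cn := lt0r_neq0 c0; apply/seteqP; split => t.
  by move=> St; exists ((t - d) / c) => //; rewrite mulrC divfK// subrK.
by move=> [x Sx <-]; rewrite /preimage/= /aff addrK mulrC mulKf.
Qed.

Lemma affine_imageE nu c d S : 0 < c -> affine_image nu c d S = nu [set c * x + d | x in S].
Proof. by move=> c0; rewrite -aff_preimage. Qed.

Lemma measure_equiv_scale (nu : borel_probability R) c : 0 < c ->
  measure_equiv nu (affine_image nu c 0).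
Proof.
move=> c0; exists c^-1, 0; rewrite invr_gt0; split => // S mS.
rewrite affine_imageE//; congr (nu _); apply/seteqP; split => t.
  by move=> St; exists (c^-1 * t + 0); [exists t|rewrite !addr0 mulVKf// lt0r_neq0].
by move=> [_ [s Ss <-] <-]; rewrite !addr0 mulVKf// lt0r_neq0.
Qed.

Lemma Rintegral_affine (mu nu : borel_probability R) c d p : 0 < c ->
  (forall S : set T, measurable S -> mu S = nu [set c * x + d | x in S]) ->
  bmeas p -> Rintegral mu setT p = Rintegral nu setT (fun t => p ((t - d) / c)).
Proof.
move=> c0 H bp; rewrite /Rintegral; congr fine.
rewrite (@eq_measure_integral _ _ _ _ (affine_image nu c d)); last first.
  by move=> A mA _; exact: etrans (H A mA) (esym (affine_imageE nu d A c0)).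
rewrite /affine_image /distribution integral_pushforward//.
- by apply/measurable_EFinP; case: bp.
- have bq : bmeas (p \o aff c d).
    case: bp => mp [B pB]; split; last by exists B => t; exact: pB.
    exact: measurableT_comp mp (measurable_aff c d).
  exact: (bmeas_integrable nu bq).
Qed.

Lemma cauchy_affine (mu nu : borel_probability R) c d z : 0 < c ->
  (forall S : set T, measurable S -> mu S = nu [set c * x + d | x in S]) ->
  0 < Im z -> cauchy_transform mu z = c%:C * cauchy_transform nu (c%:C * z + d%:C).
Proof.
move=> c0 H z0; have cn : c%:C != 0 :> R[i] by rewrite eq_complex/= negb_and lt0r_neq0.
have w0 : 0 < Im (c%:C * z + d%:C) by rewrite ImD ImM/= mul0r !addr0 mulr_gt0.
rewrite -[cauchy_transform nu _]/(cint nu (ck (c%:C * z + d%:C))) -cintZ; last exact: cbm_ck.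
have E t : ck z ((t - d) / c) = c%:C * ck (c%:C * z + d%:C) t.
  have b := ck_den t w0; rewrite /ck.
  have -> : ((t - d) / c)%:C = (t%:C - d%:C) / c%:C :> R[i] by rewrite rmorphM/= fmorphV rmorphB.
  by field; rewrite cn b.
have [b1 b2] := cbm_ck z0.
apply: complexP; rewrite /cint/= (Rintegral_affine c0 H)//; apply: eq_Rintegral => t _. all: by rewrite -/(ck z _) E.
Qed.

Lemma F_affine (mu nu : borel_probability R) c d z : 0 < c ->
  (forall S : set T, measurable S -> mu S = nu [set c * x + d | x in S]) ->
  0 < Im z -> reciprocal_cauchy_transform mu z =
    reciprocal_cauchy_transform nu (c%:C * z + d%:C) / c%:C.
Proof.
by move=> c0 H z0; rewrite !F_E (cauchy_affine c0 H)// invfM mulrC.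
Qed.

Lemma cder_derivable (f : R[i] -> R[i]) z d : cder f z d ->
  derivable (f : R[i]^o -> R[i]^o) z 1.
Proof.
move=> H.
suff C : h^-1 *: (((f : R[i]^o -> R[i]^o) \o shift z) (h *: (1 : R[i]^o)) - f z)
    @[h --> (0 : R[i]^o)^'] --> (d : R[i]^o) by exact: cvgP C.
apply/cvgrPdist_le => e e0.
have {}e0 : e = (Re e)%:C /\ 0 < Re e by move: e0; case: e => a b; rewrite ltcE/= => /andP[/eqP -> ?].
have [eE er] := e0; have [r r0 Hr] := H _ er.
have rC : 0 < r%:C :> R[i] by rewrite ltcR.
have nz : \forall h \near (0 : R[i]^o)^', h != 0 by exact: nbhs_dnbhs_neq.
have nr : \forall h \near (0 : R[i]^o)^', `|h| < r%:C by exact: dnbhs0_lt.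
near=> h.
have h0 : h != 0 by near: h.
have hr : `|h| < r%:C by near: h.
have {}hr : normc h < r by rewrite -ltcR; move: hr; rewrite -normC_normc.
rewrite /= /GRing.scale/= mulr1 (addrC h) eE normC_normc lecR.
have hn : 0 < normc h by rewrite normc_gt0.
rewrite normcB -(ler_pM2r hn) -normcM mulrBl mulrAC mulVf// mul1r.
exact: Hr.
Unshelve. all: by end_near. Qed.

End Affine.

(** * Stability in terms of the inverse of F *)

Section Stability.
Variables (R : realType) (nu : borel_probability R).
Local Notation T := (measurableTypeR R).
Local Notation Gam M := (truncated_cone (1 : R) M).
Local Notation F := (reciprocal_cauchy_transform nu).
Variables (M : R) (g : R[i] -> R[i]).
Hypothesis M0 : 0 < M.
Hypothesis g_der : forall z, Gam M z -> cder g z (dF nu (g z))^-1.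
Hypothesis g_Im : forall z, Gam M z -> 0 < Im (g z).
Hypothesis gF : forall z, Gam M z -> F (g z) = z.
Hypothesis g_asymp : forall e : R, 0 < e -> exists K : R, forall z, Gam M z -> K < normc z ->
        normc (g z - z) <= e * normc z.

Lemma ReZ (a : R) z : Re (a%:C * z) = a * Re z.
Proof. by rewrite ReM/= mul0r subr0. Qed.
Lemma ImZ (a : R) z : Im (a%:C * z) = a * Im z.
Proof. by rewrite ImM/= mul0r addr0. Qed.
Lemma normcZ (a : R) z : 0 < a -> normc (a%:C * z) = a * normc z.
Proof. by move=> a0; rewrite normcM normcR gtr0_norm. Qed.

Lemma cone_scale (a M' : R) z : 0 < a -> M <= a * M' -> Gam M' z -> Gam M (a%:C * z).
Proof.
move=> a0 aM [Mz xy]; rewrite mul1r in xy; split; rewrite ?mul1r ImZ.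
  by rewrite (le_lt_trans aM)// ltr_pM2l.
by rewrite ReZ normrM gtr0_norm// ltr_pM2l.
Qed.

(** If [X] has law [nu] then [mu] is the law of [(X - d) / c], which turns [g] into
    [(g (c z) - d) / c]. The condition [M <= c * M'] keeps [c z] in the cone of [g]. *)
Lemma voiculescu_affine (mu : borel_probability R) (c d M' : R) : 0 < c -> 0 < M' -> M <= c * M' ->
  (forall S : set T, measurable S -> mu S = nu [set c * x + d | x in S]) ->
  is_voiculescu_transform mu 1 M' (fun z => (g (c%:C * z) - d%:C) / c%:C - z).
Proof.
move=> c0 M0' cM H.
have cn : c%:C != 0 :> R[i] by rewrite eq_complex/= negb_and lt0r_neq0.
exists (fun z => (g (c%:C * z) - d%:C) / c%:C) => //.
have Gc z : Gam M' z -> Gam M (c%:C * z) by exact: cone_scale.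
have dC z : Im ((g (c%:C * z) - d%:C) / c%:C) = Im (g (c%:C * z)) / c.
  by rewrite -fmorphV mulrC ImZ ImB/= subr0 mulrC.
split.
- move=> z /Gc Gz; have := g_der Gz; set D := (dF nu _)^-1 => gD.
  apply: (@cder_derivable _ _ _ D) => e e0; have [r r0 Hr] := gD e e0.
  exists (r / c); first by rewrite divr_gt0.
  move=> h hr; have hc : normc (c%:C * h) < r by rewrite normcZ// mulrC -ltr_pdivlMr.
  have {Hr} := Hr _ hc; rewrite -mulrDr normcZ// => Hr.
  have -> : (g (c%:C * (z + h)) - d%:C) / c%:C - (g (c%:C * z) - d%:C) / c%:C - D * h
    = (g (c%:C * (z + h)) - g (c%:C * z) - D * (c%:C * h)) / c%:C by field.
  rewrite normcM normcV normcR gtr0_norm// ler_pdivrMr//.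
  by rewrite (le_trans Hr)// mulrA mulrAC.
- by move=> z /Gc Gz; rewrite /upper_half_plane/= dC divr_gt0// g_Im.
- move=> z Gz; have Gcz := Gc _ Gz.
  rewrite (F_affine c0 H); last by rewrite dC divr_gt0// g_Im.
  have -> : c%:C * ((g (c%:C * z) - d%:C) / c%:C) + d%:C = g (c%:C * z) by field.
  by rewrite gF// mulrC mulKf.
move=> e e0; have e30 : 0 < e / 3 by rewrite divr_gt0.
have [K HK] := g_asymp e30.
exists (Num.max (K / c) (3 * `|d| / (c * e))) => z Gz.
rewrite normC_normc ltcR gt_max => /andP[]; rewrite !ltr_pdivrMr ?mulr_gt0// => K1 K2.
have [_ y0 _ yn _] := cone1_norm M0' Gz.
have n0 : 0 < normc z by exact: lt_le_trans yn.
have z0 : z != 0 by rewrite -normc_gt0.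
rewrite normC_normc ltcR.
have -> : (g (c%:C * z) - d%:C) / c%:C / z - 1 = ((g (c%:C * z) - c%:C * z) - d%:C) / (c%:C * z).
  by field; rewrite cn z0.
have := HK _ (Gc _ Gz); rewrite normcZ// mulrC => /(_ K1) h.
rewrite normcM normcV normcZ// ltr_pdivrMr ?mulr_gt0//.
apply: le_lt_trans (normc_leB _ _) _; rewrite normcR.
have := mulr_gt0 e0 (mulr_gt0 c0 n0); lra.
Qed.

Hypothesis nu_npm : ~ point_mass nu.
Hypothesis nu_stable : forall mu1 mu2 : borel_probability R,
    measure_equiv mu1 nu -> measure_equiv nu mu2 ->
    exists2 lam : borel_probability R,
      is_free_convolution mu1 mu2 lam & measure_equiv lam nu.

Lemma stable_equation (a : R) : 0 < a -> exists c : R, 0 < c /\ exists d : R,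
  forall z, Gam M z -> Gam M (a%:C * z) -> Gam M (c%:C * z) ->
  (g (c%:C * z) - d%:C) / c%:C - z = (g z - z) + (g (a%:C * z) / a%:C - z).
Proof.
move=> a0.
have eq1 S : [set 1 * x + 0 | x in S] = S :> set R.
  apply/seteqP; split => t; first by move=> [s Ss <-]; rewrite mul1r addr0.
  by move=> St; exists t => //; rewrite mul1r addr0.
have e1 : measure_equiv nu nu.
  by exists 1, 0; split => // S mS; rewrite eq1.
have [lam lamF [c [d [c0 Hc]]]] := nu_stable e1 (measure_equiv_scale nu a0).
exists c; split => //; exists d => z Gz Gaz Gcz.
(* Above this height all three transforms exist; the three membership hypotheses say exactly that
   [z] lies in the cone of threshold [M']. *)
pose M' := Num.max M (Num.max (M / a) (M / c)).
have M0' : 0 < M' by rewrite lt_max M0.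
have M1 : M <= 1 * M' by rewrite mul1r le_max lexx.
have Ma : M <= a * M' by rewrite mulrC -ler_pdivrMr// !le_max lexx orbT.
have Mc : M <= c * M' by rewrite mulrC -ler_pdivrMr// !le_max lexx !orbT.
have V1 := @voiculescu_affine nu 1 0 M' ltr01 M0' M1.
have {}V1 := V1 (fun S _ => congr1 nu (esym (eq1 S))).
have V2 := @voiculescu_affine (affine_image nu a 0) a 0 M' a0 M0' Ma (fun S _ => affine_imageE nu 0 S a0).
have V3 := @voiculescu_affine lam c d M' c0 M0' Mc Hc.
have := lamF 1 M' _ _ _ ltr01 M0' V1 V2 V3 z.
rewrite !mul1r !subr0 divr1; apply.
move: Gz Gaz Gcz => [z1 z2] [z3 _] [z4 _]; split => //.
by rewrite !ImZ in z3 z4; rewrite !gt_max z1/= !ltr_pdivrMr// mulrC z3 mulrC z4.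
Qed.

Definition defect z : R := Im z - Im (g z).

Lemma defect_gt0 z : Gam M z -> 0 < defect z.
Proof.
move=> Gz; rewrite /defect subr_gt0 -{2}(gF Gz); apply: Im_F_gt => //.
exact: g_Im.
Qed.

(** The function [k] of the overview. Dividing by [|z|] absorbs the factors [1 / a] and [1 / c] that
    dilation puts in front of the transform. *)
Definition rdef z : R := defect z / normc z.

Lemma rdef_gt0 z : Gam M z -> 0 < rdef z.
Proof.
move=> Gz; rewrite divr_gt0 ?defect_gt0//.
by have [_ y0 _ yn _] := cone1_norm M0 Gz; exact: lt_le_trans yn.
Qed.

Lemma rdef_equation (a : R) : 0 < a -> exists2 c : R, 0 < c &
  forall z, Gam M z -> Gam M (a%:C * z) -> Gam M (c%:C * z) ->
  rdef (c%:C * z) = rdef z + rdef (a%:C * z).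
Proof.
move=> a0; have [c [c0 [d H]]] := stable_equation a0.
exists c => // z Gz Gaz Gcz; have [_ y0 _ yn _] := cone1_norm M0 Gz.
have n0 : normc z != 0 by rewrite lt0r_neq0// (lt_le_trans y0).
have := congr1 (@complex.Im R) (H z Gz Gaz Gcz).
rewrite -!fmorphV ![_ * _%:C]mulrC !(ImD, ImN, ImZ) /= oppr0 addr0 => E.
have E2 : Im (g (c%:C * z)) = c * (Im (g z) - Im z + (a^-1 * Im (g (a%:C * z)))).
  apply: (@mulfI _ c^-1); first by rewrite invr_eq0 lt0r_neq0.
  by rewrite mulKf ?lt0r_neq0//; lra.
rewrite /rdef /defect !ImZ !normcZ// E2; field.
by rewrite n0 !lt0r_neq0.
Qed.

Lemma rdef_small (e : R) : 0 < e -> exists K : R, forall z, Gam M z -> K < normc z -> rdef z <= e.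
Proof.
move=> /g_asymp[K HK]; exists K => z Gz Kz; have := HK z Gz Kz.
have [_ y0 _ yn _] := cone1_norm M0 Gz.
rewrite /rdef ler_pdivrMr ?(lt_le_trans y0)// => h; apply: le_trans h.
by rewrite normcB /defect -ImB (le_trans (ler_norm _))// normc_ge_Im.
Qed.

Lemma cone_up (c : R) z : 1 <= c -> Gam M z -> Gam M (c%:C * z).
Proof.
move=> c1; apply: cone_scale; first exact: lt_le_trans c1.
by rewrite ler_peMl// ltW.
Qed.

Lemma cone_nonempty : Gam M (0 +i* (M + 1)).
Proof. by split; rewrite /= ?mul1r ?normr0 ?ltrDl ?ltr01 ?addr_gt0. Qed.

(** Iteration along [c^n z] would keep [rdef] above its positive initial value, whereas it tends to
    0 at infinity. *)
Lemma rdef_ratio_gt1 (c N : R) : 1 < c -> 1 <= N ->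
  (forall z, Gam M z -> rdef (c%:C * z) = N * rdef z) -> False.
Proof.
move=> c1 N1 H; set z := 0 +i* (M + 1); have Gz : Gam M z := cone_nonempty.
have c0 : 0 < c by lra.
have Gn n : Gam M ((c ^+ n)%:C * z) by apply: cone_up => //; rewrite exprn_ege1// ltW.
have rn n : rdef z <= rdef ((c ^+ n)%:C * z).
  elim: n => [|n IH]; first by rewrite expr0 mul1r.
  rewrite exprS rmorphM/= -mulrA H// (le_trans IH)// ler_peMl// ltW// rdef_gt0//.
have e0 : 0 < rdef z / 2 by rewrite divr_gt0// rdef_gt0.
have [K HK] := rdef_small e0.
have n0 : 0 < normc z by have [_ y0 _ yn _] := cone1_norm M0 Gz; exact: lt_le_trans yn.
have [n nK] : exists n, K < c ^+ n * normc z.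
  have b n : n%:R * (c - 1) <= c ^+ n.
    elim: n => [|n IH]; first by rewrite mul0r expr0.
    have : 1 <= c ^+ n by rewrite exprn_ege1// ltW.
    by rewrite exprS -natr1; nra.
  exists (Num.truncn (`|K| / ((c - 1) * normc z))).+1.
  have := truncnS_gt (`|K| / ((c - 1) * normc z)).
  rewrite ltr_pdivrMr; last by rewrite mulr_gt0//; lra.
  move=> h; apply: le_lt_trans (ler_norm _) _; apply: lt_le_trans h _.
  by rewrite mulrA ler_wpM2r ?normc_ge0.
have := HK _ (Gn n); rewrite normcZ ?exprn_gt0// => /(_ nK).
have := rn n; have := rdef_gt0 Gz; lra.
Qed.

Lemma rdef_ratio_lt1 (c N : R) : 0 < c -> c < 1 -> 0 < N -> N <= 1 ->
  (forall z, Gam M z -> Gam M (c%:C * z) -> rdef (c%:C * z) = N * rdef z) -> False.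
Proof.
move=> c0 c1 N0 N1 H; apply: (@rdef_ratio_gt1 c^-1 N^-1).
- by rewrite invf_gt1.
- by rewrite invf_ge1.
move=> z Gz; have cn : c%:C != 0 :> R[i] by rewrite eq_complex/= negb_and lt0r_neq0.
have E : c%:C * (c^-1%:C * z) = z by rewrite mulrA fmorphV mulfV// mul1r.
have G2 : Gam M (c^-1%:C * z) by apply: cone_up => //; rewrite invf_ge1// ltW.
by have := H _ G2; rewrite E => /(_ Gz) ->; rewrite mulKf// lt0r_neq0.
Qed.

End Stability.

(** * Scaling factors of an additive relation on a cone *)

Section ScalingSequence.
Variables (R : realType) (M : R) (k : R[i] -> R).
Local Notation Gam := (truncated_cone (1 : R) M).
Hypothesis M0 : 0 < M.
Hypothesis k_gt0 : forall z, Gam z -> 0 < k z.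
Hypothesis k_add : forall a : R, 0 < a -> exists2 c : R, 0 < c &
  forall z, Gam z -> Gam (a%:C * z) -> Gam (c%:C * z) ->
  k (c%:C * z) = k z + k (a%:C * z).
Hypothesis k_gt1 : forall c N : R, 1 < c -> 1 <= N ->
  (forall z, Gam z -> k (c%:C * z) = N * k z) -> False.
Hypothesis k_lt1 : forall c N : R, 0 < c -> c < 1 -> 0 < N -> N <= 1 ->
  (forall z, Gam z -> Gam (c%:C * z) -> k (c%:C * z) = N * k z) -> False.
Hypothesis k_cont : forall z, Gam z -> forall e : R, 0 < e -> exists2 r : R, 0 < r &
  forall t : R, `|t - 1| < r -> Gam (t%:C * z) /\ `|k (t%:C * z) - k z| <= e.

Let up (c : R) z : 1 <= c -> Gam z -> Gam (c%:C * z).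
Proof. exact: cone_up. Qed.

Lemma scaleCM (a b : R) (z : R[i]) : a%:C * (b%:C * z) = (a * b)%:C * z.
Proof. by rewrite rmorphM mulrA. Qed.

(** The next factor is the [c] that [k_add] assigns to [a = s n]. If it exceeded [s n], the quotient
    would be a dilation by a factor above 1 that multiplies [k] by [(n+2)/(n+1)], which [k_gt1]
    excludes. As [s n <= 1], the dilation may leave the cone, whence the second membership. *)
Lemma scaling_sequence : exists s : nat -> R, forall n,
  [/\ 0 < s n, s n.+1 <= s n, s n <= 1 &
  forall z, Gam z -> Gam ((s n)%:C * z) -> k ((s n)%:C * z) = n.+1%:R * k z].
Proof.
(* Made total for the axiom of choice; nonpositive [a] receive the dummy value 0. *)
have ex (a : R) : exists c : R, 0 < a -> 0 < c /\
  forall z, Gam z -> Gam (a%:C * z) -> Gam (c%:C * z) -> k (c%:C * z) = k z + k (a%:C * z).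
  have [a0|a0] := ltP 0 a; last by exists 0.
  by have [c c0 H] := k_add a0; exists c.
have [C HC] := choice ex.
pose s := fix s n := if n is n'.+1 then C (s n') else 1.
have step n : [/\ 0 < s n, s n <= 1 &
    forall z, Gam z -> Gam ((s n)%:C * z) -> k ((s n)%:C * z) = n.+1%:R * k z] -> s n.+1 <= s n.
  move=> [s0 s1 Hs]; have [c0 Hc] := HC _ s0; rewrite leNgt; apply/negP => lt.
  have {}lt : s n < C (s n) := lt.
  apply: (@k_gt1 (C (s n) / s n) (n.+2%:R / n.+1%:R)).
  - by rewrite ltr_pdivlMr// mul1r.
  - by rewrite ler_pdivlMr// mul1r ler_nat.
  (* Evaluation at [z / s n], which stays in the cone, turns the relations for the two factors into
     one for their quotient. *)
  move=> z Gz; have G1 : Gam ((s n)^-1%:C * z) by apply: up => //; rewrite invf_ge1.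
  have e1 : (s n)%:C * ((s n)^-1%:C * z) = z.
    by rewrite scaleCM mulfV ?lt0r_neq0// mul1r.
  have e2 : (C (s n))%:C * ((s n)^-1%:C * z) = (C (s n) / s n)%:C * z by rewrite scaleCM.
  have G2 : Gam ((C (s n))%:C * ((s n)^-1%:C * z)).
    by rewrite e2; apply: up => //; rewrite ler_pdivlMr// mul1r ltW.
  have := Hc _ G1; have := Hs _ G1; rewrite e1 => /(_ Gz) k1 /(_ Gz G2).
  have : n.+1%:R != 0 :> R by rewrite pnatr_eq0.
  rewrite e2 => q0 ->; rewrite k1 -[n.+2%:R]natr1.
  by move: (n.+1%:R : R) q0 => q q0; field.
suff P n : [/\ 0 < s n, s n <= 1 &
    forall z, Gam z -> Gam ((s n)%:C * z) -> k ((s n)%:C * z) = n.+1%:R * k z] /\ s n.+1 <= s n.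
  by exists s => n; have [[? ? ?] ?] := P n.
elim: n => [|n [[s0 s1 Hs] ss]].
  have P0 : [/\ 0 < s 0%N, s 0%N <= 1 &
    forall z, Gam z -> Gam ((s 0%N)%:C * z) -> k ((s 0%N)%:C * z) = 1%:R * k z].
    by split => //= z _ _; rewrite !mul1r.
  by split => //; exact: step.
have P1 : [/\ 0 < s n.+1, s n.+1 <= 1 &
    forall z, Gam z -> Gam ((s n.+1)%:C * z) -> k ((s n.+1)%:C * z) = n.+2%:R * k z].
  have [c0 Hc] := HC _ s0; split => //; first exact: le_trans ss s1.
  move=> z Gz Gs; have Gn : Gam ((s n)%:C * z).
    have -> : (s n)%:C * z = (s n / s n.+1)%:C * ((s n.+1)%:C * z).
      by rewrite scaleCM divfK// lt0r_neq0.
    by apply: up => //; rewrite ler_pdivlMr// mul1r.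
  by rewrite (Hc z Gz Gn Gs) Hs// -[n.+2%:R]natr1; ring.
by split => //; exact: step.
Qed.

(** If [t] decreased somewhere, the dilation by [t n / t n.+1 > 1] would multiply [k] by
    [N n / N n.+1 > 1], against [k_gt1]; so [t] is monotone and converges. Since [N n] tends to 1, a
    limit [l < 1] would satisfy [k (l z) = k z] by continuity, against [k_lt1]. *)
Lemma ratio_sequence : exists (t N : nat -> R),
  [/\ forall n, 0 < t n < 1, forall n, 1 < N n,
      t @ \oo --> (1 : R) &
      forall n z, Gam z -> Gam ((t n)%:C * z) -> k ((t n)%:C * z) = N n * k z].
Proof.
have [s Hs] := scaling_sequence.
pose t n := s n.+1 / s n; pose N n : R := n.+2%:R / n.+1%:R.
have s0 n : 0 < s n by have [] := Hs n.
have t0 n : 0 < t n by rewrite divr_gt0.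
have t1 n : t n <= 1 by have [_ ss _ _] := Hs n; rewrite ler_pdivrMr// mul1r.
have N1 n : 1 < N n by rewrite ltr_pdivlMr// mul1r ltr_nat.
have HT n z : Gam z -> Gam ((t n)%:C * z) -> k ((t n)%:C * z) = N n * k z.
  move=> Gz Gt; have [_ _ s1 H1] := Hs n; have [_ _ _ H2] := Hs n.+1.
  have G1 : Gam ((s n)^-1%:C * z) by apply: up => //; rewrite invf_ge1.
  have := H1 _ G1; rewrite scaleCM mulfV ?lt0r_neq0// mul1r => /(_ Gz) ->.
  have := H2 _ G1; rewrite scaleCM -/(t n) => /(_ Gt) ->.
  have : n.+1%:R != 0 :> R by rewrite pnatr_eq0.
  by rewrite /N; move: (n.+1%:R : R) (n.+2%:R : R) => q p q0; field.
have tlt n : t n < 1.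
  rewrite lt_neqAle t1 andbT; apply/eqP => e.
  have := HT n _ (cone_nonempty M0); rewrite e mul1r => /(_ (cone_nonempty M0)).
  by have := k_gt0 (cone_nonempty M0); have := N1 n; nra.
have Nd n : N n.+1 < N n.
  rewrite /N ltr_pdivrMr// mulrAC ltr_pdivlMr// -!natrM ltr_nat; lia.
have tn n : t n <= t n.+1.
  rewrite leNgt; apply/negP => lt; apply: (@k_gt1 (t n / t n.+1) (N n / N n.+1)).
  - by rewrite ltr_pdivlMr// mul1r.
  - by rewrite ler_pdivlMr ?(lt_trans ltr01)// mul1r ltW.
  move=> z Gz; have G1 : Gam ((t n.+1)^-1%:C * z) by apply: up => //; rewrite invf_ge1.
  have e1 : (t n.+1)%:C * ((t n.+1)^-1%:C * z) = z.
    by rewrite scaleCM mulfV ?lt0r_neq0// mul1r.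
  have e2 : (t n)%:C * ((t n.+1)^-1%:C * z) = (t n / t n.+1)%:C * z by rewrite scaleCM.
  have G2 : Gam ((t n)%:C * ((t n.+1)^-1%:C * z)).
    by rewrite e2; apply: up => //; rewrite ler_pdivlMr// mul1r ltW.
  have := HT n.+1 _ G1; rewrite e1 => /(_ Gz) ->; rewrite -e2 (HT n _ G1 G2).
  by field; rewrite gt_eqF// (lt_trans ltr01).
have ct : cvgn t.
  apply: nondecreasing_is_cvgn; first exact/nondecreasing_seqP.
  by exists 1 => _ [n _ <-].
have Ncv : N @ \oo --> (1 : R).
  have -> : N = (fun n => 1 + n.+1%:R^-1).
    apply/funext => n; have : n.+1%:R != 0 :> R by rewrite pnatr_eq0.
    by rewrite /N -[n.+2%:R]natr1; move: (n.+1%:R : R) => q q0; field.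
  by rewrite -[X in _ --> X]addr0; apply: cvgD; [exact: cvg_cst|exact: cvg_harmonic].
set l := limn t in ct.
have l1 : l <= 1 by apply: limr_le => //; exact: nearW.
have l0 : 0 < l by apply: lt_le_trans (t0 0%N) _; apply: limr_ge => //; near=> n; elim: (n) => // m IH; exact: le_trans (tn m).
exists t, N; split => //.
  by move=> n; rewrite t0 tlt.
suff <- : l = 1 by [].
apply/eqP; rewrite eq_le l1/= leNgt; apply/negP => ll1.
apply: (@k_lt1 l 1) => // z Gz Glz; rewrite mul1r.
apply/eqP; rewrite -subr_eq0 -normr_eq0; apply/eqP.
apply: le_anti; rewrite normr_ge0 andbT; apply/ler_addgt0Pl => e e0; rewrite addr0.
have e20 : 0 < e / 2 by rewrite divr_gt0.
have [r r0 Hr] := k_cont Glz e20.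
have kz : 0 < k z := k_gt0 Gz.
have rl : 0 < r * l by rewrite mulr_gt0.
move/cvgrPdist_lt : ct => /(_ _ rl) tc.
have ek : 0 < e / (2 * k z) by rewrite divr_gt0// mulr_gt0.
move/cvgrPdist_le : Ncv => /(_ _ ek) Nc.
near \oo => n.
have h1 : `|l - t n| < r * l by near: n.
have h2 : `|1 - N n| <= e / (2 * k z) by near: n.
have q : `|t n / l - 1| < r.
  have -> : t n / l - 1 = (t n - l) / l by field; exact: lt0r_neq0.
  by rewrite normrM normfV (gtr0_norm l0) ltr_pdivrMr// distrC.
have [G1] := Hr _ q; rewrite scaleCM divfK ?lt0r_neq0// => h3.
move: G1; rewrite scaleCM divfK ?lt0r_neq0// => G1.
rewrite (HT n z Gz G1) in h3.
have h4 : `|(1 - N n) * k z| <= e / 2.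
  rewrite normrM (gtr0_norm kz) -ler_pdivlMr//.
  by rewrite (le_trans h2)// invfM mulrA.
have -> : k (l%:C * z) - k z = - (N n * k z - k (l%:C * z)) - (1 - N n) * k z by ring.
by rewrite (le_trans (ler_normB _ _))// normrN; lra.
Unshelve. all: by end_near. Qed.

End ScalingSequence.

Section RealDerivative.
Variable R : realType.
Implicit Types (f g : R -> R) (x a b c : R).

Definition rder f x a := is_derive x (1 : R) f a.

Lemma rder_eq f x a b : rder f x a -> a = b -> rder f x b.
Proof. by move=> ? <-. Qed.

Lemma rder_cst c x : rder (fun=> c) x 0.
Proof. exact: is_derive_cst. Qed.

Lemma rder_id x : rder id x 1.
Proof. exact: is_derive_id. Qed.

Lemma rderD f g x a b : rder f x a -> rder g x b -> rder (fun t => f t + g t) x (a + b).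
Proof. by move=> df dg; exact: is_deriveD. Qed.

Lemma rderB f g x a b : rder f x a -> rder g x b -> rder (fun t => f t - g t) x (a - b).
Proof. by move=> df dg; exact: is_deriveB. Qed.

Lemma rderM f g x a b : rder f x a -> rder g x b ->
  rder (fun t => f t * g t) x (a * g x + f x * b).
Proof.
move=> df dg; apply: rder_eq (is_deriveM df dg) _.
by rewrite /GRing.scale/= addrC mulrC.
Qed.

Lemma rderV f x a : f x != 0 -> rder f x a -> rder (fun t => (f t)^-1) x (- a / f x ^+ 2).
Proof.
move=> fx df; apply: rder_eq (is_deriveV fx df) _.
by rewrite /GRing.scale/= mulNr mulrC mulNr.
Qed.

Lemma rder_quot f g x a b : g x != 0 -> rder f x a -> rder g x b ->
  rder (fun t => f t / g t) x ((a * g x - f x * b) / g x ^+ 2).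
Proof.
by move=> gx df dg; apply: rder_eq (rderM df (rderV gx dg)) _; field.
Qed.

Lemma rder_continuous f x a : rder f x a -> {for x, continuous f}.
Proof. by move=> [df _]; apply/differentiable_continuous/derivable1_diffP. Qed.

Lemma rder_cst_seg f (a b : R) : a <= b -> (forall x, a <= x <= b -> rder f x 0) -> f a = f b.
Proof.
move=> ab H; have [c _ E] := @MVT_deriv R f (fun=> 0) a b ab H.
by apply/eqP; rewrite eq_sym -subr_eq0 E mul0r.
Qed.

End RealDerivative.

(** * The infinitesimal equation on a cone *)

Section StableCone.
Variables (R : realType) (nu : borel_probability R).
Local Notation F := (reciprocal_cauchy_transform nu).
Hypothesis nu_stable : free_stable nu.

(** The defect satisfies [defect (t n z) = N n t n defect z] with [t n] tending to 1. Dividing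
    increments by [t n - 1] gives its derivative along the ray, [Im z - Im (z g')]; its quotient by
    the defect is a limit [kap] that does not depend on [z]. *)
Lemma stable_cone_equation : exists (M : R) (g : R[i] -> R[i]) (kap : R),
  [/\ 0 < M, kap < 1,
    forall z, truncated_cone 1 M z -> [/\ 0 < Im (g z), F (g z) = z, dF nu (g z) != 0 &
      Im (z / dF nu (g z)) - Im z = kap * (Im (g z) - Im z)]
    & forall w, 2 * M < Im w -> `|Re w| < Im w / 2 ->
      truncated_cone 1 M (F w) /\ g (F w) = w].
Proof.
have [npm stab] := nu_stable.
have [M [g [M0 [gdn gI gF ga gs]]]] := F_inverse_exists nu.
have gd z : truncated_cone 1 M z -> cder g z (dF nu (g z))^-1 by move=> /gdn[].
have kpos := rdef_gt0 M0 gI gF npm.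
have kadd := rdef_equation M0 gd gI gF ga stab.
have kgt1 := rdef_ratio_gt1 M0 gI gF ga npm.
have klt1 := rdef_ratio_lt1 M0 gI gF ga npm.
have cone_near z : truncated_cone 1 M z -> exists2 r : R, 0 < r &
    forall t : R, `|t - 1| < r -> 0 < t /\ truncated_cone 1 M (t%:C * z).
  move=> Gz; have [Mz y0 xy _ _] := cone1_norm M0 Gz.
  exists (Num.min (1 / 2) ((Im z - M) / (2 * Im z))).
    by rewrite lt_min !divr_gt0 ?subr_gt0// mulr_gt0.
  move=> t; rewrite lt_min => /andP[t1 t2].
  have t0 : 0 < t by move: t1; rewrite ltr_norml => /andP[? _]; lra.
  split => //; split; last by rewrite mul1r ReZ ImZ normrM gtr0_norm// ltr_pM2l.
  rewrite ImZ; move: t2; rewrite ltr_pdivlMr ?mulr_gt0//.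
  by have := ler_norm (- (t - 1)); rewrite normrN; nra.
have gder z t : truncated_cone 1 M (t%:C * z) ->
    rder (fun t => Im (g (0 + t%:C * z))) t (Im ((dF nu (g (t%:C * z)))^-1 * z)).
  by move=> Gz; apply: cder_is_derive_Im; rewrite add0r; exact: gd.
have rE z t : 0 < t -> rdef g (t%:C * z) = (t * Im z - Im (g (0 + t%:C * z))) / (t * normc z).
  by move=> t0; rewrite /rdef /defect ImZ normcZ// add0r.
have rdefd z t : 0 < t -> truncated_cone 1 M (t%:C * z) -> 0 < normc z ->
   rder (fun t => (t * Im z - Im (g (0 + t%:C * z))) / (t * normc z)) t
     (((Im z - Im ((dF nu (g (t%:C * z)))^-1 * z)) * t - defect g (t%:C * z)) / (t ^+ 2 * normc z)).
  move=> t0 Gz n0.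
  apply: rder_eq (rder_quot _ (rderB (rderM (rder_id _) (rder_cst _ _)) (gder _ _ Gz))
    (rderM (rder_id t) (rder_cst (normc z) _))) _.
    by rewrite mulf_neq0 ?lt0r_neq0.
  rewrite /defect ImZ add0r; field; by rewrite !lt0r_neq0.
have npos z : truncated_cone 1 M z -> 0 < normc z.
  by move=> Gz; have [_ y0 _ yn _] := cone1_norm M0 Gz; exact: lt_le_trans yn.
have kcont : forall z, truncated_cone 1 M z -> forall e : R, 0 < e -> exists2 r : R, 0 < r &
  forall t : R, `|t - 1| < r -> truncated_cone 1 M (t%:C * z) /\ `|rdef g (t%:C * z) - rdef g z| <= e.
  move=> z Gz e e0; have [r r0 Hr] := cone_near z Gz.
  have G1 : truncated_cone 1 M (1%:C * z) by rewrite mul1r.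
  have /rder_continuous := rdefd z 1 ltr01 G1 (npos z Gz).
  move=> /cvgrPdist_le /(_ _ e0) /nbhs_ballP[r' /= r'0 Hr'].
  exists (Num.min r r'); first by rewrite lt_min r0.
  move=> t; rewrite lt_min => /andP[/Hr[t0 Gt] tr']; split => //.
  have := Hr' t; rewrite /ball/= distrC => /(_ tr'); rewrite -!rE// mul1r distrC.
  exact.
have [t [N [t01 N1 t1 tN]]] := ratio_sequence M0 kpos kadd kgt1 klt1 kcont.
(* Difference quotient of the defect along a ray, divided by the defect: the same sequence for every
   [z]. *)
pose x n := (N n * t n - 1) / (t n - 1).
have tne n : t n - 1 != 0 by have /andP[_ ?] := t01 n; rewrite subr_eq0 lt_eqF.
pose m1 z := Im z - Im (z / dF nu (g z)).
have xcv z : truncated_cone 1 M z -> x @ \oo --> m1 z / defect g z.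
  move=> Gz; have n0 := npos z Gz; have d0 := defect_gt0 gI gF npm Gz.
  apply/cvgrPdist_le => e e0.
  have e1 : 0 < e * defect g z / normc z by rewrite divr_gt0// mulr_gt0.
  have [r r0 Hr] := gd z Gz _ e1; have [r' r'0 Hr'] := cone_near z Gz.
  have r1 : 0 < Num.min r' (r / normc z) by rewrite lt_min r'0 divr_gt0.
  move/cvgrPdist_lt : t1 => /(_ _ r1)[n0' _ Hn].
  exists n0' => // n /= /Hn; rewrite lt_min distrC => /andP[/Hr'[t0 Gt]].
  rewrite ltr_pdivlMr// => hn.
  have nh : normc ((t n - 1)%:C * z) = `|t n - 1| * normc z by rewrite normcM normcR.
  have := Hr ((t n - 1)%:C * z); rewrite nh => /(_ hn).
  have -> : z + (t n - 1)%:C * z = (t n)%:C * z by rewrite rmorphB/=; ring.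
  move=> h; have {h} := le_trans (normc_ge_Im _) h.
  set A := g _ - g z - _ => h.
  have kE := tN n z Gz Gt.
  have dE : defect g ((t n)%:C * z) = N n * t n * defect g z.
    move: kE; rewrite /rdef normcZ// => kE.
    by rewrite -[LHS](divfK (_ : t n * normc z != 0)) ?mulf_neq0 ?lt0r_neq0// kE; field; rewrite lt0r_neq0.
  have AE : Im A = (t n - 1) * m1 z - (N n * t n - 1) * defect g z.
    have : N n * t n * defect g z = t n * Im z - Im (g ((t n)%:C * z)) by rewrite -dE /defect ImZ.
    have -> : A = g ((t n)%:C * z) - g z - (t n - 1)%:C * (z / dF nu (g z)) by rewrite /A; ring.
    rewrite !ImB ImZ /m1 /defect; lra.
  rewrite -(ler_pM2r (_ : 0 < `|t n - 1| * defect g z)) ?mulr_gt0 ?normr_gt0//.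
  have -> : `|m1 z / defect g z - x n| * (`|t n - 1| * defect g z) = `|Im A|.
    rewrite -[X in _ * (_ * X)](gtr0_norm d0) -!normrM; congr Num.norm.
    by rewrite AE /x; field; rewrite tne lt0r_neq0.
  apply: le_trans h _; rewrite le_eqVlt; apply/orP; left; apply/eqP; field.
  exact: lt0r_neq0.
have G0 := cone_nonempty M0; set z0 := 0 +i* (M + 1) in G0.
pose kap := m1 z0 / defect g z0.
have kE z : truncated_cone 1 M z -> m1 z = kap * defect g z.
  move=> Gz; have d0 := defect_gt0 gI gF npm Gz.
  have -> : kap = m1 z / defect g z by apply: (cvg_unique _ (xcv _ G0) (xcv _ Gz)).
  by rewrite divfK// lt0r_neq0.
have k1 : kap <= 1.
  have <- : limn x = kap by apply: cvg_lim => //; exact: xcv.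
  apply: limr_le; first by apply: cvgP (xcv _ G0).
  apply: nearW => n; have /andP[tn0 tn1] := t01 n.
  by rewrite /x ler_ndivrMr ?subr_lt0// mul1r; have := N1 n; nra.
exists M, g, kap; split => //.
  (* For [kap = 1] the derivative of [rdef] along rays vanishes, so that doubling leaves [rdef]
     unchanged, contrary to its decay. *)
  rewrite lt_neqAle k1 andbT; apply/eqP => kap1.
  apply: (kgt1 2 1) => //; first by rewrite ltr1n.
  move=> z Gz; rewrite mul1r.
  have two : (0 : R) < 2 by [].
  have E1 : rdef g z = (1 * Im z - Im (g (0 + 1%:C * z))) / (1 * normc z).
    by rewrite -rE// mul1r.
  rewrite (rE z 2 two) E1; symmetry.
  apply: (@rder_cst_seg R (fun t => (t * Im z - Im (g (0 + t%:C * z))) / (t * normc z))).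
    by rewrite ler1n.
  move=> s /andP[s1 s2]; have s0 : 0 < s by lra.
  have Gs : truncated_cone 1 M (s%:C * z) by apply: cone_up.
  apply: rder_eq (rdefd z s s0 Gs (npos z Gz)) _.
  have := kE _ Gs; rewrite kap1 mul1r /m1 => <-; rewrite ImZ -mulrA ImZ [z / _]mulrC.
  by rewrite (_ : _ - _ = 0) ?mul0r//; ring.
move=> z Gz; split; [exact: gI|exact: gF|by have [] := gdn z Gz|].
by have := kE z Gz; rewrite /m1 /defect; lra.
Qed.

End StableCone.

(** * The differential equation of F *)

Section IdentityTheorem.
Variable R : realType.
Implicit Types (z w h c : R[i]).

Definition ccts (f : R[i] -> R) z := forall e : R, 0 < e -> exists2 r : R, 0 < r &
  forall h, normc h < r -> `|f (z + h) - f z| <= e.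

Lemma ccts_continuous f z : ccts f z ->
  {for (Re z, Im z), continuous (fun p : R * R => f (p.1 +i* p.2))}.
Proof.
move=> fz; apply/cvgrPdist_le => e /fz[r r0 H].
have r2 : 0 < r / 2 by rewrite divr_gt0.
exists (ball (Re z) (r / 2), ball (Im z) (r / 2)); first by split; exact: nbhsx_ballx.
move=> [x y] [/= h1 h2]; rewrite /ball/= in h1 h2.
have -> : Re z +i* Im z = z by case: (z).
have -> : x +i* y = z + ((x - Re z) +i* (y - Im z)) by apply: complexP => /=; rewrite ?ReD ?ImD/=; ring.
rewrite distrC; apply: H; apply: le_lt_trans (normc_le_ReIm _) _ => /=.
by rewrite distrC [X in _ + X]distrC; lra.
Qed.

Lemma ccts_normc w0 z : ccts (fun w => normc (w - w0)) z.
Proof.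
move=> e e0; exists e => // h he; rewrite ler_norml; apply/andP; split.
  have := normcD_le (z + h - w0) (- h); rewrite normcNE (_ : z + h - w0 - h = z - w0); [lra|ring].
have := normcD_le (z - w0) h; rewrite (_ : z - w0 + h = z + h - w0); [lra|ring].
Qed.

(** Compactness is taken from the real plane, to which [ccts_continuous] transfers continuity. *)
Lemma EVT_annulus (f : R[i] -> R) w0 (a b : R) :
  (exists z, a <= normc (z - w0) <= b) ->
  (forall z, a <= normc (z - w0) <= b -> ccts f z) ->
  exists2 z, a <= normc (z - w0) <= b & forall w, a <= normc (w - w0) <= b -> f w <= f z.
Proof.
move=> [z0 Hz0] cf.
pose N (p : R * R) := normc (p.1 +i* p.2 - w0).
pose A : set (R * R) := [set p | a <= N p <= b].
have cN : continuous N.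
  move=> [x y]; exact: (ccts_continuous (ccts_normc w0 (x +i* y))).
have clA : closed A.
  rewrite (_ : A = N @^-1` [set` `[a, b]]); last by apply/seteqP; split => p; rewrite /A/= in_itv.
  by apply: closed_comp => [p _|]; [exact: cN|exact: itv_closed].
have cA : compact A.
  apply: (@subclosed_compact _ A (`[Re w0 - b, Re w0 + b] `*` `[Im w0 - b, Im w0 + b])%classic) => //.
    by apply: compact_setX; exact: segment_compact.
  move=> [x y] /andP[_ xy]; split; rewrite /= in_itv/=.
    have := le_trans (normc_ge_Re _) xy; rewrite ReB/= ler_norml; lra.
  have := le_trans (normc_ge_Im _) xy; rewrite ImB/= ler_norml; lra.
have [||p] := @compact_EVT_max _ R (fun p => f (p.1 +i* p.2)) A _ cA.
- by exists (Re z0, Im z0); rewrite /A/= /N/=; case: (z0) Hz0.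
- apply: continuous_in_subspaceT => -[x y] /[!inE] Axy.
  exact: (ccts_continuous (cf (x +i* y) Axy)).
rewrite inE => Ap pmax; exists (p.1 +i* p.2) => //.
move=> w Hw; have := pmax (Re w, Im w); rewrite inE/=.
have -> : Re w +i* Im w = w by case: (w).
by apply; rewrite /A/= /N/=; case: (w) Hw.
Qed.

Definition has_jet (f : R[i] -> R[i]) z := exists c1 c2, jet2 f z c1 c2.

Lemma has_jet_ccts f z : has_jet f z -> ccts (fun w => normc (f w)) z.
Proof.
move=> [c1 [c2 /jet2_cder /cder_cts H]] e /H[r r0 Hr]; exists r => // h /Hr /ltW {}Hr.
rewrite ler_norml; apply/andP; split.
  have := normc_geB (f z) (f z - f (z + h)); rewrite subKr normcB; lra.
have := normcD_le (f (z + h) - f z) (f z); rewrite subrK; lra.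
Qed.

Lemma ccts_sqr f z : ccts f z -> ccts (fun w => f w ^+ 2) z.
Proof.
move=> cf e e0; have A0 : 0 < 2 * `|f z| + 1 by rewrite ltr_wpDl// mulr_ge0.
have m0 : 0 < Num.min 1 (e / (2 * `|f z| + 1)) by rewrite lt_min ltr01 divr_gt0.
have [r r0 H] := cf _ m0; exists r => // h /H; rewrite le_min => /andP[h1].
rewrite ler_pdivlMr// => h2.
have -> : f (z + h) ^+ 2 - f z ^+ 2 = (f (z + h) - f z) * ((f (z + h) - f z) + 2 * f z) by ring.
rewrite normrM; apply: le_trans h2; apply: ler_wpM2l => //.
by rewrite (le_trans (ler_normD _ _))// normrM ger0_norm//; lra.
Qed.

Lemma cctsD f g z : ccts f z -> ccts g z -> ccts (fun w => f w + g w) z.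
Proof.
move=> cf cg e e0; have e20 : 0 < e / 2 by rewrite divr_gt0.
have [r1 r10 H1] := cf _ e20; have [r2 r20 H2] := cg _ e20.
exists (Num.min r1 r2); first by rewrite lt_min r10.
move=> h; rewrite lt_min => /andP[/H1 {}H1 /H2 {}H2].
have -> : f (z + h) + g (z + h) - (f z + g z) = (f (z + h) - f z) + (g (z + h) - g z) by ring.
by rewrite (le_trans (ler_normD _ _))//; lra.
Qed.

Lemma cctsZ (k : R) f z : ccts f z -> ccts (fun w => k * f w) z.
Proof.
move=> cf e e0; have A0 : 0 < `|k| + 1 by rewrite ltr_wpDl.
have [r r0 H] := cf _ (divr_gt0 e0 A0); exists r => // h /H.
rewrite ler_pdivlMr// -mulrBr normrM => h1; apply: le_trans h1.
by rewrite mulrC ler_wpM2l// lerDl.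
Qed.

(* The four directions [1, 'i, -1, -'i] kill all cross terms of the squared
   modulus of a quadratic polynomial. *)
Lemma four_point_mean f z : has_jet f z -> exists K r : R, [/\ 0 <= K, 0 < r &
  forall t : R, 0 < t < r ->
   4 * normc (f z) ^+ 2 - K * t ^+ 3 <=
   normc (f (z + t +i* 0)) ^+ 2 + normc (f (z + 0 +i* t)) ^+ 2 +
   (normc (f (z + (- t) +i* 0)) ^+ 2 + normc (f (z + 0 +i* (- t))) ^+ 2)].
Proof.
move=> [c1 [c2 [K [r [K0 r0 H]]]]].
set P := normc (f z) + normc c1 + normc c2.
have P0 : 0 <= P by rewrite !addr_ge0 ?normc_ge0.
exists (8 * (P * K)), (Num.min r 1); split.
- by rewrite !mulr_ge0.
- by rewrite lt_min r0 ltr01.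
move=> t /andP[t0]; rewrite lt_min => /andP[tr t1].
have bound h : normc h = t ->
    normc (f z + c1 * h + c2 * h ^+ 2) ^+ 2 - 2 * (P * K) * t ^+ 3 <= normc (f (z + h)) ^+ 2.
  move=> ht; have := H h; rewrite ht => /(_ tr).
  set p := f z + c1 * h + c2 * h ^+ 2 => h1.
  have pP : normc p <= P by apply: jet2_bound; rewrite ht ltW.
  have := normc_geB p (p - f (z + h)); rewrite subKr normcB => h2.
  have p0 := normc_ge0 p; have f0 := normc_ge0 (f (z + h)).
  have t3 : 0 <= K * t ^+ 3 by rewrite mulr_ge0// exprn_ge0// ltW.
  set k := K * t ^+ 3 in h1 t3.
  rewrite (_ : 2 * (P * K) * t ^+ 3 = 2 * (P * k)); last by rewrite /k; ring.
  have h3 : normc p <= normc (f (z + h)) + k by lra.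
  have Pk : normc p * k <= P * k by rewrite ler_wpM2r.
  have [pk|pk] := leP (normc p) k; last by nra.
  have : normc p ^+ 2 <= 2 * (P * k) by nra.
  by have := sqr_ge0 (normc (f (z + h))); lra.
have n1 : normc (t +i* 0) = t by rewrite /= expr0n /= addr0 sqrtr_sqr gtr0_norm.
have n2 : normc (0 +i* t) = t by rewrite /= expr0n /= add0r sqrtr_sqr gtr0_norm.
have n3 : normc ((- t) +i* 0) = t by rewrite /= expr0n /= addr0 sqrrN sqrtr_sqr gtr0_norm.
have n4 : normc (0 +i* (- t)) = t by rewrite /= expr0n /= add0r sqrrN sqrtr_sqr gtr0_norm.
have := bound _ n1; have := bound _ n2; have := bound _ n3; have := bound _ n4.
rewrite !addrA.
have E : normc (f z + c1 * (t +i* 0) + c2 * (t +i* 0) ^+ 2) ^+ 2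
  + normc (f z + c1 * (0 +i* t) + c2 * (0 +i* t) ^+ 2) ^+ 2
  + normc (f z + c1 * ((-t) +i* 0) + c2 * ((-t) +i* 0) ^+ 2) ^+ 2
  + normc (f z + c1 * (0 +i* (-t)) + c2 * (0 +i* (-t)) ^+ 2) ^+ 2
  = 4 * normc (f z) ^+ 2 + 4 * normc c1 ^+ 2 * t ^+ 2 + 4 * normc c2 ^+ 2 * t ^+ 4.
  rewrite !normc_sqr !expr2; case: (f z) c1 c2 {H P P0 bound} => [a b] [a1 b1] [a2 b2] /=.
  by ring.
have : 0 <= normc c1 ^+ 2 * t ^+ 2 by rewrite mulr_ge0 ?sqr_ge0.
have : 0 <= normc c2 ^+ 2 * t ^+ 4 by rewrite mulr_ge0 ?sqr_ge0// exprn_ge0// ltW.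
lra.
Qed.

End IdentityTheorem.

(** * Maximum principle and identity theorem *)

Section IdentityDisc.
Variable R : realType.
Implicit Types (z w h c : R[i]).

Lemma has_jetM (f g : R[i] -> R[i]) z : has_jet f z -> has_jet g z -> has_jet (fun w => f w * g w) z.
Proof. by move=> [a1 [a2 Hf]] [b1 [b2 Hg]]; eexists; eexists; exact: jet2M Hf Hg. Qed.

Lemma has_jetD (f g : R[i] -> R[i]) z : has_jet f z -> has_jet g z -> has_jet (fun w => f w + g w) z.
Proof. by move=> [a1 [a2 Hf]] [b1 [b2 Hg]]; eexists; eexists; exact: jet2D Hf Hg. Qed.

Lemma has_jet_cst c z : has_jet (fun=> c) z.
Proof. by eexists; eexists; exact: jet2_cst. Qed.

Lemma has_jet_id z : has_jet id z.
Proof. by eexists; eexists; exact: jet2_id. Qed.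

Lemma has_jetX (f : R[i] -> R[i]) n z : has_jet f z -> has_jet (fun w => f w ^+ n) z.
Proof.
move=> jf; elim: n => [|n IH].
  by under eq_fun do rewrite expr0; exact: has_jet_cst.
by under eq_fun do rewrite exprS; exact: has_jetM.
Qed.

Lemma has_jet_inv c z : z != c -> has_jet (fun w => (w - c)^-1) z.
Proof. by move=> zc; eexists; eexists; exact: jet2_inv. Qed.

(** Adding [e |w - w0|^2] makes [|q|^2] strictly subharmonic: at an interior maximum the four-point
    mean would exceed the value by [e t^2] up to an error of order [t^3], impossible for small [t].
    The choice [e = e' / b^2] makes the added term cost at most [e'] on the annulus. *)
Lemma max_principle_annulus (q : R[i] -> R[i]) w0 (a b B : R) : 0 < a -> a < b -> 0 <= B ->
  (forall z, a <= normc (z - w0) <= b -> has_jet q z) ->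
  (forall z, normc (z - w0) = a -> q z = 0) ->
  (forall z, normc (z - w0) = b -> normc (q z) <= B) ->
  forall z, a <= normc (z - w0) <= b -> normc (q z) <= B.
Proof.
move=> a0 ab B0 jq qa qb z Hz.
apply: ger0_ler_sqr => //; apply/ler_addgt0Pl => e' e'0; rewrite addrC.
have b0 : 0 < b by lra.
pose e := e' / b ^+ 2; have e0 : 0 < e by rewrite divr_gt0// exprn_gt0.
pose Psi w := normc (q w) ^+ 2 + e * normc (w - w0) ^+ 2.
have [||z2 Hz2 zmax] := @EVT_annulus R Psi w0 a b.
- by exists z.
- move=> w Hw; apply: cctsD; first exact/ccts_sqr/has_jet_ccts/jq.
  exact/cctsZ/ccts_sqr/ccts_normc.
have eb : e * b ^+ 2 = e' by rewrite /e divfK// lt0r_neq0// exprn_gt0.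
suff zb : Psi z2 <= B ^+ 2 + e'.
  have := zmax _ Hz; rewrite /Psi in zb *.
  have : 0 <= e * normc (z - w0) ^+ 2 by rewrite mulr_ge0 ?sqr_ge0// ltW.
  lra.
have eb2 : e * normc (z2 - w0) ^+ 2 <= e'.
  rewrite -eb; apply: ler_wpM2l; first exact: ltW.
  by case/andP: Hz2 => _ h; rewrite ler_pXn2r ?nnegrE ?normc_ge0 ?(ltW b0).
have [za|za] := eqVneq (normc (z2 - w0)) a.
  rewrite /Psi (qa _ za) normc0 expr0n/= add0r; apply: le_trans eb2 _.
  by rewrite lerDr sqr_ge0.
have [zb|zb] := eqVneq (normc (z2 - w0)) b.
  by rewrite /Psi lerD// ler_pXn2r ?nnegrE ?normc_ge0// qb.
have [za1 zb1] : a < normc (z2 - w0) /\ normc (z2 - w0) < b.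
  by case/andP: Hz2 => h1 h2; rewrite !lt_neqAle h1 h2 zb eq_sym za.
have [K [r [K0 r0 H4]]] := four_point_mean (jq _ Hz2).
have K1 : 0 < K + 1 by lra.
(* Small enough for the expansion to apply, for [K t < 4 e], and for the four points to stay in the
   annulus. *)
pose t := Num.min (Num.min (r / 2) (e / (K + 1))) (Num.min (normc (z2 - w0) - a) (b - normc (z2 - w0))).
have t0 : 0 < t by rewrite !lt_min; apply/andP; split; apply/andP; split; [lra|exact: divr_gt0|lra|lra].
have : t <= t by [].
rewrite {2}/t !le_min => /andP[/andP[t1 t2] /andP[t3 t4]].
rewrite ler_pdivlMr// in t2.
have t5 : t < r by lra.
have := H4 t; rewrite t0 t5 => /(_ isT) {}H4.
have inA h : normc h = t -> Psi (z2 + h) <= Psi z2.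
  move=> ht; apply: zmax; apply/andP; split.
    have := normcD_le (z2 + h - w0) (- h); rewrite normcNE ht (_ : z2 + h - w0 - h = z2 - w0); [lra|ring].
  have := normcD_le (z2 - w0) h; rewrite ht (_ : z2 - w0 + h = z2 + h - w0); [lra|ring].
have n1 : normc (t +i* 0) = t by rewrite /= expr0n /= addr0 sqrtr_sqr gtr0_norm.
have n2 : normc (0 +i* t) = t by rewrite /= expr0n /= add0r sqrtr_sqr gtr0_norm.
have n3 : normc ((- t) +i* 0) = t by rewrite /= expr0n /= addr0 sqrrN sqrtr_sqr gtr0_norm.
have n4 : normc (0 +i* (- t)) = t by rewrite /= expr0n /= add0r sqrrN sqrtr_sqr gtr0_norm.
have := inA _ n1; have := inA _ n2; have := inA _ n3; have := inA _ n4; rewrite /Psi.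
have E : normc (z2 + t +i* 0 - w0) ^+ 2 + normc (z2 + 0 +i* t - w0) ^+ 2 +
   normc (z2 + (- t) +i* 0 - w0) ^+ 2 + normc (z2 + 0 +i* (- t) - w0) ^+ 2 =
   4 * normc (z2 - w0) ^+ 2 + 4 * t ^+ 2.
  by rewrite !normc_sqr; case: (z2) (w0) => [x y] [x' y'] /=; ring.
have /(congr1 (fun x => e * x)) := E.
have t20 : 0 < t ^+ 2 by rewrite exprn_gt0.
have : K * t ^+ 3 < 4 * e * t ^+ 2.
  rewrite (_ : K * t ^+ 3 = K * t * t ^+ 2); last by ring.
  by rewrite ltr_pM2r//; nra.
rewrite !mulrDr; lra.
Qed.

(** As [Q] vanishes on the inner circle, [Q / (w - w0)^n] obeys the maximum principle on the annulus
    for every [n]. Thus [|Q z1| <= B (|z1 - w0| / b)^n], and the ratio is below 1. *)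
Lemma identity_disc (Q : R[i] -> R[i]) w0 (r R0 : R) : 0 < r -> r < R0 ->
  (forall z, normc (z - w0) < R0 -> has_jet Q z) ->
  (forall z, normc (z - w0) < r -> Q z = 0) ->
  forall z, normc (z - w0) < R0 -> Q z = 0.
Proof.
move=> r0 rR jQ Q0 z1 Hz1.
have [h|rz] := ltP (normc (z1 - w0)) (r / 2); first by apply: Q0; lra.
pose b := (normc (z1 - w0) + R0) / 2.
have zb : normc (z1 - w0) < b by rewrite /b; lra.
have bR : b < R0 by rewrite /b; lra.
have b0 : 0 < b by lra.
have rb : r / 2 < b by lra.
have [||zM HM zmax] := @EVT_annulus R (fun w => normc (Q w)) w0 (r / 2) b.
- by exists z1; rewrite rz ltW.
- by move=> w /andP[_ h]; apply/has_jet_ccts/jQ; lra.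
set B := normc (Q zM) in zmax.
have B0 : 0 <= B by exact: normc_ge0.
have bound n : normc (Q z1) <= B * (normc (z1 - w0) / b) ^+ n.
  pose q w := Q w * (w - w0)^-1 ^+ n.
  have qn w : normc (q w) = normc (Q w) * (normc (w - w0))^-1 ^+ n.
    by rewrite normcM normcX normcV.
  have := @max_principle_annulus q w0 (r / 2) b (B * b^-1 ^+ n) _ rb _ _ _ _ z1 _.
  rewrite qn expr_div_n mulrA.
  have zp : 0 < normc (z1 - w0) by lra.
  have zp' : 0 < normc (z1 - w0) ^+ n by rewrite exprn_gt0.
  move=> H; rewrite mulrAC -ler_pdivrMr// -exprVn -[(b ^+ n)^-1]exprVn; apply: H.
  - by rewrite divr_gt0.
  - by rewrite mulr_ge0// exprn_ge0// invr_ge0 ltW.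
  - move=> w /andP[h1 h2]; apply: has_jetM; first by apply: jQ; lra.
    apply/has_jetX/has_jet_inv; apply/eqP => e; move: h1; rewrite e subrr normc0; lra.
  - by move=> w Hw; rewrite /q Q0 ?mul0r// Hw; lra.
  - move=> w Hw; rewrite qn Hw; apply: ler_wpM2r; first by rewrite exprn_ge0// invr_ge0 ltW.
    by apply: zmax; rewrite Hw lexx andbT ltW.
  - by rewrite rz ltW.
apply/eqP; rewrite -normc_eq0; apply/eqP; apply: le_anti; rewrite normc_ge0 andbT.
have cv : (fun n => B * (normc (z1 - w0) / b) ^+ n) @ \oo --> (0 : R).
  rewrite -(mulr0 B); apply: cvgMr; apply: cvg_expr; rewrite ger0_norm; last by apply: divr_ge0; [exact: normc_ge0|exact: ltW].
  by rewrite ltr_pdivrMr// mul1r.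
have <- : limn (fun n => B * (normc (z1 - w0) / b) ^+ n) = 0 by exact: cvg_lim cv.
by apply: limr_ge; [exact: cvgP cv|exact: nearW].
Qed.

End IdentityDisc.

(** * From the cone to the half plane *)

Section GlobalEquation.
Variables (R : realType) (nu : borel_probability R).
Local Notation F := (reciprocal_cauchy_transform nu).
Local Notation G := (cauchy_transform nu).
Hypothesis nu_stable : free_stable nu.

(** Increments of [f] are real in the directions [1] and ['i], so [d] and [d * 'i] are both real. *)
Lemma cder_real_valued (f : R[i] -> R[i]) z d (r : R) : 0 < r ->
  (forall h, normc h < r -> Im (f (z + h)) = 0) -> cder f z d -> d = 0.
Proof.
move=> r0 fr df.
have key u : normc u = 1 -> Im (d * u) = 0.
  move=> nu1; apply/eqP; rewrite -normr_le0; apply/ler_addgt0Pl => e e0; rewrite addr0.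
  have [r1 r10 H] := df _ e0; pose t := Num.min r r1 / 2.
  have m0 : 0 < Num.min r r1 by rewrite lt_min r0.
  have t0 : 0 < t by rewrite divr_gt0.
  have : t < Num.min r r1 by rewrite /t; lra.
  rewrite lt_min => /andP[tr tr1].
  have nt : normc (t%:C * u) = t by rewrite normcM normcR nu1 mulr1 gtr0_norm.
  have := H (t%:C * u); rewrite nt => /(_ tr1) h.
  have := le_trans (normc_ge_Im _) h.
  have f1 : Im (f (z + t%:C * u)) = 0 by apply: fr; rewrite nt.
  have f2 : Im (f z) = 0 by rewrite -[z]addr0; apply: fr; rewrite normc0.
  rewrite !ImB f1 f2 subr0 sub0r normrN mulrCA ImZ normrM gtr0_norm// [e * t]mulrC.
  by rewrite ler_pM2l.
have h1 := key 1 (normc1 R).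
have hi : normc ('i : R[i]) = 1 by rewrite /= expr0n /= add0r expr1n sqrtr1.
have h2 := key 'i hi.
apply: complexP; first by move: h2; rewrite ImM/= mulr1 mulr0 addr0.
by move: h1; rewrite mulr1.
Qed.

Lemma stable_ode : exists alpha s : R, 0 < alpha /\
  forall w, 0 < Im w ->
    (alpha%:C * F w + (1 - alpha)%:C * w + s%:C) * dF nu w = F w.
Proof.
have [M [g [kap [M0 k1 Hg Hw]]]] := stable_cone_equation nu_stable.
pose Om w := 2 * M < Im w /\ `|Re w| < Im w / 2.
have Om0 w : Om w -> 0 < Im w by move=> [? _]; lra.
have Om_near w : Om w -> exists2 r : R, 0 < r & forall h, normc h < r -> Om (w + h).
  move=> [p1 p2]; exists (Num.min ((Im w - 2 * M) / 2) ((Im w / 2 - `|Re w|) / 2)).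
    by rewrite lt_min !divr_gt0// subr_gt0.
  move=> h; rewrite lt_min => /andP[h1 h2]; rewrite /Om ReD ImD.
  have := normc_ge_Im h; rewrite ler_norml => /andP[? ?]; split; first lra.
  by apply: le_lt_trans (ler_normD _ _) _; have := normc_ge_Re h; lra.
have Om_seg w1 w2 (t : R) : Om w1 -> Om w2 -> 0 <= t <= 1 -> Om (seg w1 w2 t).
  move=> [a1 a2] [b1 b2] /andP[t0 t1]; rewrite /Om /seg ReD ImD ReZ ImZ ReB ImB.
  have cvx (a x y : R) : a < x -> a < y -> a < (1 - t) * x + t * y.
    move=> ax ay; have m1 : a < Num.min x y by rewrite lt_min ax.
    have m2 : Num.min x y <= x by rewrite ge_min lexx.
    have m3 : Num.min x y <= y by rewrite ge_min lexx orbT.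
    apply: lt_le_trans m1 _; nra.
  split; first by have := cvx _ _ _ a1 b1; lra.
  have -> : Re w1 + t * (Re w2 - Re w1) = (1 - t) * Re w1 + t * Re w2 by ring.
  apply: le_lt_trans (ler_normD _ _) _; rewrite !normrM (ger0_norm t0) ger0_norm ?subr_ge0//.
  have := cvx 0 (Im w1 / 2 - `|Re w1|) (Im w2 / 2 - `|Re w2|).
  by rewrite !subr_gt0 => /(_ a2 b2); lra.
have G2n w : Om w -> Gn nu 2 w != 0.
  move=> Ow; have [p1 p2] := Ow; have [GF gF] := Hw w p1 p2.
  have [_ _ d0 _] := Hg _ GF; move: d0; rewrite gF /dF.
  by apply: contraNneq => ->; rewrite mul0r.
(* In terms of [F] this is [F / F' - (1 - kap) F - kap w]. The cone equation at the point [F w] says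
   that its imaginary part is 0, so it is a real constant [s], and [al = 1 - kap]. *)
pose S w := G w / Gn nu 2 w - (1 - kap)%:C / G w - kap%:C * w.
have ImS w : Om w -> Im (S w) = 0.
  move=> Ow; have [p1 p2] := Ow; have [GF gF] := Hw w p1 p2.
  have [_ _ _ E] := Hg _ GF; rewrite gF in E.
  have gn := G_neq0 nu (Om0 _ Ow); have g2n := G2n _ Ow.
  have -> : S w = F w / dF nu w - (1 - kap)%:C * F w - kap%:C * w.
    by rewrite /S F_E /dF; field; rewrite gn g2n.
  by rewrite !ImB !ImZ; lra.
have cS w : Om w -> exists d, cder S w d.
  move=> Ow; have gn := G_neq0 nu (Om0 _ Ow); have g2n := G2n _ Ow.
  have cG := cder_G nu (Om0 _ Ow); have cG2 := cder_G2 nu (Om0 _ Ow).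
  by eexists; apply: cderB (cderZ _ (cder_id _)); apply: cderB (cderZ _ (cderV gn cG));
     apply: cderM cG (cderV g2n cG2).
have cS0 w : Om w -> cder S w 0.
  move=> Ow; have [d dS] := cS _ Ow; have [r r0 Hr] := Om_near _ Ow.
  rewrite -(cder_real_valued r0 (fun h hr => ImS _ (Hr h hr)) dS)//.
have Sconst w1 w2 : Om w1 -> Om w2 -> S w2 = S w1.
  move=> o1 o2; apply/eqP; rewrite -subr_eq0 -normc_eq0; apply/eqP.
  have H := @cder_segment_bound R S (fun=> 0) w1 w2 0 0
    (fun t t01 => cS0 _ (Om_seg _ _ t o1 o2 t01)).
  apply: le_anti; rewrite normc_ge0 andbT.
  have {}H : normc (S w2 - S w1 - 0 * (w2 - w1)) <= 0 * normc (w2 - w1).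
    by apply: H => t _; rewrite subr0 normc0.
  by move: H; rewrite !mul0r subr0.
have [s Hs] : exists s : R, forall w, Om w -> S w = s%:C.
  pose w1 : R[i] := 0 +i* (2 * M + 1).
  have o1 : Om w1 by split => /=; rewrite ?normr0; lra.
  exists (Re (S w1)) => w /(Sconst _ _ o1) ->.
  by apply: complexP; [by []|rewrite ImS].
exists (1 - kap), s; split; first by rewrite subr_gt0.
(* This is [S - s] multiplied by [G] and [Gn nu 2]. With denominators cleared it has a second-order
   expansion on the whole half plane, also at possible zeros of [Gn nu 2]. *)
pose Q w := Gn nu 1 w ^+ 2 + (- (1 - kap)%:C * Gn nu 2 w
   + - (kap%:C * w + s%:C) * (Gn nu 1 w * Gn nu 2 w)).
have Q0 w : Om w -> Q w = 0.
  move=> Ow; have := Hs w Ow; have gn := G_neq0 nu (Om0 _ Ow); have g2n := G2n _ Ow.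
  move=> E; have -> : Q w = (S w - s%:C) * (G w * Gn nu 2 w).
    by rewrite /Q /S -GE; field; rewrite gn g2n.
  by rewrite E subrr mul0r.
have jQ w : 0 < Im w -> has_jet Q w.
  move=> w0; have j1 : has_jet (Gn nu 1) w by eexists; eexists; exact: jet2_G1.
  have j2 : has_jet (Gn nu 2) w by eexists; eexists; exact: jet2_G2.
  apply: has_jetD; first exact: has_jetX.
  apply: has_jetD; first by apply: has_jetM => //; exact: has_jet_cst.
  apply: has_jetM; last exact: has_jetM.
  have -> : (fun w => - (kap%:C * w + s%:C)) = (fun w => (- kap%:C) * w + (- s%:C)).
    by apply/funext => v; ring.
  apply: has_jetD; last exact: has_jet_cst.
  by apply: has_jetM; [exact: has_jet_cst|exact: has_jet_id].
have QC w : 0 < Im w -> Q w = 0.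
  (* The disc of radius [Y] about ['i Y] lies in the half plane and contains [w] because
     [|w|^2 < 2 Y Im w]; the unit disc with the same centre lies in [Om]. *)
  move=> w0; pose Y := normc w ^+ 2 / (2 * Im w) + 2 * M + 4.
  have p0 : 0 <= normc w ^+ 2 / (2 * Im w) by rewrite divr_ge0 ?sqr_ge0// mulr_ge0// ltW.
  have Y4 : 4 + 2 * M <= Y by rewrite /Y; lra.
  have Yw : normc w ^+ 2 < 2 * Im w * Y.
    rewrite mulrC -ltr_pdivrMr ?mulr_gt0// /Y; lra.
  apply: (@identity_disc R Q (0 +i* Y) 1 Y) => //; first lra.
  - move=> z; move=> h; apply: jQ.
    have := le_lt_trans (normc_ge_Im _) h; rewrite ImB/= ltr_norml => /andP[? _]; lra.
  - move=> z h; apply: Q0.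
    have := le_lt_trans (normc_ge_Im _) h; rewrite ImB/= ltr_norml => /andP[h1 h2].
    have := le_lt_trans (normc_ge_Re _) h; rewrite ReB/= subr0 => h3.
    by split; lra.
  rewrite -(@ltr_pXn2r _ 2) ?nnegrE ?normc_ge0//; last lra.
  move: Yw; rewrite !normc_sqr ReB ImB/=; lra.
move=> w w0; have gn := G_neq0 nu w0; have := QC w w0; rewrite /Q -GE => E.
rewrite /dF F_E.
have -> : ((1 - kap)%:C * (G w)^-1 + (1 - (1 - kap))%:C * w + s%:C) * (Gn nu 2 w / G w ^+ 2)
  = (G w ^+ 2 - (G w ^+ 2 + (- (1 - kap)%:C * Gn nu 2 w
   + - (kap%:C * w + s%:C) * (G w * Gn nu 2 w)))) / (G w ^+ 3).
  by rewrite subKr; field.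
by rewrite E subr0; field.
Qed.

End GlobalEquation.

(** * Boundary values of F *)

Section Gronwall.
Variable R : realType.

Lemma rder_nondecreasing (f df : R -> R) (a b : R) : a <= b ->
  (forall x, a <= x <= b -> rder f x (df x)) ->
  (forall x, a <= x <= b -> 0 <= df x) -> f a <= f b.
Proof.
move=> ab H d0; have [c cab E] := MVT_deriv ab H.
by rewrite -subr_ge0 E mulr_ge0 ?d0// subr_ge0.
Qed.

Lemma rder_expRZ (L x : R) : rder (fun y => expR (L * y)) x (L * expR (L * x)).
Proof.
have h : rder (fun y => L * y) x L.
  by apply: rder_eq (rderM (rder_cst L x) (rder_id x)) _; rewrite mul0r add0r mulr1.
apply: rder_eq (@is_derive1_comp R expR (fun y => L * y) x _ _ (is_derive_expR _) h) _.
by rewrite mulrC.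
Qed.

(** The product of [f] with the integrating factor [expR (L * x)] is nondecreasing. *)
Lemma gronwall (f df : R -> R) (a b L : R) : a <= b ->
  (forall x, a <= x <= b -> rder f x (df x)) ->
  (forall x, a <= x <= b -> - (L * f x) <= df x) -> f a <= f b * expR (L * (b - a)).
Proof.
move=> ab H dL.
have := @rder_nondecreasing (fun y => f y * expR (L * y))
  (fun y => df y * expR (L * y) + f y * (L * expR (L * y))) a b ab.
move=> /(_ (fun x xab => rderM (H x xab) (rder_expRZ L x))) h.
have {h} : f a * expR (L * a) <= f b * expR (L * b).
  apply: h => x xab; have := dL x xab; have := expR_gt0 (L * x); nra.
rewrite mulrBr expRB mulrA ler_pdivlMr ?expR_gt0//.
Qed.

Lemma gronwall_rev (f df : R -> R) (a b L : R) : a <= b ->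
  (forall x, a <= x <= b -> rder f x (df x)) ->
  (forall x, a <= x <= b -> df x <= L * f x) -> f b <= f a * expR (L * (b - a)).
Proof.
move=> ab H dL.
have := @rder_nondecreasing (fun y => 0 - f y * expR (- L * y))
  (fun y => 0 - (df y * expR (- L * y) + f y * (- L * expR (- L * y)))) a b ab.
move=> /(_ (fun x xab => rderB (rder_cst 0 x) (rderM (H x xab) (rder_expRZ (- L) x)))) h.
have {h} : 0 - f a * expR (- L * a) <= 0 - f b * expR (- L * b).
  apply: h => x xab; have := dL x xab; have := expR_gt0 (- L * x); nra.
rewrite !sub0r lerN2 !mulNr !expRN => h.
by rewrite mulrBr expRB mulrA mulrAC -ler_pdivrMr ?expR_gt0.
Qed.

End Gronwall.

Section Boundary.
Variables (R : realType) (F F' : R[i] -> R[i]) (al s : R).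
Hypothesis al0 : 0 < al.
Hypothesis dF : forall w, 0 < Im w -> cder F w (F' w).
Hypothesis ImF : forall w, 0 < Im w -> Im w <= Im (F w).

Definition Dn w : R[i] := al%:C * F w + (1 - al)%:C * w + s%:C.
Hypothesis ode : forall w, 0 < Im w -> Dn w * F' w = F w.

Lemma Im_Dn w : 0 < Im w -> Im w <= Im (Dn w).
Proof.
move=> w0; rewrite /Dn !ImD !ImZ/= addr0.
have := ler_wpM2l (ltW al0) (ImF w0); lra.
Qed.

Lemma Dn_neq0 w : 0 < Im w -> Dn w != 0.
Proof. by move=> w0; apply: Im_gt0_neq0; exact: lt_le_trans (Im_Dn w0). Qed.

Lemma F'E w : 0 < Im w -> F' w = F w / Dn w.
Proof. by move=> w0; rewrite -ode// mulrC mulKf// Dn_neq0. Qed.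

Definition dD w : R[i] := al%:C * F' w + (1 - al)%:C.

Lemma cder_Dn w : 0 < Im w -> cder Dn w (dD w).
Proof.
move=> w0; apply: cder_eq (cderD (cderD (cderZ _ (dF w0)) (cderZ _ (cder_id w))) (cder_cst s%:C w)) _.
by rewrite addr0 mulr1.
Qed.

(** The derivative [dD] may blow up near the real line, but its product with [Dn] is affine in [Dn]
    and [w]. Hence a bound on [Dn] over a box bounds the derivative of [Dn ^+ 2] there. *)
Lemma DndD w : 0 < Im w -> Dn w * dD w = (2 - al)%:C * Dn w - (1 - al)%:C * w - s%:C.
Proof.
move=> w0; rewrite /dD mulrDr mulrCA ode// /Dn.
have -> : (2 - al)%:C = 1 + (1 - al)%:C :> R[i] by rewrite -(rmorph1 (real_complex R)) -rmorphD; congr (_%:C); ring.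
by ring.
Qed.

Definition box (X : R) w := `|Re w| <= X /\ 0 < Im w <= 1.

Lemma box_seg X w1 w2 t : box X w1 -> box X w2 -> 0 <= t <= 1 -> box X (seg w1 w2 t).
Proof.
move=> [a1 /andP[a2 a3]] [b1 /andP[b2 b3]] /andP[t0 t1].
rewrite /box /seg ReD ImD ReZ ImZ ReB ImB; split.
  have -> : Re w1 + t * (Re w2 - Re w1) = (1 - t) * Re w1 + t * Re w2 by ring.
  apply: le_trans (ler_normD _ _) _; rewrite !normrM (ger0_norm t0) ger0_norm ?subr_ge0//.
  nra.
apply/andP; split; last by nra.
have m1 : 0 < Num.min (Im w1) (Im w2) by rewrite lt_min a2.
have m2 : Num.min (Im w1) (Im w2) <= Im w1 by rewrite ge_min lexx.
have m3 : Num.min (Im w1) (Im w2) <= Im w2 by rewrite ge_min lexx orbT.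
apply: lt_le_trans m1 _; nra.
Qed.

(** Compactness gives a bound at height 1. Going down from there, [|Dn|^2 + 1] grows at most
    exponentially: the derivative of [|Dn|^2] is at most [2 |Dn dD| <= 2 C0 (1 + |Dn|) <= 4 C0
    (|Dn|^2 + 1)]. *)
Lemma Dn_bounded (X : R) : exists2 B : R, 0 <= B & forall w, box X w -> normc (Dn w) <= B.
Proof.
have [X0|X0] := ltP X 0.
  by exists 0 => // w [h _]; have := normr_ge0 (Re w); lra.
pose C0 := `|2 - al| + `|1 - al| * (X + 1) + `|s|.
have C00 : 0 <= C0 by rewrite !addr_ge0// mulr_ge0//; lra.
pose N (x y : R) := normc (Dn (x%:C + y%:C * 'i)) ^+ 2 + 1.
have Imxy (x y : R) : Im (x%:C + y%:C * 'i) = y by rewrite ImD ImZ/= mulr1 add0r.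
have Rexy (x y : R) : Re (x%:C + y%:C * 'i) = x by rewrite ReD ReZ/= mulr0 addr0.
have bnd (x y : R) : `|x| <= X -> 0 < y -> y <= 1 -> N x y <= N x 1 * expR (4 * C0 * (1 - y)).
  move=> xX y0 y1.
  pose a (t : R) := Re (Dn (x%:C + t%:C * 'i)); pose b (t : R) := Im (Dn (x%:C + t%:C * 'i)).
  pose d (t : R) := dD (x%:C + t%:C * 'i) * 'i.
  have NE t : N x t = a t * a t + b t * b t + 1 by rewrite /N normc_sqr !expr2.
  rewrite !NE; apply: (@gronwall R (fun t => a t * a t + b t * b t + 1)
     (fun t => Re (d t) * a t + a t * Re (d t) + (Im (d t) * b t + b t * Im (d t)) + 0)) => //.
    move=> t /andP[yt t1]; have t0 : 0 < Im (x%:C + t%:C * 'i) by rewrite Imxy; lra.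
    have da : rder a t (Re (d t)) by apply: cder_is_derive_Re; exact: cder_Dn.
    have db : rder b t (Im (d t)) by apply: cder_is_derive_Im; exact: cder_Dn.
    by apply: rderD (rder_cst _ _); apply: rderD; apply: rderM.
  move=> t /andP[yt t1]; have t0 : 0 < Im (x%:C + t%:C * 'i) by rewrite Imxy; lra.
  set w := x%:C + t%:C * 'i in t0.
  have e1 : normc (Dn w * dD w) <= C0 * (1 + normc (Dn w)).
    rewrite DndD//; apply: le_trans (normc_leB _ _) _.
    have := normc_leB ((2 - al)%:C * Dn w) ((1 - al)%:C * w).
    rewrite !normcM !normcR.
    have wX : normc w <= X + 1.
      by apply: le_trans (normc_le_ReIm _) _; rewrite Rexy Imxy lerD// gtr0_norm; lra.
    have n0 := normc_ge0 (Dn w).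
    have p1 := ler_wpM2l (normr_ge0 (1 - al)) wX.
    have p2 : 0 <= `|1 - al| * (X + 1) * normc (Dn w) by rewrite !mulr_ge0//; lra.
    have p3 := mulr_ge0 (normr_ge0 s) n0.
    have := normr_ge0 (2 - al); rewrite /C0; lra.
  have e2 : `|Re (d t) * a t + b t * Im (d t)| <= normc (Dn w * dD w).
    have -> : Re (d t) * a t + b t * Im (d t) = Re (conjc (Dn w) * dD w * 'i).
      by rewrite /a /b /d -/w; case: (Dn w) (dD w) => [p q] [p' q'] /=; ring.
    apply: le_trans (normc_ge_Re _) _; rewrite !normcM.
    have -> : normc ('i : R[i]) = 1 by rewrite /= expr0n /= add0r expr1n sqrtr1.
    have -> : normc (conjc (Dn w)) = normc (Dn w) by case: (Dn w) => p q /=; rewrite sqrrN.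
    by rewrite mulr1.
  have e3 := le_trans e2 e1; have := ler_norm (- (Re (d t) * a t + b t * Im (d t))).
  rewrite normrN -expr2 -[b t * b t]expr2 -/w.
  have -> : a t ^+ 2 + b t ^+ 2 = normc (Dn w) ^+ 2 by rewrite normc_sqr.
  have : C0 * (1 + normc (Dn w)) <= C0 * (2 * (normc (Dn w) ^+ 2 + 1)).
    by rewrite ler_wpM2l//; have := normc_ge0 (Dn w); nra.
  lra.
have [x0 x0X xmax] : exists2 c, c \in `[- X, X]%R & forall t, t \in `[- X, X]%R -> N t 1 <= N c 1.
  apply: EVT_max; first lra.
  apply: continuous_in_subspaceT => t _.
  pose p (x : R) : R[i] := (0 +i* 1) + x%:C * 1.
  have pE (x : R) : x%:C + 1%:C * 'i = p x by apply: complexP => /=; ring.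
  have NE : N ^~ 1 = fun x => Re (Dn (p x)) * Re (Dn (p x)) + Im (Dn (p x)) * Im (Dn (p x)) + 1.
    by apply/funext => x; rewrite /N pE normc_sqr !expr2.
  have p0 : 0 < Im (p t) by rewrite /p ImD ImZ/= mulr0 addr0.
  have da : rder (fun x => Re (Dn (p x))) t (Re (dD (p t) * 1)).
    by apply: cder_is_derive_Re; exact: cder_Dn.
  have db : rder (fun x => Im (Dn (p x))) t (Im (dD (p t) * 1)).
    by apply: cder_is_derive_Im; exact: cder_Dn.
  rewrite NE; apply: rder_continuous.
  exact: rderD (rderD (rderM da da) (rderM db db)) (rder_cst 1 t).
exists (N x0 1 * expR (4 * C0)); first by rewrite mulr_ge0 ?expR_ge0// addr_ge0 ?sqr_ge0.
move=> w [xX /andP[y0 y1]].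
have wE : w = (Re w)%:C + (Im w)%:C * 'i by apply: complexP; rewrite ?Rexy ?Imxy.
have h1 := bnd _ _ xX y0 y1.
have h2 : N (Re w) 1 <= N x0 1 by apply: xmax; rewrite in_itv/= -ler_norml.
have h3 : normc (Dn w) <= N (Re w) (Im w) by rewrite /N -wE; have := normc_ge0 (Dn w); nra.
apply: (le_trans h3); apply: (le_trans h1); apply: ler_pM => //.
- by rewrite addr_ge0 ?sqr_ge0.
by rewrite ler_expR; nra.
Qed.

Lemma Dn_sqr_lip (X : R) : exists2 C : R, 0 <= C & forall w1 w2, box X w1 -> box X w2 ->
  normc (Dn w2 ^+ 2 - Dn w1 ^+ 2) <= C * normc (w2 - w1).
Proof.
have [B B0 HB] := Dn_bounded X.
pose E := `|2 - al| * B + `|1 - al| * (`|X| + 1) + `|s|.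
have E0 : 0 <= E by rewrite !addr_ge0 ?mulr_ge0 ?addr_ge0.
exists (2 * E); first by rewrite mulr_ge0.
move=> w1 w2 b1 b2.
have H := @cder_segment_bound R (fun w => Dn w * Dn w) (fun w => dD w * Dn w + Dn w * dD w) w1 w2 0 (2 * E).
have {H} : normc (Dn w2 * Dn w2 - Dn w1 * Dn w1 - 0 * (w2 - w1)) <= 2 * E * normc (w2 - w1).
  apply: H => t t01; have [xX /andP[y0 y1]] := box_seg b1 b2 t01.
    by apply: cderM; exact: cder_Dn.
  rewrite subr0 (_ : _ + _ = 2%:R * (Dn (seg w1 w2 t) * dD (seg w1 w2 t))); last by ring.
  rewrite normcM.
  have -> : normc (2%:R : R[i]) = 2.
    by rewrite (_ : 2 = (2 : R)%:C) ?normcR ?ger0_norm// rmorph_nat.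
  rewrite ler_wpM2l// DndD//.
  set w := seg w1 w2 t in xX y0 y1 *.
  apply: le_trans (normc_leB _ _) _; rewrite normcR lerD2r.
  apply: le_trans (normc_leB _ _) _; rewrite !normcM !normcR.
  apply: lerD; apply: ler_wpM2l => //; first exact/HB/box_seg.
  apply: le_trans (normc_le_ReIm _) _; apply: lerD; first exact: le_trans xX (ler_norm _).
  by rewrite gtr0_norm.
by rewrite mul0r subr0 !expr2.
Qed.

(** The sign conditions give [|d2 + d1| >= |d2 - d1|]: the squares of these moduli differ by four
    times the real inner product of [d1] and [d2]. *)
Lemma sqr_diff_le (d1 d2 : R[i]) : 0 <= Im d1 -> 0 <= Im d2 -> 0 <= Re d1 * Re d2 ->
  normc (d2 - d1) ^+ 2 <= normc (d2 ^+ 2 - d1 ^+ 2).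
Proof.
move=> i1 i2 r12; have -> : d2 ^+ 2 - d1 ^+ 2 = (d2 - d1) * (d2 + d1) by ring.
rewrite normcM expr2 ler_wpM2l ?normc_ge0//; apply: ger0_ler_sqr; first exact: normc_ge0.
rewrite !normc_sqr !ReD !ImD ReN ImN.
have := mulr_ge0 i1 i2; nra.
Qed.

(* [Dn] is recovered from [Dn ^+ 2] as a square root with values in the upper
   half plane; the intermediate value theorem handles a change of sign of [Re]. *)
Lemma Dn_holder (X : R) : exists2 C : R, 0 <= C & forall w1 w2, box X w1 -> box X w2 ->
  normc (Dn w2 - Dn w1) ^+ 2 <= C * normc (w2 - w1).
Proof.
have [C C0 HC] := Dn_sqr_lip X; exists (4 * C); first by rewrite mulr_ge0.
move=> w1 w2 b1 b2; have n0 := normc_ge0 (w2 - w1).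
have I w : box X w -> 0 <= Im (Dn w).
  by move=> [_ /andP[y0 _]]; rewrite ltW// (lt_le_trans y0)// Im_Dn.
have P v1 v2 : box X v1 -> box X v2 -> 0 <= Re (Dn v1) * Re (Dn v2) ->
    normc (Dn v2 - Dn v1) ^+ 2 <= C * normc (v2 - v1).
  by move=> c1 c2 r12; apply: le_trans (HC _ _ c1 c2); apply: sqr_diff_le => //; exact: I.
have [r12|r12] := leP 0 (Re (Dn w1) * Re (Dn w2)).
  by apply: le_trans (P _ _ b1 b2 r12) _; have := mulr_ge0 C0 n0; lra.
pose f (t : R) := Re (Dn (w1 + t%:C * (w2 - w1))).
have f0 : f 0 = Re (Dn w1) by rewrite /f mul0r addr0.
have f1 : f 1 = Re (Dn w2) by rewrite /f mul1r addrC subrK.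
have [t t01 ft] : exists2 t, t \in `[0, 1]%R & f t = 0.
  apply: IVT => //.
    apply: derivable_within_continuous => t; rewrite in_itv/= => t01.
    have [_ /andP[y0 _]] := box_seg b1 b2 t01.
    by have [] := cder_is_derive_Re (cder_Dn y0).
  rewrite f0 f1 ge_min le_max; apply/andP; split; apply/orP.
    by have [|h] := leP (Re (Dn w1)) 0; [left|right; nra].
  by have [|h] := leP 0 (Re (Dn w1)); [left|right; nra].
rewrite in_itv/= in t01; have b3 := box_seg b1 b2 t01; have /andP[t0 t1] := t01.
set w3 := seg w1 w2 t in b3.
have r3 : Re (Dn w3) = 0 by exact: ft.
have h1 := P _ _ b1 b3; rewrite r3 mulr0 in h1; have {}h1 := h1 (lexx _).
have h2 := P _ _ b3 b2; rewrite r3 mul0r in h2; have {}h2 := h2 (lexx _).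
have n1 : normc (w3 - w1) = t * normc (w2 - w1).
  by rewrite /w3 /seg addrAC subrr add0r normcM normcR ger0_norm.
have n2 : normc (w2 - w3) = (1 - t) * normc (w2 - w1).
  rewrite (_ : w2 - w3 = (1 - t)%:C * (w2 - w1)) ?normcM ?normcR ?ger0_norm ?subr_ge0//.
  by rewrite /w3 /seg rmorphB rmorph1; ring.
rewrite n1 in h1; rewrite n2 in h2.
have := normc_triangle (Dn w3) (Dn w2) (Dn w1).
have q1 := normc_ge0 (Dn w2 - Dn w3); have q2 := normc_ge0 (Dn w3 - Dn w1); have q3 := normc_ge0 (Dn w2 - Dn w1).
move: h1 h2 q1 q2 q3; set a := normc (Dn w2 - Dn w3); set b := normc (Dn w3 - Dn w1); set c := normc (Dn w2 - Dn w1).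
move=> h1 h2 q1 q2 q3 abc.
have c2 : c ^+ 2 <= (a + b) ^+ 2 by rewrite ler_pXn2r ?nnegrE// addr_ge0.
have ab2 : (a + b) ^+ 2 <= 2 * a ^+ 2 + 2 * b ^+ 2 by have := sqr_ge0 (a - b); nra.
have := mulr_ge0 C0 n0; lra.
Qed.

(** [al F] is [Dn] minus an affine function, and on a bounded box a Lipschitz term is also Hoelder
    of exponent 1/2. *)
Lemma F_holder (X : R) : exists2 C : R, 0 <= C & forall w1 w2, box X w1 -> box X w2 ->
  normc (F w2 - F w1) ^+ 2 <= C * normc (w2 - w1).
Proof.
have [C C0 HC] := Dn_holder X.
have q0 : 0 <= (1 - al) ^+ 2 * (2 * `|X| + 1).
  by rewrite mulr_ge0 ?sqr_ge0// addr_ge0// mulr_ge0.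
exists ((2 * C + 2 * ((1 - al) ^+ 2 * (2 * `|X| + 1))) / al ^+ 2).
  by rewrite divr_ge0 ?sqr_ge0// addr_ge0// mulr_ge0.
move=> w1 w2 b1 b2; have h := HC _ _ b1 b2.
rewrite mulrAC ler_pdivlMr ?exprn_gt0//.
have n0 := normc_ge0 (w2 - w1).
have nX : normc (w2 - w1) <= 2 * `|X| + 1.
  case: b1 b2 => [x1 /andP[y1 y1']] [x2 /andP[y2 y2']].
  apply: le_trans (normc_le_ReIm _) _; rewrite ReB ImB; apply: lerD; last first.
    by rewrite ler_norml; apply/andP; split; lra.
  by apply: le_trans (ler_normB _ _) _; have := ler_norm X; lra.
have e : normc (F w2 - F w1) * al = normc ((Dn w2 - Dn w1) - (1 - al)%:C * (w2 - w1)).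
  rewrite -[X in _ * X](gtr0_norm al0) -(normcR al) -normcM; congr normc.
  by rewrite /Dn; ring.
rewrite -exprMn e.
have := normc_leB (Dn w2 - Dn w1) ((1 - al)%:C * (w2 - w1)).
rewrite normcM normcR; set a := normc (Dn w2 - Dn w1) in h *.
set b := `|1 - al| * _; set c := normc (_ - _ * _) => cab.
have b2E : b ^+ 2 = (1 - al) ^+ 2 * normc (w2 - w1) ^+ 2.
  by rewrite /b exprMn real_normK ?num_real.
have c0 : 0 <= c by exact: normc_ge0.
have a0 : 0 <= a by exact: normc_ge0.
have b0 : 0 <= b by rewrite mulr_ge0.
have c2 : c ^+ 2 <= (a + b) ^+ 2 by rewrite ler_pXn2r ?nnegrE// addr_ge0.
have ab2 : (a + b) ^+ 2 <= 2 * a ^+ 2 + 2 * b ^+ 2 by have := sqr_ge0 (a - b); nra.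
have : (1 - al) ^+ 2 * normc (w2 - w1) ^+ 2 <= (1 - al) ^+ 2 * (2 * `|X| + 1) * normc (w2 - w1).
  by rewrite -mulrA ler_wpM2l ?sqr_ge0// expr2 ler_wpM2r.
rewrite -b2E; lra.
Qed.

(** The Hoelder bound is uniform down to the real line, so along the heights [4^-n] the values
    change by a multiple of [2^-n]. The limit is taken over all nearby [x'] as well, from which the
    continuity of [F0] will follow. *)
Lemma boundary_value : exists F0 : R -> R[i], forall x (e : R), 0 < e ->
  exists2 d : R, 0 < d & forall x' y' : R, `|x' - x| < d -> 0 < y' < d ->
    normc (F (x' +i* y') - F0 x) <= e.
Proof.
suff ex (x : R) : exists l, forall e : R, 0 < e -> exists2 d : R, 0 < d &
    forall x' y' : R, `|x' - x| < d -> 0 < y' < d -> normc (F (x' +i* y') - l) <= e.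
  by have [F0 HF] := choice ex; exists F0.
have [C C0 HC] := F_holder (`|x| + 1).
pose y n : R := 4^-1 ^+ n.
have y0 n : 0 < y n by rewrite exprn_gt0// invr_gt0.
have y1 n : y n <= 1 by rewrite exprn_ile1// invf_le1// ler1n.
have bx n : box (`|x| + 1) (x +i* y n) by rewrite /box/= y0 y1; split => //; lra.
have C1 : 0 <= C + 1 by lra.
have p0 n : 0 < 2^-1 ^+ n :> R by rewrite exprn_gt0// invr_gt0.
have yE n : y n = (2^-1 ^+ n) ^+ 2.
  by rewrite exprAC; congr (_ ^+ n); field.
have [||l Hl] := @complex_geometric_cvg R (fun n => F (x +i* y n)) (normc (F (x +i* y 0%N)) + (C + 1)) (C + 1) C1.
- move=> n; have h : normc (F (x +i* y n) - F (x +i* y 0%N)) <= C + 1.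
    apply: ger0_ler_sqr => //; apply: le_trans (HC _ _ (bx 0%N) (bx n)) _.
    have : normc ((x +i* y n) - (x +i* y 0%N)) <= 1.
      apply: le_trans (normc_le_ReIm _) _; rewrite ReB ImB/= subrr normr0 add0r ler_norml.
      by have := y0 n; have := y1 n; rewrite /y expr0; lra.
    nra.
  by have := normcD_le (F (x +i* y n) - F (x +i* y 0%N)) (F (x +i* y 0%N)); rewrite subrK; lra.
- move=> n; apply: ger0_ler_sqr; first by rewrite mulr_ge0// ltW.
  apply: le_trans (HC _ _ (bx n) (bx n.+1)) _.
  have h : normc ((x +i* y n.+1) - (x +i* y n)) <= (2^-1 ^+ n) ^+ 2.
    apply: le_trans (normc_le_ReIm _) _; rewrite ReB ImB/= subrr normr0 add0r ler_norml -yE.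
    have -> : y n.+1 = 4^-1 * y n by rewrite /y exprS.
    by have := y0 n; lra.
  by rewrite exprMn; have := sqr_ge0 (2^-1 ^+ n : R); nra.
exists l => e e0; have C2 : 0 < C + 1 by lra.
(* The two points compared are at distance at most [2 d], and [2 (C + 1) d <= (e / 2)^2]. *)
pose d := Num.min 1 (e ^+ 2 / (8 * (C + 1))).
have d0 : 0 < d by rewrite lt_min ltr01 divr_gt0 ?exprn_gt0// mulr_gt0.
exists d => // x' y' xx /andP[y'0 y'd].
have e20 : 0 < e / 2 by rewrite divr_gt0.
have [N HN] := Hl _ e20.
have [n nN yd] : exists2 n, (N <= n)%N & y n < d.
  have : y @ \oo --> (0 : R) by apply: cvg_expr; rewrite ger0_norm// invf_lt1// ltr1n.
  move/cvgrPdist_lt => /(_ _ d0)[m _ Hm]; exists (maxn N m); first exact: leq_maxl.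
  have := Hm (maxn N m) (leq_maxr _ _); rewrite /= sub0r normrN gtr0_norm//.
have [d1 d2] : d <= 1 /\ d <= e ^+ 2 / (8 * (C + 1)) by rewrite !ge_min !lexx orbT.
have b' : box (`|x| + 1) (x' +i* y').
  rewrite /box/= y'0; split; last by rewrite /= ltW//; lra.
  by rewrite -(subrK x x') (le_trans (ler_normD _ _))//; lra.
have h1 := HC _ _ (bx n) b'.
have h2 : normc ((x' +i* y') - (x +i* y n)) <= 2 * d.
  apply: le_trans (normc_le_ReIm _) _; rewrite ReB ImB/=.
  have : `|y' - y n| <= d by rewrite ler_norml; have := y0 n; lra.
  lra.
have h3 : normc (F (x' +i* y') - F (x +i* y n)) <= e / 2.
  apply: ger0_ler_sqr; first lra.
  apply: (le_trans h1); apply: (@le_trans _ _ ((C + 1) * (2 * d))).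
    apply: ler_pM => //; [exact: normc_ge0|lra].
  by move: d2; rewrite ler_pdivlMr ?mulr_gt0//; lra.
have := HN n nN; have := normc_triangle (F (x +i* y n)) (F (x' +i* y')) l; lra.
Qed.

End Boundary.

(** * Differentiability and absence of zeros on the real line *)

Section BoundaryFunction.
Variables (R : realType) (F F' : R[i] -> R[i]) (al s : R) (F0 : R -> R[i]).
Hypothesis al0 : 0 < al.
Hypothesis dF : forall w, 0 < Im w -> cder F w (F' w).
Hypothesis ImF : forall w, 0 < Im w -> Im w < Im (F w).
Hypothesis ode : forall w, 0 < Im w -> Dn F al s w * F' w = F w.
Hypothesis bF0 : forall x (e : R), 0 < e ->
  exists2 d : R, 0 < d & forall x' y' : R, `|x' - x| < d -> 0 < y' < d ->
    normc (F (x' +i* y') - F0 x) <= e.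

Let ImFle w : 0 < Im w -> Im w <= Im (F w).
Proof. by move=> /ImF /ltW. Qed.

Let ImD_le w : 0 < Im w -> Im w <= Im (Dn F al s w).
Proof. exact: (Im_Dn s al0 ImFle). Qed.

Let F'_quot w : 0 < Im w -> F' w = F w / Dn F al s w.
Proof. exact: (F'E al0 ImFle ode). Qed.

Definition Dn0 x : R[i] := al%:C * F0 x + (1 - al)%:C * x%:C + s%:C.

Lemma F0_continuous x (e : R) : 0 < e -> exists2 d : R, 0 < d &
  forall x', `|x' - x| < d -> normc (F0 x' - F0 x) <= e.
Proof.
move=> e0; have e20 : 0 < e / 2 by rewrite divr_gt0.
have [d d0 H] := bF0 x e20; exists d => // x' xx.
have [d' d'0 H'] := bF0 x' e20.
pose y := Num.min d d' / 2; have m0 : 0 < Num.min d d' by rewrite lt_min d0.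
have y0 : 0 < y by rewrite divr_gt0.
have : y < Num.min d d' by rewrite /y; lra.
rewrite lt_min => /andP[y1 y2].
have h1 := H x' y xx; rewrite y0 y1 in h1; have {}h1 := h1 isT.
have h2 := H' x' y; rewrite subrr normr0 y0 y2 in h2; have {}h2 := h2 d'0 isT.
by have := normc_triangle (F (x' +i* y)) (F0 x') (F0 x); rewrite normcB in h2; lra.
Qed.

Let yn n : R := n.+1%:R^-1.

Lemma F_cvg_boundary x (e : R) : 0 < e -> exists N, forall n, (N <= n)%N ->
  normc (F (x +i* n.+1%:R^-1) - F0 x) <= e.
Proof.
move=> e0; have [d d0 H] := bF0 x e0.
have : (fun n => n.+1%:R^-1) @ \oo --> (0 : R) by exact: cvg_harmonic.
move/cvgrPdist_lt => /(_ _ d0)[N _ HN]; exists N => n /HN /=.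
rewrite sub0r normrN gtr0_norm ?invr_gt0// => nd.
by apply: H; rewrite ?subrr ?normr0// nd invr_gt0 ltr0Sn.
Qed.

Lemma Re_F_cvg x : (fun n => Re (F (x +i* n.+1%:R^-1))) @ \oo --> Re (F0 x).
Proof.
apply/cvgrPdist_le => e /(F_cvg_boundary x)[N HN]; exists N => // n /= /HN h.
by rewrite distrC -ReB (le_trans (normc_ge_Re _)).
Qed.

Lemma Im_F_cvg x : (fun n => Im (F (x +i* n.+1%:R^-1))) @ \oo --> Im (F0 x).
Proof.
apply/cvgrPdist_le => e /(F_cvg_boundary x)[N HN]; exists N => // n /= /HN h.
by rewrite distrC -ImB (le_trans (normc_ge_Im _)).
Qed.

Lemma Im_F0_ge0 x : 0 <= Im (F0 x).
Proof.
have <- : limn (fun n => Im (F (x +i* n.+1%:R^-1))) = Im (F0 x) by apply: cvg_lim => //; exact: Im_F_cvg.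
apply: limr_ge; first by apply/cvg_ex; exists (Im (F0 x)); exact: Im_F_cvg.
apply: nearW => n; have h : 0 < Im (x +i* n.+1%:R^-1) by rewrite /= invr_gt0.
by rewrite ltW// (lt_trans h)// ImF.
Qed.

Lemma Dn_near x (e : R) : 0 < e -> exists2 d : R, 0 < d & forall x' y' : R, `|x' - x| < d -> 0 < y' < d ->
    normc (F (x' +i* y') - F0 x) <= e /\ normc (Dn F al s (x' +i* y') - Dn0 x) <= e.
Proof.
move=> e0; have A0 : 0 < al + 2 * `|1 - al| + 1 by rewrite ltr_wpDl// addr_ge0 ?mulr_ge0// ltW.
pose e1 := Num.min e (e / (al + 2 * `|1 - al| + 1)).
have e10 : 0 < e1 by rewrite lt_min e0 divr_gt0.
have [e1a e1b] : e1 <= e /\ e1 * (al + 2 * `|1 - al| + 1) <= e.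
  by rewrite -ler_pdivlMr// !ge_min !lexx orbT.
clearbody e1.
have [d d0 H] := bF0 x e10; exists (Num.min d e1); first by rewrite lt_min d0.
move=> x' y'; rewrite !lt_min => /andP[x1 x2] /andP[y0 /andP[y1 y2]].
have h : normc (F (x' +i* y') - F0 x) <= e1 by apply: H; rewrite ?y0.
split; first exact: le_trans e1a.
have -> : Dn F al s (x' +i* y') - Dn0 x = al%:C * (F (x' +i* y') - F0 x) + (1 - al)%:C * ((x' - x) +i* y').
  by rewrite /Dn /Dn0 (_ : (x' - x) +i* y' = (x' +i* y') - x%:C); [ring|apply: complexP => /=; rewrite ?ReB ?ImB/= ?subr0].
apply: le_trans (normcD_le _ _) _; rewrite !normcM !normcR (gtr0_norm al0).
have : normc ((x' - x) +i* y') <= 2 * e1.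
  by apply: le_trans (normc_le_ReIm _) _ => /=; rewrite (gtr0_norm y0); lra.
move=> /(ler_wpM2l (normr_ge0 (1 - al))); have := ler_wpM2l (ltW al0) h; lra.
Qed.

Lemma F'_near x (e : R) : Dn0 x != 0 -> 0 < e -> exists2 d : R, 0 < d &
  forall x' y' : R, `|x' - x| < d -> 0 < y' < d -> normc (F' (x' +i* y') - F0 x / Dn0 x) <= e.
Proof.
move=> D0 e0; have n0 : 0 < normc (Dn0 x) by rewrite normc_gt0.
set n := normc (Dn0 x) in n0; have f0 := normc_ge0 (F0 x); set f := normc (F0 x) in f0.
have A0 : 0 < 2 * (n + f) by rewrite mulr_gt0// ltr_wpDr.
pose e1 := Num.min (n / 2) (e * n ^+ 2 / (2 * (n + f))).
have e10 : 0 < e1 by rewrite lt_min !divr_gt0// mulr_gt0// exprn_gt0.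
have [e1a e1b] : e1 <= n / 2 /\ e1 * (2 * (n + f)) <= e * n ^+ 2.
  by rewrite -ler_pdivlMr// !ge_min !lexx orbT.
have [d d0 H] := Dn_near x e10; exists d => // x' y' xx yy; have [h1 h2] := H x' y' xx yy.
have y0 : 0 < Im (x' +i* y') by case/andP: yy.
rewrite F'_quot//; set w := x' +i* y' in y0 h1 h2 *.
have m : n / 2 <= normc (Dn F al s w).
  by have := normc_geB (Dn0 x) (Dn0 x - Dn F al s w); rewrite subKr normcB -/n; lra.
have Dw : Dn F al s w != 0 by rewrite -normc_gt0; lra.
have -> : F w / Dn F al s w - F0 x / Dn0 x =
  ((F w - F0 x) * Dn0 x - F0 x * (Dn F al s w - Dn0 x)) / (Dn F al s w * Dn0 x) by field; rewrite Dw D0.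
rewrite normcM normcV normcM -/n ler_pdivrMr ?mulr_gt0//; last lra.
apply: le_trans (normc_leB _ _) _; rewrite !normcM -/n -/f.
have := ler_wpM2r (ltW n0) h1; have := ler_wpM2l f0 h2.
have : e * (n / 2 * n) <= e * (normc (Dn F al s w) * n).
  by rewrite ler_wpM2l ?ler_wpM2r// ltW.
move: e1b; rewrite expr2; lra.
Qed.

(** The mean value inequality on a horizontal segment of small height [y], where [F'] is close to
    [F0 x / Dn0 x]; the bound does not depend on [y], which can then tend to 0. *)
Lemma F0_increment x (e : R) : Dn0 x != 0 -> 0 < e -> exists2 d : R, 0 < d &
  forall h : R, `|h| < d -> normc (F0 (x + h) - F0 x - F0 x / Dn0 x * h%:C) <= e * `|h|.
Proof.
move=> D0 e0; have [d d0 H] := F'_near D0 e0; exists d => // h hd.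
apply/ler_addgt0Pl => e' e'0; have e'2 : 0 < e' / 2 by rewrite divr_gt0.
have [d1 d10 H1] := bF0 x e'2; have [d2 d20 H2] := bF0 (x + h) e'2.
pose y := Num.min d (Num.min d1 d2) / 2.
have m0 : 0 < Num.min d (Num.min d1 d2) by rewrite !lt_min d0 d10.
have y0 : 0 < y by rewrite divr_gt0.
have : y < Num.min d (Num.min d1 d2) by rewrite /y; lra.
rewrite !lt_min => /andP[yd /andP[y1 y2]].
have {}H1 : normc (F (x +i* y) - F0 x) <= e' / 2.
  by apply: H1; rewrite ?subrr ?normr0// y0.
have {}H2 : normc (F ((x + h) +i* y) - F0 (x + h)) <= e' / 2.
  by apply: H2; rewrite ?subrr ?normr0// y0.
have wE : ((x + h) +i* y) - (x +i* y) = h%:C :> R[i] by apply: complexP; rewrite ?ReB ?ImB/=; ring.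
have segE (t : R) : seg (x +i* y) ((x + h) +i* y) t = (x + t * h) +i* y.
  by rewrite /seg wE; apply: complexP; rewrite ?ReD ?ImD ?ReZ ?ImZ/= ?mulr0 ?addr0.
have := @cder_segment_bound R F F' (x +i* y) ((x + h) +i* y) (F0 x / Dn0 x) e.
rewrite wE normcR => HS; have {}HS : normc (F ((x + h) +i* y) - F (x +i* y) - F0 x / Dn0 x * h%:C) <= e * `|h|.
  apply: HS => t /andP[t0 t1]; rewrite segE; first exact: dF.
  apply: H; last by rewrite y0.
  rewrite addrAC subrr add0r normrM ger0_norm//; apply: le_lt_trans hd.
  by rewrite ler_piMl.
have -> : F0 (x + h) - F0 x - F0 x / Dn0 x * h%:C =
  (F ((x + h) +i* y) - F (x +i* y) - F0 x / Dn0 x * h%:C) + ((F (x +i* y) - F0 x) - (F ((x + h) +i* y) - F0 (x + h))) by ring.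
apply: le_trans (normcD_le _ _) _.
have := normc_leB (F (x +i* y) - F0 x) (F ((x + h) +i* y) - F0 (x + h)); lra.
Qed.

Lemma rder_Re_F0 x : Dn0 x != 0 -> rder (fun x => Re (F0 x)) x (Re (F0 x / Dn0 x)).
Proof.
move=> D0; apply: is_derive_eps => e /(F0_increment D0)[d d0 H]; exists d => // h /H.
by apply: le_trans; rewrite [_ * h]mulrC -ReZ mulrC -!ReB normc_ge_Re.
Qed.

Lemma rder_Im_F0 x : Dn0 x != 0 -> rder (fun x => Im (F0 x)) x (Im (F0 x / Dn0 x)).
Proof.
move=> D0; apply: is_derive_eps => e /(F0_increment D0)[d d0 H]; exists d => // h /H.
by apply: le_trans; rewrite [_ * h]mulrC -ImZ mulrC -!ImB normc_ge_Im.
Qed.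

Lemma Im_Dn0 x : Im (Dn0 x) = al * Im (F0 x).
Proof. by rewrite /Dn0 !ImD !ImZ/= mulr0 !addr0. Qed.

(** Along horizontal lines [Re F / Im F] has the nonnegative derivative
    [Im D |F|^2 / (|D|^2 (Im F)^2)], where [D] is [Dn]. The cross-multiplied form stays meaningful
    on the real line, where [Im F0] may vanish. *)
Lemma cross_interior (x1 x2 y : R) : 0 < y -> x1 <= x2 ->
  Re (F (x1 +i* y)) * Im (F (x2 +i* y)) <= Re (F (x2 +i* y)) * Im (F (x1 +i* y)).
Proof.
move=> y0 x12.
have v0 (x : R) : 0 < Im (F (x +i* y)).
  have h : 0 < Im (x +i* y) by [].
  by apply: lt_trans (ImF h).
have E (x : R) : (0 +i* y) + x%:C * 1 = x +i* y by apply: complexP; rewrite mulr1 ?ReD ?ImD/= ?add0r ?addr0.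
have du (x : R) : rder (fun x => Re (F (x +i* y))) x (Re (F' (x +i* y))).
  have := @cder_is_derive_Re R F (0 +i* y) 1 x (F' (x +i* y)); rewrite E mulr1.
  under eq_fun do rewrite E.
  by apply; exact: dF.
have dv (x : R) : rder (fun x => Im (F (x +i* y))) x (Im (F' (x +i* y))).
  have := @cder_is_derive_Im R F (0 +i* y) 1 x (F' (x +i* y)); rewrite E mulr1.
  under eq_fun do rewrite E.
  by apply; exact: dF.
rewrite -ler_pdivrMr// mulrAC -ler_pdivlMr//.
apply: (@rder_nondecreasing R (fun x => Re (F (x +i* y)) / Im (F (x +i* y)))
  (fun x => (Re (F' (x +i* y)) * Im (F (x +i* y)) - Re (F (x +i* y)) * Im (F' (x +i* y))) / Im (F (x +i* y)) ^+ 2)) => //.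
  by move=> x _; exact: (rder_quot (lt0r_neq0 (v0 x)) (du x) (dv x)).
move=> x _; rewrite divr_ge0 ?sqr_ge0//.
have h : 0 < Im (x +i* y) by [].
rewrite F'_quot//; set w := x +i* y in h *.
have D0 := lt_le_trans h (ImD_le h).
have Dn2 : 0 < normc (Dn F al s w) ^+ 2 by rewrite exprn_gt0// normc_gt0 Im_gt0_neq0.
rewrite ReM ImM Re_inv Im_inv.
set u := Re (F w); set v := Im (F w); set a := Re (Dn F al s w); set b := Im (Dn F al s w) in D0 *.
move: Dn2; move: (normc (Dn F al s w) ^+ 2) => q Dn2.
rewrite (_ : _ - _ = b * (u ^+ 2 + v ^+ 2) / q); last by field; exact: lt0r_neq0.
by rewrite divr_ge0 ?(ltW Dn2)// mulr_ge0 ?(ltW D0)// addr_ge0 ?sqr_ge0.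
Qed.

Lemma cross_boundary (x1 x2 : R) : x1 <= x2 -> Re (F0 x1) * Im (F0 x2) <= Re (F0 x2) * Im (F0 x1).
Proof.
move=> x12.
have cv x x' : (fun n => Re (F (x +i* n.+1%:R^-1)) * Im (F (x' +i* n.+1%:R^-1))) @ \oo -->
    Re (F0 x) * Im (F0 x') by apply: cvgM; [exact: Re_F_cvg|exact: Im_F_cvg].
apply: (ler_cvg_to (@cv x1 x2) (@cv x2 x1)).
by apply: nearW => n; apply: cross_interior => //; rewrite invr_gt0.
Qed.

(** Near [x] the logarithmic derivative [F' / F = 1 / Dn] is bounded, so Gronwall's inequality
    carries the zero at [x] up the vertical line, where [Im F > 0]. *)
Lemma F0_neq0_regular x : F0 x = 0 -> Dn0 x != 0 -> False.
Proof.
move=> F00 D0; have n0 : 0 < normc (Dn0 x) by rewrite normc_gt0.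
have n20 : 0 < normc (Dn0 x) / 2 by rewrite divr_gt0.
have [d d0 H] := Dn_near x n20; pose y1 := d / 2.
have y10 : 0 < y1 by rewrite divr_gt0.
(* The logarithmic derivative of [|F|^2] is at most [2 / |Dn|], and [|Dn| >= |Dn0 x| / 2] near
   [x]. *)
pose L := 4 / normc (Dn0 x); have L0 : 0 < L by rewrite divr_gt0.
pose u (y : R) := Re (F (x%:C + y%:C * 'i)); pose v (y : R) := Im (F (x%:C + y%:C * 'i)).
have wE (y : R) : x%:C + y%:C * 'i = x +i* y by apply: complexP => /=; ring.
pose N (y : R) := u y * u y + v y * v y.
have NE y : N y = normc (F (x +i* y)) ^+ 2 by rewrite /N /u /v wE normc_sqr !expr2.
have N1 : 0 < N y1.
  rewrite NE exprn_gt0// normc_gt0 Im_gt0_neq0//.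
  by have h : 0 < Im (x +i* y1) by []; apply: lt_trans (ImF h).
have key y : 0 < y -> y <= y1 -> N y1 <= N y * expR (L * (y1 - y)).
  move=> y0 yy.
  pose du (t : R) := Re (F' (x%:C + t%:C * 'i) * 'i); pose dv (t : R) := Im (F' (x%:C + t%:C * 'i) * 'i).
  apply: (@gronwall_rev R N (fun t => du t * u t + u t * du t + (dv t * v t + v t * dv t))) => // t /andP[ty ty1].
    have t0 : 0 < Im (x%:C + t%:C * 'i) by rewrite wE; exact: lt_le_trans ty.
    have hu : rder u t (du t) by apply: cder_is_derive_Re; exact: dF.
    have hv : rder v t (dv t) by apply: cder_is_derive_Im; exact: dF.
    by apply: rderD; apply: rderM.
  have t0 : 0 < Im (x +i* t) by exact: lt_le_trans ty.
  have [_ Dt] : normc (F (x +i* t) - F0 x) <= normc (Dn0 x) / 2 /\ normc (Dn F al s (x +i* t) - Dn0 x) <= normc (Dn0 x) / 2.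
    apply: H; first by rewrite subrr normr0.
    by apply/andP; split; [exact: t0|rewrite /y1 in ty1; lra].
  have m : normc (Dn0 x) / 2 <= normc (Dn F al s (x +i* t)).
    by have := normc_geB (Dn0 x) (Dn0 x - Dn F al s (x +i* t)); rewrite subKr normcB; lra.
  rewrite NE /du /dv /u /v wE; set w := x +i* t in t0 m *.
  have -> : Re (F' w * 'i) * Re (F w) + Re (F w) * Re (F' w * 'i) + (Im (F' w * 'i) * Im (F w) + Im (F w) * Im (F' w * 'i))
    = 2 * Re (conjc (F w) * (F' w * 'i)).
    by case: (F w) (F' w) => [p q] [p' q'] /=; ring.
  apply: (@le_trans _ _ (2 * (normc (F w) * normc (F' w)))).
    rewrite ler_wpM2l// (le_trans (ler_norm _))// (le_trans (normc_ge_Re _))// !normcM.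
    have -> : normc ('i : R[i]) = 1 by rewrite /= expr0n /= add0r expr1n sqrtr1.
    have -> : normc (conjc (F w)) = normc (F w) by case: (F w) => p q /=; rewrite sqrrN.
    by rewrite mulr1.
  rewrite F'_quot// normcM normcV; set f := normc (F w); set n := normc (Dn F al s w) in m *.
  have n0' : 0 < n by exact: lt_le_trans m.
  have ni : n^-1 <= 2 / normc (Dn0 x) by rewrite -[leRHS]invrK invf_div lef_pV2// posrE.
  have f20 : 0 <= f ^+ 2 by exact: sqr_ge0.
  have := ler_wpM2l f20 ni; rewrite /L expr2; lra.
pose K := expR (L * y1); have K0 : 0 < K by exact: expR_gt0.
pose e := Num.min 1 (N y1 / (2 * K)).
have e0 : 0 < e by rewrite lt_min ltr01 divr_gt0// mulr_gt0.
have [e1 e2] : e <= 1 /\ e * (2 * K) <= N y1.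
  by rewrite -ler_pdivlMr ?mulr_gt0// !ge_min !lexx orbT.
have [d' d'0 H'] := bF0 x e0.
pose y := Num.min d' y1 / 2; have m0 : 0 < Num.min d' y1 by rewrite lt_min d'0.
have y0 : 0 < y by rewrite divr_gt0.
have : y < Num.min d' y1 by rewrite /y; lra.
rewrite lt_min => /andP[yd yy].
have := H' x y; rewrite subrr normr0 y0 yd F00 subr0 => /(_ d'0 isT) Fe.
have := key y y0 (ltW yy).
have Ne : N y <= e by rewrite NE; have := normc_ge0 (F (x +i* y)); nra.
have Ke : expR (L * (y1 - y)) <= K by rewrite ler_expR; nra.
have := expR_ge0 (L * (y1 - y)).
have N0 : 0 <= N y by rewrite NE sqr_ge0.
set E := expR _ => E0 h.
have : N y * E <= e * K by apply: ler_pM.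
lra.
Qed.

(* On the vertical line above [x] the quantity [|F w - (w - x)|^2 / |F w|^(2 (1 - al))]
   is a constant of motion, which is forced to vanish when [F0 x = 0]. *)
Lemma F0_neq0_singular x : F0 x = 0 -> Dn0 x = 0 -> False.
Proof.
move=> F00; rewrite /Dn0 F00 mulr0 add0r => D0.
have wE (y : R) : x%:C + y%:C * 'i = x +i* y by apply: complexP => /=; ring.
pose de w := F w - (w - x%:C); pose de' w := F' w - 1.
have cde w : 0 < Im w -> cder de w (de' w).
  move=> w0; apply: cderB; first exact: dF.
  by apply: cder_eq (cderB (cder_id w) (cder_cst x%:C w)) _; rewrite subr0.
have DE w : Dn F al s w = al%:C * F w + (1 - al)%:C * (w - x%:C).
  by rewrite /Dn -addrA; congr (_ + _); rewrite mulrBr (_ : s%:C = - ((1 - al)%:C * x%:C))//; apply/eqP; rewrite -addr_eq0 addrC D0.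
(* Here [s = - (1 - al) x], which gives [F - Dn = (1 - al) (F - (w - x))]. *)
have deE w : 0 < Im w -> de' w = (1 - al)%:C * (de w / Dn F al s w).
  move=> w0; have Dw : Dn F al s w != 0 by apply: Im_gt0_neq0; exact: lt_le_trans (ImD_le w0).
  apply: (mulIf Dw); rewrite mulrA divfK// /de' F'_quot// mulrBl divfK// mul1r DE /de.
  by rewrite rmorphB rmorph1; ring.
pose u (y : R) := Re (F (x%:C + y%:C * 'i)); pose v (y : R) := Im (F (x%:C + y%:C * 'i)).
pose u1 (y : R) := Re (de (x%:C + y%:C * 'i)); pose v1 (y : R) := Im (de (x%:C + y%:C * 'i)).
pose b (y : R) := u y * u y + v y * v y.
pose a (y : R) := u1 y * u1 y + v1 y * v1 y.
have bE y : b y = normc (F (x +i* y)) ^+ 2 by rewrite /b /u /v wE normc_sqr !expr2.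
have aE y : a y = normc (de (x +i* y)) ^+ 2 by rewrite /a /u1 /v1 wE normc_sqr !expr2.
have b0 y : 0 < y -> 0 < b y.
  move=> y0; rewrite bE exprn_gt0// normc_gt0 Im_gt0_neq0//.
  by have h : 0 < Im (x +i* y) by []; apply: lt_trans (ImF h).
pose p (y : R) := Re ('i / Dn F al s (x +i* y)).
have db y : 0 < y -> rder b y (2 * b y * p y).
  move=> y0; have h : 0 < Im (x%:C + y%:C * 'i) by rewrite wE.
  have hu : rder u y (Re (F' (x%:C + y%:C * 'i) * 'i)) by apply: cder_is_derive_Re; exact: dF.
  have hv : rder v y (Im (F' (x%:C + y%:C * 'i) * 'i)) by apply: cder_is_derive_Im; exact: dF.
  apply: rder_eq (rderD (rderM hu hu) (rderM hv hv)) _.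
  rewrite F'_quot// /b /p /u /v wE.
  have -> : F (x +i* y) / Dn F al s (x +i* y) * 'i = F (x +i* y) * ('i / Dn F al s (x +i* y)) by ring.
  move: ('i / Dn F al s (x +i* y)) => q; rewrite !ReM !ImM; ring.
have da y : 0 < y -> rder a y (2 * (1 - al) * a y * p y).
  move=> y0; have h : 0 < Im (x%:C + y%:C * 'i) by rewrite wE.
  have hu : rder u1 y (Re (de' (x%:C + y%:C * 'i) * 'i)) by apply: cder_is_derive_Re; exact: cde.
  have hv : rder v1 y (Im (de' (x%:C + y%:C * 'i) * 'i)) by apply: cder_is_derive_Im; exact: cde.
  apply: rder_eq (rderD (rderM hu hu) (rderM hv hv)) _.
  rewrite deE// /a /p /u1 /v1 wE.
  have -> : (1 - al)%:C * (de (x +i* y) / Dn F al s (x +i* y)) * 'i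
    = (1 - al)%:C * (de (x +i* y) * ('i / Dn F al s (x +i* y))) by ring.
  move: ('i / Dn F al s (x +i* y)) => q; rewrite !ReZ !ImZ !ReM !ImM; ring.
(* By [da] and [db] the logarithmic derivatives of the two factors are opposite. *)
pose h y := a y * expR (- (1 - al) * ln (b y)).
have dh y : 0 < y -> rder h y 0.
  move=> y0.
  have dln : rder (fun y => ln (b y)) y ((b y)^-1 * (2 * b y * p y)).
    exact: (@is_derive1_comp R (@ln R) b y _ _ (is_derive1_ln (b0 y y0)) (db y y0)).
  have dm : rder (fun y => - (1 - al) * ln (b y)) y (- (1 - al) * (2 * p y)).
    apply: rder_eq (rderM (rder_cst (- (1 - al)) y) dln) _.
    by field; exact: lt0r_neq0 (b0 y y0).
  have de1 : rder (fun y => expR (- (1 - al) * ln (b y))) y (expR (- (1 - al) * ln (b y)) * (- (1 - al) * (2 * p y))).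
    exact: (@is_derive1_comp R expR (fun y => - (1 - al) * ln (b y)) y _ _ (is_derive_expR _) dm).
  by apply: rder_eq (rderM (da y y0) de1) _; ring.
have hc y : 0 < y -> y <= 1 -> h y = h 1.
  move=> y0 y1; apply: rder_cst_seg => // t /andP[t1 _]; apply: dh; exact: lt_le_trans t1.
have h1 : 0 < h 1.
  rewrite mulr_gt0 ?expR_gt0// aE exprn_gt0// normc_gt0 Im_gt0_neq0//.
  have i1 : 0 < Im (x +i* 1) by [].
  by have := ImF i1; rewrite /de !ImB /= => ?; lra.
(* Since [|de| <= 2 |F|], the constant is at most [4 |F|^(2 al)]; once [|F|^2 <= expR B] this is at
   most half of [h 1]. *)
have [B HB] : exists B : R, expR (al * B) <= h 1 / 8.
  exists (ln (h 1 / 8) / al); rewrite mulrC divfK ?lt0r_neq0// lnK// posrE divr_gt0//.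
have eB : 0 < expR (B / 2) by exact: expR_gt0.
have [d d0 Hd] := bF0 x eB.
pose y := Num.min d 1 / 2; have m0 : 0 < Num.min d 1 by rewrite lt_min d0 ltr01.
have y0 : 0 < y by rewrite divr_gt0.
have : y < Num.min d 1 by rewrite /y; lra.
rewrite lt_min => /andP[yd y1].
have := Hd x y; rewrite subrr normr0 y0 yd F00 subr0 => /(_ d0 isT) Fe.
have lnb : ln (b y) <= B.
  rewrite -[B](expRK) ler_ln ?posrE ?expR_gt0 ?b0// bE.
  have -> : expR B = expR (B / 2) ^+ 2 by rewrite -expRM_natl; congr expR; field.
  by rewrite ler_pXn2r ?nnegrE ?normc_ge0// ltW.
have ab : a y <= 4 * b y.
  rewrite aE bE (_ : 4 * _ = (2 * normc (F (x +i* y))) ^+ 2); last by ring.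
  have i1 : 0 < Im (x +i* y) by [].
  have yF : y <= normc (F (x +i* y)).
    by apply: le_trans (normc_ge_Im _); apply: le_trans (ler_norm _); exact: ltW (ImF i1).
  rewrite ler_pXn2r ?nnegrE ?normc_ge0 ?mulr_ge0 ?normc_ge0//.
  apply: le_trans (normc_leB _ _) _.
  have -> : normc (x +i* y - x%:C) = y.
    by rewrite /= subrr expr0n /= add0r subr0 sqrtr_sqr gtr0_norm.
  lra.
have := hc y y0 (ltW y1); rewrite /h -/(h 1) => hy.
have E0 := expR_gt0 (- (1 - al) * ln (b y)).
have : a y * expR (- (1 - al) * ln (b y)) <= 4 * expR (al * ln (b y)).
  have -> : expR (al * ln (b y)) = b y * expR (- (1 - al) * ln (b y)).
    rewrite -{2}(lnK (b0 y y0 : b y \is Num.pos)) -expRD; congr expR; ring.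
  by rewrite mulrA ler_wpM2r// ltW.
have : expR (al * ln (b y)) <= expR (al * B) by rewrite ler_expR ler_wpM2l// ltW.
by rewrite hy; lra.
Qed.

Lemma F0_neq0 x : F0 x != 0.
Proof.
apply/eqP => F00; have [D0|D0] := eqVneq (Dn0 x) 0; first exact: F0_neq0_singular D0.
exact: F0_neq0_regular F00 D0.
Qed.

End BoundaryFunction.

(** * Stieltjes inversion *)

Section Poisson.
Variables (R : realType) (nu : borel_probability R).
Local Notation G := (cauchy_transform nu).
Local Notation leb := (@lebesgue_measure R).
Local Notation T := (measurableTypeR R).

(** The Poisson kernel of the upper half plane, that is, [- Im (ck w t) / pi] at [w = x + 'i y]. *)
Definition pk (y x t : R) : R := y / ((x - t) ^+ 2 + y ^+ 2) / pi.

Lemma pk_den (y x t : R) : 0 < y -> 0 < (x - t) ^+ 2 + y ^+ 2.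
Proof. by move=> y0; rewrite ltr_wpDl ?sqr_ge0// exprn_gt0. Qed.

Lemma pk_ge0 (y x t : R) : 0 < y -> 0 <= pk y x t.
Proof.
move=> y0; apply: divr_ge0; last exact: pi_ge0.
by apply: divr_ge0; [exact: ltW|exact: ltW (pk_den x t y0)].
Qed.

Lemma pk_ck (y x t : R) : 0 < y -> pk y x t = - Im (ck (x +i* y) t) / pi.
Proof.
move=> y0; rewrite Im_ck// -[- (- _ * _)]mulNr opprK /ck mul1r normcV exprVn normc_sqr ReB ImB/=.
by rewrite subr0.
Qed.

Lemma pk_G (y x : R) : 0 < y -> Rintegral nu setT (pk y x) = - Im (G (x +i* y)) / pi.
Proof.
move=> y0; have h : 0 < Im (x +i* y) by [].
have [_ bi] := cbm_ck h.
have -> : pk y x = fun t => (- pi^-1) * Im (ck (x +i* y) t).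
  by apply/funext => t; rewrite pk_ck//; ring.
rewrite RintegralZl//; last exact: bmeas_integrable.
by rewrite mulNr mulrC -mulNr.
Qed.

Lemma bmeas_pk (y x : R) : 0 < y -> bmeas (pk y x : T -> R).
Proof.
move=> y0; have h : 0 < Im (x +i* y) by [].
have [_ bi] := cbm_ck h.
rewrite (_ : pk y x = fun t => - Im (ck (x +i* y) t) / pi); last by apply/funext => t; exact: pk_ck.
by apply: bmeasM; [exact: bmeasN|exact: bmeas_cst].
Qed.

(** The mass given to [[a, b]] by the Poisson kernel of height [y] centred at [t]. *)
Definition poisson_cdf (y a b t : R) : R := (atan ((b - t) / y) - atan ((a - t) / y)) / pi.

Lemma poisson_integral (y a b t : R) : 0 < y -> a < b ->
  (\int[leb]_(x in `[a, b]) (pk y x t)%:E = (poisson_cdf y a b t)%:E)%E.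
Proof.
move=> y0 ab; pose A x := atan ((x - t) / y) / pi.
have yn := lt0r_neq0 y0.
have dA x : rder A x (pk y x t).
  have h : rder (fun x => (x - t) / y) x (y^-1).
    by apply: rder_eq (rderM (rderB (rder_id x) (rder_cst t x)) (rder_cst y^-1 x)) _; rewrite mulr0 addr0 subr0 mul1r.
  apply: rder_eq (rderM (@is_derive1_comp R (@atan R) _ x _ _ (is_derive1_atan _) h) (rder_cst pi^-1 x)) _.
  rewrite mulr0 addr0 /pk; have d0 := lt0r_neq0 (pk_den x t y0).
  rewrite -invfM; congr (_ / pi).
  have -> : (1 + ((x - t) / y) ^+ 2) * y = ((x - t) ^+ 2 + y ^+ 2) / y by field.
  by rewrite invf_div.
rewrite (@continuous_FTC2 R (fun x => pk y x t) A a b ab).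
- by rewrite -EFinB /A /poisson_cdf; congr EFin; ring.
- apply: continuous_in_subspaceT => x _.
  have dd := rder_id x; have dxt := rderB dd (rder_cst t x).
  have dq := @rder_quot R (fun=> y) (fun x => (x - t) ^+ 2 + y ^+ 2) x 0 _
    (lt0r_neq0 (pk_den x t y0)) (rder_cst y x) (rderD (rderM dxt dxt) (rder_cst (y ^+ 2) x)).
  exact: rder_continuous (rderM dq (rder_cst pi^-1 x)).
- split.
  + by move=> x _; case: (dA x).
  + by apply: cvg_at_right_filter; exact: rder_continuous (dA a).
  + by apply: cvg_at_left_filter; exact: rder_continuous (dA b).
- move=> x _; rewrite derive1E; by case: (dA x).
Qed.

Lemma poisson_fubini (y a b : R) : 0 < y -> a < b ->
  (\int[leb]_(x in `[a, b]) (- Im (G (x +i* y)) / pi)%:E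
   = \int[nu]_(t in setT) (poisson_cdf y a b t)%:E)%E.
Proof.
move=> y0 ab.
pose D : set R := `[a, b]%classic.
(* The restriction to [[a, b]] is moved into the integrand, so that Tonelli's theorem is applied on
   the whole product space. *)
pose g (p : R * T) : \bar R := (pk y p.1 p.2 * \1_D p.1)%:E.
have mD : measurable D by exact: measurable_itv.
have g0 p : (0 <= g p)%E by rewrite lee_fin mulr_ge0 ?pk_ge0.
have mg : measurable_fun setT g.
  apply/measurable_EFinP; apply: measurable_funM; last first.
    have h : measurable_fun [set: R] (\1_D : R -> R) by exact: measurable_indic.
    exact: (measurableT_comp h measurable_fst).
  have mc : measurable_fun setT (fun u : R => y / (u ^+ 2 + y ^+ 2) / pi).
    apply: continuous_measurable_fun => u.
    have d0 : 0 < u ^+ 2 + y ^+ 2 by rewrite ltr_wpDl ?sqr_ge0// exprn_gt0.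
    have dq := @rder_quot R (fun=> y) (fun u => u ^+ 2 + y ^+ 2) u 0 _
      (lt0r_neq0 d0) (rder_cst y u) (rderD (rderM (rder_id u) (rder_id u)) (rder_cst (y ^+ 2) u)).
    exact: rder_continuous (rderM dq (rder_cst pi^-1 u)).
  have mD2 : measurable_fun [set: R * T] (fun p : R * T => p.1 - p.2).
    by apply: measurable_funB; [exact: measurable_fst|exact: measurable_snd].
  exact: (measurableT_comp mc mD2).
have := @fubini_tonelli _ _ _ _ R leb nu g mg g0.
rewrite /fubini_F /fubini_G /=.
have -> : (\int[leb]_x \int[nu]_t g (x, t) = \int[leb]_(x in D) (- Im (G (x +i* y)) / pi)%:E)%E.
  rewrite [RHS]integral_mkcond; apply: eq_integral => x _.
  rewrite patchE /g/= indicE; case: ifPn => xD; last first.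
    by under eq_integral do rewrite mulr0; rewrite integral0.
  under eq_integral do rewrite mulr1.
  rewrite -pk_G// /Rintegral fineK//.
  by apply: integrable_fin_num => //; apply: bmeas_integrable; exact: bmeas_pk.
move=> ->; apply: eq_integral => t _.
rewrite -poisson_integral// [RHS]integral_mkcond; apply: eq_integral => x _.
by rewrite patchE /g/= indicE; case: ifPn => _; rewrite ?mulr1 ?mulr0.
Qed.

End Poisson.

(** * The limit of Poisson integrals at the real line *)

Section Stieltjes.
Variables (R : realType) (nu : borel_probability R) (f : R -> R).
Local Notation G := (cauchy_transform nu).
Local Notation leb := (@lebesgue_measure R).
Local Notation T := (measurableTypeR R).
Hypothesis f_ge0 : forall x, 0 <= f x.
Hypothesis f_cont : continuous f.
Hypothesis G_cvg : forall x,
  (fun n => - Im (G (x +i* n.+1%:R^-1)) / pi) @ \oo --> f x.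
Hypothesis G_bound : forall X : R, exists (B : R) (N : nat), forall x n,
  `|x| <= X -> (N <= n)%N -> `|- Im (G (x +i* n.+1%:R^-1)) / pi| <= B.

Lemma atan_scale_cvg (u : R) : (fun n => atan (u / n.+1%:R^-1)) @ \oo --> Num.sg u * (pi / 2).
Proof.
have pos (v : R) : 0 < v -> (fun n => atan (v / n.+1%:R^-1)) @ \oo --> pi / 2.
  move=> v0; apply: (@cvg_comp _ _ _ (fun n => v / n.+1%:R^-1) atan \oo (+oo%R)); last exact: cvgy_atan.
  apply/cvgryPge => A; near=> n; rewrite invrK -ler_pdivrMl//.
  apply: le_trans (ltW (truncnS_gt _)) _; rewrite ler_nat ltnS.
  by near: n; exact: nbhs_infty_ge.
have [u0|u0|<-] := ltgtP 0 u.
- by rewrite gtr0_sg// mul1r; exact: pos.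
- rewrite ltr0_sg// mulN1r.
  have -> : (fun n => atan (u / n.+1%:R^-1)) = (fun n => - atan (- u / n.+1%:R^-1)).
    by apply/funext => n; rewrite mulNr atanN opprK.
  by apply: cvgN; apply: pos; rewrite oppr_gt0.
rewrite sgr0 mul0r (_ : (fun _ => _) = cst 0); first exact: cvg_cst.
by apply/funext => n; rewrite mul0r atan0.
Unshelve. all: by end_near. Qed.

(** For [a < b], the indicator of [[a, b]] with the value 1/2 at both ends: the pointwise limit of
    [poisson_cdf]. *)
Definition midpoint_indic (a b t : R) : R := (Num.sg (b - t) - Num.sg (a - t)) / 2.

Lemma poisson_cdf_cvg (a b t : R) :
  (fun n => poisson_cdf n.+1%:R^-1 a b t) @ \oo --> midpoint_indic a b t.
Proof.
have pn : pi != 0 :> R by rewrite lt0r_neq0// pi_gt0.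
have -> : midpoint_indic a b t = (Num.sg (b - t) * (pi / 2) - Num.sg (a - t) * (pi / 2)) / pi.
  by rewrite /midpoint_indic; move: pn; generalize (pi : R) => p p0; field.
have h : (fun n => atan ((b - t) / n.+1%:R^-1) - atan ((a - t) / n.+1%:R^-1)) @ \oo -->
    Num.sg (b - t) * (pi / 2) - Num.sg (a - t) * (pi / 2).
  by apply: cvgB; exact: atan_scale_cvg.
exact: (cvgM h (cvg_cst pi^-1)).
Qed.

Lemma normr_poisson_cdf_le (y a b t : R) : `|poisson_cdf y a b t| <= 1.
Proof.
have p0 : 0 < pi :> R := pi_gt0 R.
rewrite /poisson_cdf normrM normfV (gtr0_norm p0) ler_pdivrMr// mul1r ler_norml.
have := atan_gtNpi2 ((b - t) / y); have := atan_ltpi2 ((b - t) / y).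
have := atan_gtNpi2 ((a - t) / y); have := atan_ltpi2 ((a - t) / y).
lra.
Qed.

Lemma measurable_poisson_cdf (y a b : R) : 0 < y ->
  measurable_fun setT (poisson_cdf y a b : T -> R).
Proof.
move=> y0; apply: continuous_measurable_fun => t.
have d (c : R) : rder (fun t => atan ((c - t) / y)) t ((1 + ((c - t) / y) ^+ 2)^-1 * (- y^-1)).
  have h : rder (fun t => (c - t) / y) t (- y^-1).
    by apply: rder_eq (rderM (rderB (rder_cst c t) (rder_id t)) (rder_cst y^-1 t)) _; rewrite mulr0 addr0 sub0r mulN1r.
  exact: (@is_derive1_comp R (@atan R) _ t _ _ (is_derive1_atan _) h).
exact: rder_continuous (rderM (rderB (d b) (d a)) (rder_cst pi^-1 t)).
Qed.

Lemma cauchy_line_continuous (y : R) : 0 < y -> continuous (fun x : R => - Im (G (x +i* y)) / pi).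
Proof.
move=> y0 x.
have E (t : R) : (0 +i* y) + t%:C * 1 = t +i* y by apply: complexP; rewrite mulr1 ?ReD ?ImD/= ?add0r ?addr0.
have h : 0 < Im (x +i* y) by exact: y0.
have := @cder_is_derive_Im R G (0 +i* y) 1 x (- Gn nu 2 (x +i* y)); rewrite E.
under eq_fun do rewrite E.
move=> /(_ (cder_G nu h)) d.
rewrite (_ : (fun _ => _) = (fun t : R => (0 - Im (G (t +i* y))) * pi^-1)); last first.
  by apply/funext => t; rewrite sub0r.
rewrite -[- Im (G (x +i* y))]sub0r; exact: rder_continuous (rderM (rderB (rder_cst 0 x) d) (rder_cst pi^-1 x)).
Qed.

(** Dominated convergence on both sides of [poisson_fubini]: the Lebesgue side is dominated through
    [G_bound], the [nu] side by the constant 1. *)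
Lemma stieltjes_interval (a b : R) : a < b ->
  (\int[nu]_(t in setT) (midpoint_indic a b t)%:E = \int[leb]_(x in `[a, b]) (f x)%:E)%E.
Proof.
move=> ab; have [B [N HB]] := G_bound (`|a| + `|b|).
(* Shifted by [N], since the bound is only given from [N] on. *)
pose y n : R := (n + N).+1%:R^-1.
have y0 n : 0 < y n by rewrite invr_gt0.
have mab : measurable (`[a, b]%classic : set R) by exact: measurable_itv.
have L1 : (\int[nu]_(t in setT) (poisson_cdf (y n) a b t)%:E @[n --> \oo] -->
    \int[nu]_(t in setT) (midpoint_indic a b t)%:E)%E.
  apply: (@dominated_cvg _ _ _ nu setT measurableT _ _ (fun=> EFin (1 : R))).
  - by move=> n; apply/measurable_EFinP; exact: measurable_poisson_cdf.
  - move=> t _; apply/cvg_EFin; first by near=> n.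
    by have := @poisson_cdf_cvg a b t; rewrite -(cvg_shiftn N).
  - by [].
  - exact: (bmeas_integrable nu (bmeas_cst (1 : R))).
  - by move=> n t _; rewrite /= lee_fin normr_poisson_cdf_le.
have L2 : (\int[leb]_(x in `[a, b]) (- Im (G (x +i* y n)) / pi)%:E @[n --> \oo] -->
    \int[leb]_(x in `[a, b]) (f x)%:E)%E.
  apply: (@dominated_cvg _ _ _ leb `[a, b]%classic mab _ _ (fun=> EFin B)).
  - move=> n; apply/measurable_EFinP; apply: measurable_funTS.
    exact: continuous_measurable_fun (cauchy_line_continuous (y0 n)).
  - move=> x _; apply/cvg_EFin; first by near=> n.
    by have := @G_cvg x; rewrite -(cvg_shiftn N).
  - by [].
  - apply: continuous_compact_integrable; first exact: segment_compact.
    by apply: continuous_subspaceT => x; exact: cst_continuous.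
  - move=> n x; rewrite /= in_itv/= => /andP[ax xb]; rewrite lee_fin; apply: HB; last exact: leq_addl.
    have := ler_norm a; have := ler_norm b; have := ler_norm (- a); have := ler_norm (- b).
    by rewrite !normrN ler_norml; lra.
have E : (fun n => \int[leb]_(x in `[a, b]) (- Im (G (x +i* y n)) / pi)%:E)%E =
  (fun n => \int[nu]_(t in setT) (poisson_cdf (y n) a b t)%:E)%E.
  by apply/funext => n; exact: poisson_fubini.
rewrite E in L2.
by apply: (cvg_unique _ L1 L2).
Unshelve. all: by end_near. Qed.

End Stieltjes.

(** * From intervals to Borel sets *)

Section StieltjesDensity.
Variables (R : realType) (nu : borel_probability R) (f : R -> R).
Local Notation leb := (@lebesgue_measure R).
Local Notation T := (measurableTypeR R).
Hypothesis f_ge0 : forall x, 0 <= f x.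
Hypothesis f_cont : continuous f.
Hypothesis inversion : forall a b, a < b ->
  (\int[nu]_(t in setT) (midpoint_indic a b t)%:E = \int[leb]_(x in `[a, b]) (f x)%:E)%E.

Lemma midpoint_indic_ge0 (a b t : R) : a < b -> 0 <= midpoint_indic a b t.
Proof.
by move=> ab; rewrite /midpoint_indic; case: (sgrP (a - t)) => h1; case: (sgrP (b - t)) => h2; lra.
Qed.

Lemma midpoint_indic_in (a b t : R) : a < t < b -> midpoint_indic a b t = 1.
Proof.
by move=> /andP[a_t t_b]; rewrite /midpoint_indic gtr0_sg ?subr_gt0// ltr0_sg ?subr_lt0//; lra.
Qed.

Lemma midpoint_indic_le1 (a b t : R) : midpoint_indic a b t <= 1.
Proof.
rewrite /midpoint_indic; by case: (sgrP (a - t)) => h1; case: (sgrP (b - t)) => h2; lra.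
Qed.

Lemma midpoint_indic_out (a b t : R) : a < b -> ~~ (a <= t <= b) -> midpoint_indic a b t = 0.
Proof.
move=> ab; rewrite negb_and -!ltNge => /orP[ta|bt]; rewrite /midpoint_indic.
  by rewrite !gtr0_sg ?subr_gt0//; lra.
by rewrite !ltr0_sg ?subr_lt0//; lra.
Qed.

Lemma measurable_midpoint_indic (a b : R) : measurable_fun setT (midpoint_indic a b : T -> R).
Proof.
apply: (@measurable_fun_cvg _ _ _ setT (fun n t => poisson_cdf n.+1%:R^-1 a b t)) => [n|t _].
  exact: measurable_poisson_cdf.
exact: poisson_cdf_cvg.
Qed.

Lemma measurable_density : measurable_fun setT (f : T -> T).
Proof. exact: continuous_measurable_fun. Qed.

(** The midpoint indicator lies between the indicators of the open and of the closed interval. *)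
Lemma measure_open_itv_le (a b : R) : a < b ->
  (nu `]a, b[%classic <= \int[leb]_(x in `[a, b]) (f x)%:E)%E.
Proof.
move=> ab; rewrite -inversion// -[X in (nu X <= _)%E]setIT -integral_indic//.
apply: ge0_le_integral => //.
- by apply/measurable_EFinP; apply: measurable_indic; exact: measurable_itv.
- by apply/measurable_EFinP; exact: measurable_midpoint_indic.
move=> t _; rewrite lee_fin indicE; case: (boolP (t \in _)) => /=; last by rewrite midpoint_indic_ge0.
rewrite inE/= in_itv/= => h; by rewrite midpoint_indic_in.
Qed.

Lemma measure_closed_itv_ge (a b : R) : a < b ->
  (\int[leb]_(x in `[a, b]) (f x)%:E <= nu `[a, b]%classic)%E.
Proof.
move=> ab; rewrite -inversion// -[X in (_ <= nu X)%E]setIT -integral_indic//.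
apply: ge0_le_integral => //.
- by move=> t _; rewrite lee_fin midpoint_indic_ge0.
- by apply/measurable_EFinP; exact: measurable_midpoint_indic.
- by apply/measurable_EFinP; apply: measurable_indic; exact: measurable_itv.
move=> t _; rewrite lee_fin indicE; case: (boolP (t \in _)) => /=; first by rewrite midpoint_indic_le1.
by rewrite notin_setE/= in_itv/= => /negP h; rewrite midpoint_indic_out.
Qed.

(** [f] is bounded near [c], so short open intervals around [c] have small mass. This removes the
    ambiguity at the ends of intervals. *)
Lemma measure_singleton (c : R) : nu [set c] = 0%E.
Proof.
have [m _ fm] : exists2 m, m \in `[c - 1, c + 1]%R & forall t, t \in `[c - 1, c + 1]%R -> f t <= f m.
  by apply: EVT_max; [lra|exact: continuous_subspaceT].
apply/eqP; rewrite eq_le measure_ge0 andbT; apply/lee_addgt0Pr => e e0; rewrite add0e.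
pose d := Num.min 1 (e / (2 * (f m + 1))).
have fm1 : 0 < f m + 1 by have := f_ge0 m; lra.
have d0 : 0 < d by rewrite lt_min ltr01 divr_gt0// mulr_gt0.
have d1 : d <= 1 by rewrite ge_min lexx.
have de : 2 * d * (f m + 1) <= e.
  have : d <= e / (2 * (f m + 1)) by rewrite ge_min lexx orbT.
  by rewrite ler_pdivlMr ?mulr_gt0//; lra.
clearbody d.
apply: (@le_trans _ _ (nu `]c - d, c + d[%classic)).
  by apply: le_measure; rewrite ?inE// => _ ->; rewrite /= in_itv/=; lra.
have cd : c - d < c + d by lra.
apply: (le_trans (measure_open_itv_le cd)).
apply: (@le_trans _ _ (\int[leb]_(x in `[(c - d)%R, (c + d)%R]) (f m)%:E)%E).
  apply: ge0_le_integral => //=.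
  - by move=> x _; rewrite lee_fin.
  - by apply/measurable_EFinP; apply: measurable_funTS; exact: measurable_density.
  - move=> x; rewrite in_itv/= => /andP[h1 h2]; rewrite lee_fin; apply: fm; rewrite in_itv/=; lra.
rewrite integral_cst//.
have E : leb `[c - d, c + d]%classic = (c + d - (c - d))%:E by rewrite lebesgue_measure_itv/= lte_fin cd EFinB.
rewrite [X in (_ * X)%E](_ : _ = leb `[c - d, c + d]%classic)// E.
rewrite -EFinM lee_fin.
by have := f_ge0 m; nra.
Qed.

Lemma measure_ocitv (a b : R) : nu `]a, b]%classic = (\int[leb]_(x in `]a, b]) (f x)%:E)%E.
Proof.
have [ab|ba] := ltP a b; last first.
  by rewrite set_itv_ge ?measure0 ?integral_set0// -leNgt bnd_simp.
have mi i : measurable ([set` i : interval R] : set T) by exact: measurable_itv.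
have E1 : nu `[a, b]%classic = nu `]a, b]%classic.
  by rewrite -(@setU1itv _ _ _ a false) ?bnd_simp ?ltW// setUC measureU0//; exact: measure_singleton.
have E2 : nu `]a, b]%classic = nu `]a, b[%classic.
  by rewrite -(@setUitv1 _ _ _ b true) ?bnd_simp// measureU0//; exact: measure_singleton.
rewrite integral_itv_obnd_cbnd; last first.
  by apply/measurable_EFinP; apply: measurable_funTS; exact: measurable_density.
apply/eqP; rewrite eq_le -{2}E1 measure_closed_itv_ge// E2 measure_open_itv_le//.
Qed.

Definition density_measure (S : set T) : \bar R := (\int[leb]_(x in S) (f x)%:E)%E.

Let density_measure0 : density_measure set0 = 0%E.
Proof. exact: integral_set0. Qed.

Let density_measure_ge0 S : (0 <= density_measure S)%E.
Proof. by apply: integral_ge0 => x _; rewrite lee_fin. Qed.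

Let density_measure_sigma_additive : semi_sigma_additive density_measure.
Proof.
move=> A mA tA mUA.
rewrite /density_measure ge0_integral_bigcup//=.
- by apply: is_cvg_ereal_nneg_natsum_cond => n _ _; exact: density_measure_ge0.
- by apply/measurable_EFinP; apply: measurable_funTS; exact: measurable_density.
- by move=> x _; rewrite lee_fin.
Qed.

HB.instance Definition _ := isMeasure.Build _ T R density_measure
  density_measure0 density_measure_ge0 density_measure_sigma_additive.

(** Half-open intervals generate the Borel sets and are stable under intersection; both measures
    agree on them, and the intervals []-k, k]] exhaust the line with finite mass. *)
Lemma is_density_of_inversion : is_density nu f.
Proof.
split; [exact: measurable_density|exact: f_ge0|move=> S mS].
apply: (@measure_unique _ R T (@ocitv R) (fun k => `]- k%:R, k%:R]%classic) _ _ _ _ nu density_measure) => //.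
- exact: ocitvI.
- by move=> i; exists (- i%:R, i%:R).
- rewrite -subTset => x _; exists (Num.truncn `|x|).+1 => //=; rewrite in_itv/=.
  by have := Num.Theory.truncnS_gt `|x|; have := ler_norm x; have := ler_norm (- x); rewrite normrN; lra.
- by move=> _ [[a b] _ <-]; exact: measure_ocitv.
- by move=> k; rewrite (le_lt_trans (probability_le1 _ _)) ?ltry//; exact: measurable_itv.
Qed.

End StieltjesDensity.

Lemma continuous_of_eps (R : realType) (g : R -> R) :
  (forall x e, 0 < e -> exists2 d : R, 0 < d & forall x', `|x' - x| < d -> `|g x' - g x| <= e) ->
  continuous g.
Proof.
move=> H x; apply/cvgrPdist_le => /= e e0; have [d d0 Hd] := H x e e0.
near=> x'; rewrite distrC; apply: Hd; rewrite distrC.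
by near: x'; exists d.
Unshelve. all: by end_near. Qed.

(** * The density read off the boundary values *)

Section BoundaryDensity.
Variables (R : realType) (nu : borel_probability R) (al s : R) (F0 : R -> R[i]).
Local Notation F := (reciprocal_cauchy_transform nu).
Local Notation G := (cauchy_transform nu).
Hypothesis al0 : 0 < al.
Hypothesis npm : ~ point_mass nu.
Hypothesis ode : forall w, 0 < Im w -> Dn F al s w * dF nu w = F w.
Hypothesis bF0 : forall x (e : R), 0 < e ->
  exists2 d : R, 0 < d & forall x' y' : R, `|x' - x| < d -> 0 < y' < d ->
    normc (F (x' +i* y') - F0 x) <= e.

Let dFnu w : 0 < Im w -> cder F w (dF nu w). Proof. exact: cder_F. Qed.
Let ImF w : 0 < Im w -> Im w < Im (F w). Proof. exact: Im_F_gt. Qed.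
Let ImFle w : 0 < Im w -> Im w <= Im (F w). Proof. exact: Im_F_ge. Qed.
Let F0n x : F0 x != 0. Proof. exact: (F0_neq0 al0 dFnu ImF ode bF0). Qed.
Let F0c := F0_continuous bF0.

Definition boundary_density x : R := Im (F0 x) / normc (F0 x) ^+ 2 / pi.

Lemma continuous_Re_F0 : continuous (fun x => Re (F0 x)).
Proof.
apply: continuous_of_eps => x e e0; have [d d0 H] := F0c x e0; exists d => // x' xx.
by rewrite -ReB (le_trans (normc_ge_Re _))// H.
Qed.

Lemma continuous_Im_F0 : continuous (fun x => Im (F0 x)).
Proof.
apply: continuous_of_eps => x e e0; have [d d0 H] := F0c x e0; exists d => // x' xx.
by rewrite -ImB (le_trans (normc_ge_Im _))// H.
Qed.

Let sqr_neq0 x : Re (F0 x) ^+ 2 + Im (F0 x) ^+ 2 != 0.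
Proof. by rewrite -normc_sqr sqrf_eq0 normc_eq0. Qed.

Lemma continuous_normc_F0_sqr : continuous (fun x => normc (F0 x) ^+ 2).
Proof.
rewrite (_ : (fun _ => _) = (fun x => Re (F0 x) ^+ 2 + Im (F0 x) ^+ 2)); last first.
  by apply/funext => x; rewrite normc_sqr.
move=> x; apply: cvgD; apply: (cvgM (f := fun x => _ (F0 x)) (g := fun x => _ (F0 x))).
all: first [exact: continuous_Re_F0|exact: continuous_Im_F0].
Qed.

Lemma continuous_boundary_density : continuous boundary_density.
Proof.
move=> x; apply: cvgM; last exact: cvg_cst.
apply: cvgM; first exact: continuous_Im_F0.
apply: cvgV; last exact: continuous_normc_F0_sqr.
by rewrite sqrf_eq0 normc_eq0.
Qed.

Lemma boundary_density_ge0 x : 0 <= boundary_density x.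
Proof.
by rewrite /boundary_density !divr_ge0 ?sqr_ge0 ?pi_ge0//; exact: (Im_F0_ge0 ImF bF0).
Qed.

Lemma boundary_density_cvg x :
  (fun n => - Im (G (x +i* n.+1%:R^-1)) / pi) @ \oo --> boundary_density x.
Proof.
have E n : - Im (G (x +i* n.+1%:R^-1)) = Im (F (x +i* n.+1%:R^-1)) /
    (Re (F (x +i* n.+1%:R^-1)) ^+ 2 + Im (F (x +i* n.+1%:R^-1)) ^+ 2).
  by rewrite -normc_sqr -[G _]invrK -F_E Im_inv mulNr opprK.
under eq_fun do rewrite E.
have cR := @Re_F_cvg _ _ _ bF0 x; have cI := @Im_F_cvg _ _ _ bF0 x.
rewrite /boundary_density normc_sqr.
apply: cvgM; last exact: cvg_cst.
apply: cvgM; first exact: cI.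
apply: cvgV; first exact: sqr_neq0.
by apply: cvgD; [exact: (cvgM cR cR)|exact: (cvgM cI cI)].
Qed.

(** [F0] is continuous without zeros, hence bounded away from 0 on [[-X, X]]; the Hoelder estimate
    transports this to a strip of uniform height. *)
Lemma normc_F_lower_bound (X : R) : exists m d : R, [/\ 0 < m, 0 < d &
  forall x y : R, `|x| <= X -> 0 < y < d -> m <= normc (F (x +i* y))].
Proof.
have [X0|X0] := ltP X 0.
  by exists 1, 1; split => // x y xX; have := normr_ge0 x; lra.
have [c cX Hc] : exists2 c, c \in `[- X, X]%R & forall t, t \in `[- X, X]%R ->
    normc (F0 c) ^+ 2 <= normc (F0 t) ^+ 2.
  apply: EVT_min; first lra.
  by apply: continuous_subspaceT; exact: continuous_normc_F0_sqr.
pose m := normc (F0 c); have m0 : 0 < m by rewrite normc_gt0.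
have [C C0 HC] := F_holder al0 dFnu ImFle ode X.
have m4 : 0 < m / 4 by rewrite divr_gt0.
pose d := Num.min 1 ((m / 4) ^+ 2 / (C + 1)).
have C1 : 0 < C + 1 by lra.
have d0 : 0 < d by rewrite lt_min ltr01 divr_gt0// exprn_gt0.
have d1 : d <= 1 by rewrite ge_min lexx.
have dC : (C + 1) * d <= (m / 4) ^+ 2.
  by rewrite mulrC -ler_pdivlMr// ge_min lexx orbT.
clearbody d.
exists (m / 2), d; split => //; first by rewrite divr_gt0.
move=> x y xX /andP[y0 yd].
have [d' d'0 Hd'] := bF0 x m4.
(* [F0 x] is only a limit: it is compared with [F] at a height [y'] below [y], and the Hoelder bound
   leads from [y'] to [y]. *)
pose y' := Num.min y d' / 2; have my0 : 0 < Num.min y d' by rewrite lt_min y0.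
have y'0 : 0 < y' by rewrite divr_gt0.
have : y' < Num.min y d' by rewrite /y'; lra.
rewrite lt_min => /andP[y'y y'd]; clearbody y'.
have h1 : normc (F (x +i* y') - F0 x) <= m / 4.
  by apply: Hd'; rewrite ?subrr ?normr0// y'0.
have h2 : normc (F (x +i* y') - F (x +i* y)) <= m / 4.
  apply: ger0_ler_sqr; first exact: ltW.
  apply: le_trans (HC (x +i* y) (x +i* y') _ _) _.
  - by rewrite /box/=; split => //; lra.
  - by rewrite /box/=; split => //; lra.
  apply: le_trans dC; apply: (@le_trans _ _ (C * d)); last by rewrite ler_wpM2r ?ltW//; lra.
  apply: ler_wpM2l => //; apply: le_trans (normc_le_ReIm _) _.
  by rewrite ReB ImB/= subrr normr0 add0r ler_norml; lra.
have h3 : m <= normc (F0 x).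
  apply: ger0_ler_sqr; first exact: normc_ge0.
  by apply: Hc; rewrite in_itv/= -ler_norml.
have := normc_geB (F0 x) (F0 x - F (x +i* y)); rewrite subKr.
have := normc_triangle (F (x +i* y')) (F0 x) (F (x +i* y)); rewrite (normcB (F0 x) (F (x +i* y'))).
lra.
Qed.

Lemma boundary_density_bound (X : R) : exists (B : R) (N : nat), forall x n,
  `|x| <= X -> (N <= n)%N -> `|- Im (G (x +i* n.+1%:R^-1)) / pi| <= B.
Proof.
have [m [d [m0 d0 H]]] := normc_F_lower_bound X.
have : (fun n => n.+1%:R^-1) @ \oo --> (0 : R) by exact: cvg_harmonic.
move=> /cvgrPdist_lt /(_ d d0) [N _ HN].
exists (m^-1 / pi), N => x n xX Nn.
have n0 : 0 < n.+1%:R^-1 :> R by rewrite invr_gt0.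
have nd : n.+1%:R^-1 < d by have := HN n Nn; rewrite /= sub0r normrN gtr0_norm.
have h := H x n.+1%:R^-1 xX; rewrite n0 nd in h; have {}h := h isT.
rewrite normrM normfV (gtr0_norm (pi_gt0 R)) normrN ler_wpM2r ?invr_ge0 ?pi_ge0//.
apply: le_trans (normc_ge_Im _) _.
have Gp : 0 < normc (G (x +i* n.+1%:R^-1)) by rewrite normc_gt0 G_neq0.
by move: h; rewrite F_E normcV => h; rewrite -lef_pV2 ?posrE ?invr_gt0// invrK.
Qed.

Lemma is_density_boundary : is_density nu boundary_density.
Proof.
apply: is_density_of_inversion boundary_density_ge0 continuous_boundary_density _.
exact: stieltjes_interval boundary_density_cvg boundary_density_bound.
Qed.

End BoundaryDensity.

(** * Critical points of the density *)

Section DerivativeSign.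
Variable R : realType.
Implicit Types (f : R -> R) (x d : R).

Lemma rder_gt0_near f x d : rder f x d -> 0 < d -> exists2 e : R, 0 < e &
  forall y, `|y - x| < e -> (x < y -> f x < f y) /\ (y < x -> f y < f x).
Proof.
move=> [df fd] d0.
have C : h^-1 *: ((f \o shift x) (h *: (1 : R)) - f x) @[h --> (0:R)^'] --> d.
  by rewrite -fd; exact: df.
have [e /= e0 He] := cvgr_gt d C 0 d0; exists e => // y yx.
have pos : y != x -> 0 < (y - x)^-1 * (f y - f x).
  move=> yx0; have := He (y - x); rewrite /= sub0r normrN subr_eq0 => /(_ yx yx0).
  by rewrite /GRing.scale/= mulr1 subrK.
split => xy.
  by have := pos (negbT (gt_eqF xy)); rewrite pmulr_rgt0 ?subr_gt0 ?invr_gt0 ?subr_gt0.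
by have := pos (negbT (lt_eqF xy)); rewrite nmulr_rgt0 ?subr_lt0 ?invr_lt0 ?subr_lt0.
Qed.

Lemma rderN f x d : rder f x d -> rder (fun t => - f t) x (- d).
Proof. by move=> df; exact: is_deriveN. Qed.

Lemma rder_opp_arg f x d : rder f (- x) d -> rder (fun t => f (- t)) x (- d).
Proof.
move=> df; have h : rder (fun t => - t) x (- 1) by exact: is_deriveN.
by apply: rder_eq (@is_derive1_comp R f (fun t => - t) x _ _ df h) _; rewrite mulrN1.
Qed.

(** Fermat's rule; a negative derivative is reduced to a positive one by the reflection of the
    argument. *)
Lemma local_max_rder f x d : rder f x d -> local_max f x -> d = 0.
Proof.
move=> df [e /= e0 He].
have H (g : R -> R) z b : rder g z b -> (forall y, `|z - y| < e -> g y <= g z) -> ~ 0 < b.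
  move=> dg Hg b0; have [r r0 Hr] := rder_gt0_near dg b0.
  pose m := Num.min e r / 2; have m0 : 0 < Num.min e r by rewrite lt_min e0.
  have : m < Num.min e r by rewrite /m; lra.
  have {}m0 : 0 < m by rewrite divr_gt0.
  rewrite lt_min => /andP[me mr]; clearbody m.
  have := Hg (z + m); rewrite opprD addNKr normrN gtr0_norm// => /(_ me).
  have zm : `|z + m - z| < r by rewrite addrC addKr gtr0_norm.
  have [+ _] := Hr (z + m) zm.
  by rewrite ltrDl => /(_ m0); lra.
have [d0|d0|//] := ltgtP d 0; exfalso; last exact: (H f x d).
apply: (H (fun t => f (- t)) (- x) (- d)); last by rewrite oppr_gt0.
- by apply: rder_opp_arg; rewrite opprK.
- by move=> y xy; rewrite opprK; apply: He; rewrite /= opprK -normrN opprD.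
Qed.

End DerivativeSign.

(** * The real system satisfied by the boundary values *)

Section Profile.
Variable R : realType.
Implicit Types (al s : R) (u v : R -> R).

(* [prof_a + i al v] is the boundary value of [Dn] and [prof_D] its squared
   modulus; [prof_f / pi] is the density, whose derivative has the sign of [- prof_P]. *)
Definition prof_a al s u x := al * u x + (1 - al) * x + s.
Definition prof_D al s u v x := prof_a al s u x ^+ 2 + al ^+ 2 * v x ^+ 2.
Definition prof_f u v (x : R) := v x / (u x ^+ 2 + v x ^+ 2).
Definition prof_P al s u x := prof_a al s u x + al * u x.

(* What unimodality uses of the boundary values [u + i v] of F, in a form stable
   under [x |-> - x]. *)
Record profile al s u v : Prop := Profile {
  prof_al : 0 < al;
  prof_cu : continuous u;
  prof_cv : continuous v;
  prof_v0 : forall x, 0 <= v x;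
  prof_r : forall x, 0 < u x ^+ 2 + v x ^+ 2;
  prof_du : forall x, 0 < v x -> rder u x ((u x * prof_a al s u x + al * v x ^+ 2) / prof_D al s u v x);
  prof_dv : forall x, 0 < v x -> rder v x (v x * (prof_a al s u x - al * u x) / prof_D al s u v x);
  prof_cross : forall x1 x2, x1 <= x2 -> u x1 * v x2 <= u x2 * v x1;
  prof_right : forall x1, 0 < v x1 -> exists2 x, x1 < x & prof_f u v x < prof_f u v x1;
  prof_left : forall x1, 0 < v x1 -> exists2 x, x < x1 & prof_f u v x < prof_f u v x1 }.

Lemma prof_a_opp al s u x : prof_a al (- s) (fun t => - u (- t)) x = - prof_a al s u (- x).
Proof. by rewrite /prof_a; ring. Qed.

Lemma prof_D_opp al s u v x :
  prof_D al (- s) (fun t => - u (- t)) (fun t => v (- t)) x = prof_D al s u v (- x).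
Proof. by rewrite /prof_D prof_a_opp sqrrN. Qed.

Lemma prof_f_opp u v x : prof_f (fun t => - u (- t)) (fun t => v (- t)) x = prof_f u v (- x).
Proof. by rewrite /prof_f sqrrN. Qed.

Lemma prof_P_opp al s u x : prof_P al (- s) (fun t => - u (- t)) x = - prof_P al s u (- x).
Proof. by rewrite /prof_P prof_a_opp; ring. Qed.

(** On the side of F this is [w |-> - conj (F (- conj w))], the passage to the law of [- X]. It
    exchanges left and right and changes the sign of [prof_P], which halves the one-sided
    arguments. *)
Lemma profile_opp al s u v : profile al s u v ->
  profile al (- s) (fun x => - u (- x)) (fun x => v (- x)).
Proof.
case=> a0 cu cv v0 r du dv cr pr pl; split => //.
- by move=> x; apply: continuousN; apply: continuous_comp; [exact: oppr_continuous|exact: cu].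
- by move=> x; apply: continuous_comp; [exact: oppr_continuous|exact: cv].
- by move=> x; rewrite sqrrN.
- move=> x vx; rewrite prof_a_opp prof_D_opp.
  by apply: rder_eq (rderN (rder_opp_arg (du _ vx))) _; rewrite opprK mulrNN.
- move=> x vx; rewrite prof_a_opp prof_D_opp.
  by apply: rder_eq (rder_opp_arg (dv _ vx)) _; rewrite -mulNr; congr (_ / _); ring.
- by move=> x1 x2 x12; rewrite !mulNr lerN2; apply: cr; rewrite lerN2.
- move=> x1 vx; have [x xx fx] := pl _ vx; exists (- x); first by rewrite ltrNr.
  by rewrite !prof_f_opp opprK.
- move=> x1 vx; have [x xx fx] := pr _ vx; exists (- x); first by rewrite ltrNl.
  by rewrite !prof_f_opp opprK.
Qed.

Section Fixed.
Variables (al s : R) (u v : R -> R).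
Hypothesis H : profile al s u v.
Let al0 := prof_al H.
Let cv := prof_cv H.
Let r_gt0 := prof_r H.
Let a := prof_a al s u.
Let D := prof_D al s u v.
Let f := prof_f u v.
Let P := prof_P al s u.

Lemma prof_D_gt0 x : 0 < v x -> 0 < D x.
Proof. by move=> vx; rewrite /D /prof_D ltr_wpDl ?sqr_ge0// mulr_gt0// exprn_gt0. Qed.

Lemma rder_prof_a x : 0 < v x ->
  rder a x (al * ((u x * a x + al * v x ^+ 2) / D x) + (1 - al)).
Proof.
move=> vx; apply: rder_eq (rderD (rderD (rderM (rder_cst al x) (prof_du H vx))
  (rderM (rder_cst (1 - al) x) (rder_id x))) (rder_cst s x)) _.
by rewrite !mul0r !add0r mulr1 addr0.
Qed.

Lemma rder_prof_P x : 0 < v x ->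
  rder P x (2 * al * ((u x * a x + al * v x ^+ 2) / D x) + (1 - al)).
Proof.
move=> vx; apply: rder_eq (rderD (rder_prof_a vx) (rderM (rder_cst al x) (prof_du H vx))) _.
by rewrite mul0r add0r -/(a x) -/(D x); ring.
Qed.

Lemma rder_prof_r x : 0 < v x ->
  rder (fun t => u t ^+ 2 + v t ^+ 2) x (2 * a x * (u x ^+ 2 + v x ^+ 2) / D x).
Proof.
move=> vx; have D0 := gt_eqF (prof_D_gt0 vx).
apply: rder_eq (rderD (rderM (prof_du H vx) (prof_du H vx)) (rderM (prof_dv H vx) (prof_dv H vx))) _.
by rewrite -/(a x) -/(D x); field; rewrite D0.
Qed.

Lemma rder_prof_f x : 0 < v x ->
  rder f x (- (v x * P x) / ((u x ^+ 2 + v x ^+ 2) * D x)).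
Proof.
move=> vx; have D0 := gt_eqF (prof_D_gt0 vx); have r0 := gt_eqF (r_gt0 x).
apply: rder_eq (rder_quot _ (prof_dv H vx) (rder_prof_r vx)) _; first by rewrite r0.
by rewrite -/(a x) -/(D x) /P /prof_P -/(a x); field; rewrite D0 r0.
Qed.

(** The weight [v^(1 + al) / (u^2 + v^2)]; writing the power with [expR] and [ln] keeps it positive
    at every point. *)
Definition prof_m x := expR ((1 + al) * ln (v x)) / (u x ^+ 2 + v x ^+ 2).

Lemma prof_m_gt0 x : 0 < prof_m x.
Proof. by rewrite divr_gt0 ?expR_gt0. Qed.

(* The weight makes the derivative free of [P]: this is what decides the sign of [P]. *)
Lemma rder_prof_mP x : 0 < v x -> rder (fun t => prof_m t * P t) x
  (prof_m x * (al ^+ 2 * (4 * v x ^+ 2 - (1 + al) * (u x ^+ 2 + v x ^+ 2)) / D x)).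
Proof.
move=> vx; have D0 := gt_eqF (prof_D_gt0 vx); have r0 := gt_eqF (r_gt0 x).
have dl : rder (fun t => ln (v t)) x ((v x)^-1 * (v x * (a x - al * u x) / D x)).
  exact: (@is_derive1_comp R (@ln R) v x _ _ (is_derive1_ln vx) (prof_dv H vx)).
have de : rder (fun t => expR ((1 + al) * ln (v t))) x
    (expR ((1 + al) * ln (v x)) * ((1 + al) * ((a x - al * u x) / D x))).
  apply: rder_eq (@is_derive1_comp R (@expR R) _ x _ _ (is_derive_expR _) (rderM (rder_cst (1 + al) x) dl)) _.
  by rewrite mul0r add0r; congr (_ * (_ * _)); field; rewrite D0 gt_eqF.
apply: rder_eq (rderM (rder_quot _ de (rder_prof_r vx)) (rder_prof_P vx)) _; first by rewrite r0.
rewrite /prof_m; move: (expR _) => E.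
have ED : D x = a x ^+ 2 + al ^+ 2 * v x ^+ 2 by [].
have EP : P x = a x + al * u x by [].
rewrite EP; move: D0; rewrite ED => D0.
by field; rewrite exprMn D0 r0.
Qed.

End Fixed.
End Profile.

(** * Sign of P and uniqueness of its zero *)

Section ProfileSign.
Variable R : realType.
Implicit Types (al s : R) (u v : R -> R).

Section OneSide.
Variables (al s : R) (u v : R -> R).
Hypothesis H : profile al s u v.
Local Notation D := (prof_D al s u v).
Local Notation f := (prof_f u v).
Local Notation P := (prof_P al s u).

(** At a zero of [v] between the two points the cross inequalities give [u >= 0] and [u <= 0], so
    [u] and [v] vanish together, against [prof_r]. *)
Lemma prof_convex x1 x x2 : 0 < v x1 -> 0 < v x2 -> x1 <= x <= x2 -> 0 < v x.
Proof.
move=> v1 v2 /andP[x1x xx2]; rewrite lt_def (prof_v0 H)// andbT; apply/eqP => vx.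
have h1 := prof_cross H x1x; have h2 := prof_cross H xx2; have h3 := prof_r H x.
rewrite vx mulr0 pmulr_lge0// in h1; rewrite vx mulr0 pmulr_lle0// in h2.
by move: h3; rewrite vx (_ : u x = 0) ?expr0n ?addr0 ?ltxx//; apply/le_anti/andP.
Qed.

Lemma prof_open x : 0 < v x -> exists2 e : R, 0 < e & forall y, `|y - x| < e -> 0 < v y.
Proof.
move=> vx; have [e /= e0 He] := cvgr_gt (v x) (prof_cv H (x := x)) 0 vx.
by exists e => // y yx; apply: He; rewrite /= distrC.
Qed.

Lemma prof_f_gt0 x : (0 < f x) = (0 < v x).
Proof. by rewrite /prof_f pmulr_lgt0 ?invr_gt0 ?(prof_r H). Qed.

Lemma continuous_prof_f : continuous f.
Proof.
move=> x; apply: cvgM; first exact: prof_cv H x.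
apply: cvgV; first by rewrite gt_eqF ?(prof_r H).
apply: cvgD; apply: (cvgM (f := fun x => _ x) (g := fun x => _ x)).
all: first [exact: prof_cu H x|exact: prof_cv H x].
Qed.

(** [f] has to drop below its value at some later point, so its maximum on the interval up to that
    point is not at the right end. With [P < 0] the derivative at that maximum would be positive. *)
Lemma prof_P_lt0_right x1 : 0 < v x1 -> ~ forall x, x1 < x -> 0 < v x -> P x < 0.
Proof.
move=> v1 HP; have [e e0 He] := prof_open v1.
(* A start strictly to the right of [x1]: the maximum may sit at the left end, and [P < 0] is
   required there too. *)
pose y1 := x1 + e / 2.
have xy1 : x1 < y1 by rewrite /y1; lra.
have vy1 : 0 < v y1 by apply: He; rewrite /y1 addrC addKr gtr0_norm; lra.
clearbody y1; have [x2 y1x2 f2] := prof_right H vy1.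
have [c + Hc] : exists2 c, c \in `[y1, x2]%R & forall t, t \in `[y1, x2]%R -> f t <= f c.
  by apply: EVT_max; [exact: ltW|apply: continuous_subspaceT; exact: continuous_prof_f].
rewrite in_itv/= => /andP[y1c cx2].
have fc : f y1 <= f c by apply: Hc; rewrite in_itv/= lexx ltW.
have {}cx2 : c < x2.
  by rewrite lt_neqAle cx2 andbT; apply/eqP => E; move: fc; rewrite E; lra.
have vc : 0 < v c by rewrite -prof_f_gt0 (lt_le_trans _ fc)// prof_f_gt0.
have Pc : P c < 0 by apply: HP => //; lra.
have [r r0 Hr] : exists2 r, 0 < r & forall y, `|y - c| < r -> (c < y -> f c < f y) /\ (y < c -> f y < f c).
  apply: (rder_gt0_near (rder_prof_f H vc)); rewrite divr_gt0 ?mulr_gt0 ?(prof_r H) ?(prof_D_gt0 H)//.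
  by rewrite oppr_gt0 pmulr_rlt0.
pose y := Num.min (c + r / 2) x2.
have cy : c < y by rewrite lt_min cx2 andbT; lra.
have yr : y <= c + r / 2 by rewrite ge_min lexx.
have yx : y <= x2 by rewrite ge_min lexx orbT.
clearbody y.
have [|+ _] := Hr y; first by rewrite gtr0_norm; lra.
move=> /(_ cy); have := Hc y; rewrite in_itv/= yx andbT => h.
by have := h (ltW (le_lt_trans y1c cy)); lra.
Qed.

Lemma prof_ratio_lt x1 x2 : x1 < x2 -> 0 < v x1 -> 0 < v x2 -> u x1 / v x1 < u x2 / v x2.
Proof.
move=> x12 v1 v2.
have [x xx|c cx E] := @MVT_deriv R (fun x => u x / v x)
    (fun x => al * (u x ^+ 2 + v x ^+ 2) / (v x * D x)) x1 x2 (ltW x12).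
  have vx := prof_convex v1 v2 xx.
  have D0 := gt_eqF (prof_D_gt0 H vx); have vx0 := gt_eqF vx.
  apply: rder_eq (rder_quot _ (prof_du H vx) (prof_dv H vx)) _; first by rewrite vx0.
  by field; rewrite D0 vx0.
have vc := prof_convex v1 v2 cx.
by rewrite -subr_gt0 E mulr_gt0 ?subr_gt0// divr_gt0 ?mulr_gt0 ?(prof_al H) ?(prof_r H) ?(prof_D_gt0 H).
Qed.

Lemma prof_mP_mvt x1 x2 : x1 <= x2 -> 0 < v x1 -> 0 < v x2 -> exists2 c, x1 <= c <= x2 &
  prof_m al u v x2 * P x2 - prof_m al u v x1 * P x1 = prof_m al u v c *
    (al ^+ 2 * (4 * v c ^+ 2 - (1 + al) * (u c ^+ 2 + v c ^+ 2)) / D c) * (x2 - x1).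
Proof.
move=> x12 v1 v2.
apply: (@MVT_deriv R (fun x => prof_m al u v x * P x) (fun c => prof_m al u v c *
    (al ^+ 2 * (4 * v c ^+ 2 - (1 + al) * (u c ^+ 2 + v c ^+ 2)) / D c))) => // x xx.
by apply: (rder_prof_mP H); exact: prof_convex xx.
Qed.

(** The last inequality reads [(3 - al) v^2 <= (1 + al) u^2]. As [u >= 0] and [u / v] increases, it
    persists to the right and becomes strict; the weighted [P] then decreases from a value [<= 0],
    so [P < 0] on the right, which [prof_P_lt0_right] excludes. *)
Lemma prof_outer_right x1 : 0 < v x1 -> P x1 <= 0 -> 0 <= u x1 ->
  4 * v x1 ^+ 2 <= (1 + al) * (u x1 ^+ 2 + v x1 ^+ 2) -> False.
Proof.
move=> v1 P1 u1 h1; have al0 := prof_al H; apply: (prof_P_lt0_right v1) => x x1x vx.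
have m0 y : 0 < prof_m al u v y := prof_m_gt0 H y.
have outer y : x1 < y -> 0 < v y -> 4 * v y ^+ 2 < (1 + al) * (u y ^+ 2 + v y ^+ 2).
  move=> x1y vy; have := prof_ratio_lt x1y v1 vy.
  rewrite ltr_pdivrMr// mulrAC ltr_pdivlMr// => h.
  have p0 : 0 <= u x1 * v y by rewrite mulr_ge0// ltW.
  have q : (u x1 * v y) ^+ 2 < (u y * v x1) ^+ 2.
    by rewrite ltr_pXn2r// nnegrE (le_trans p0)// ltW.
  have q1 : (3 - al) * (v x1 ^+ 2 * v y ^+ 2) <= (1 + al) * (u x1 * v y) ^+ 2.
    rewrite (_ : _ * (_ * _) ^+ 2 = (1 + al) * u x1 ^+ 2 * v y ^+ 2); last by ring.
    rewrite (mulrA (3 - al)) ler_wpM2r ?sqr_ge0//; lra.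
  have q2 : (1 + al) * (u x1 * v y) ^+ 2 < (1 + al) * (u y * v x1) ^+ 2.
    by rewrite ltr_pM2l//; lra.
  have q3 : (3 - al) * v y ^+ 2 < (1 + al) * u y ^+ 2.
    rewrite -(ltr_pM2r (exprn_gt0 2 v1)); move: (le_lt_trans q1 q2); rewrite exprMn.
    by congr (is_true (_ < _)); ring.
  lra.
have step y z : x1 <= y -> y < z -> 0 < v y -> 0 < v z ->
    prof_m al u v z * P z <= prof_m al u v y * P y /\
    (x1 < y -> prof_m al u v z * P z < prof_m al u v y * P y).
  move=> x1y yz vy vz; have [c /andP[yc cz] E] := prof_mP_mvt (ltW yz) vy vz.
  have vc : 0 < v c by apply: prof_convex vy vz _; rewrite yc.
  have D0 := prof_D_gt0 H vc; have a2 : 0 < al ^+ 2 by rewrite exprn_gt0.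
  have zy : 0 < z - y by rewrite subr_gt0.
  split => [|x1y'].
    rewrite -subr_le0 E pmulr_lle0// pmulr_rle0// pmulr_lle0 ?invr_gt0// pmulr_rle0// subr_le0.
    have [/eqP <-//|nc] := boolP (x1 == c); apply: ltW; apply: outer => //.
    by rewrite lt_neqAle nc; lra.
  rewrite -subr_lt0 E pmulr_llt0// pmulr_rlt0// pmulr_llt0 ?invr_gt0// pmulr_rlt0// subr_lt0.
  by apply: outer => //; lra.
(* At [x1] the inequality is only non-strict, so strict decrease is obtained on the second half. *)
pose y := (x1 + x) / 2.
have x1y : x1 < y by rewrite /y; lra.
have yx : y < x by rewrite /y; lra.
clearbody y.
have vy : 0 < v y by apply: prof_convex v1 vx _; rewrite !ltW.
have [s1 _] := step x1 y (lexx _) x1y v1 vy.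
have [_ /(_ x1y) s2] := step y x (ltW x1y) yx vy vx.
have s3 : prof_m al u v x1 * P x1 <= 0 by rewrite pmulr_rle0.
by have := lt_le_trans s2 (le_trans s1 s3); rewrite pmulr_rlt0.
Qed.

End OneSide.

Section TwoSides.
Variables (al s : R) (u v : R -> R).
Hypothesis H : profile al s u v.
Local Notation D := (prof_D al s u v).
Local Notation f := (prof_f u v).
Local Notation P := (prof_P al s u).

Lemma prof_P_gt0_left x1 : 0 < v x1 -> ~ forall x, x < x1 -> 0 < v x -> 0 < P x.
Proof.
move=> v1 HP; have /(_ (- x1)) := prof_P_lt0_right (profile_opp H); rewrite opprK.
by apply => // x xx vx; rewrite prof_P_opp oppr_lt0; apply: HP => //; rewrite ltrNl.
Qed.

Lemma prof_outer_left x1 : 0 < v x1 -> 0 <= P x1 -> u x1 <= 0 ->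
  4 * v x1 ^+ 2 <= (1 + al) * (u x1 ^+ 2 + v x1 ^+ 2) -> False.
Proof.
move=> v1 P1 u1 h; apply: (prof_outer_right (profile_opp H) (x1 := - x1)).
all: by rewrite ?opprK ?sqrrN ?prof_P_opp ?opprK ?oppr_le0 ?oppr_ge0.
Qed.

(** A zero satisfies both [P <= 0] and [P >= 0], so for either sign of [u] one of the two outer
    lemmas excludes the opposite inequality. *)
Lemma prof_zero_inner z : 0 < v z -> P z = 0 -> (1 + al) * u z ^+ 2 < (3 - al) * v z ^+ 2.
Proof.
move=> vz Pz; rewrite ltNge; apply/negP => h.
have h4 : 4 * v z ^+ 2 <= (1 + al) * (u z ^+ 2 + v z ^+ 2) by lra.
have [u0|/ltW u0] := leP 0 (u z).
  by apply: (prof_outer_right H vz) => //; rewrite Pz.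
by apply: (prof_outer_left vz) => //; rewrite Pz.
Qed.

(** The inequality bounds [|u / v|], so it confines the increasing function [u / v] to an interval.
    It therefore holds everywhere between [z1] and [z2], where it makes the derivative of the
    weighted [P] positive. *)
Lemma prof_mP_increasing z1 z2 : 0 < v z1 -> 0 < v z2 -> z1 < z2 ->
  (1 + al) * u z1 ^+ 2 < (3 - al) * v z1 ^+ 2 ->
  (1 + al) * u z2 ^+ 2 < (3 - al) * v z2 ^+ 2 ->
  prof_m al u v z1 * P z1 < prof_m al u v z2 * P z2.
Proof.
move=> v1 v2 z12 h1 h2; have al0 := prof_al H.
have a1 : 0 < 1 + al by lra.
have T x : 0 < v x -> ((1 + al) * u x ^+ 2 < (3 - al) * v x ^+ 2) = ((1 + al) * (u x / v x) ^+ 2 < 3 - al).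
  by move=> vx; rewrite expr_div_n [X in _ = (X < _)]mulrA ltr_pdivrMr ?exprn_gt0.
have [c /andP[z1c cz2] E] := prof_mP_mvt H (ltW z12) v1 v2.
have vc : 0 < v c by apply: (prof_convex H v1 v2); rewrite z1c.
suff hc : (1 + al) * u c ^+ 2 < (3 - al) * v c ^+ 2.
  have D0 := prof_D_gt0 H vc; have m0 := prof_m_gt0 H c.
  rewrite -subr_gt0 E mulr_gt0 ?subr_gt0// mulr_gt0// divr_gt0// mulr_gt0 ?exprn_gt0//; lra.
have [->//|nz1] := eqVneq c z1; have [->//|nz2] := eqVneq c z2.
have l1 := prof_ratio_lt H (_ : z1 < c) v1 vc; have l2 := prof_ratio_lt H (_ : c < z2) vc v2.
have {}l1 : u z1 / v z1 < u c / v c by apply: l1; rewrite lt_neqAle eq_sym nz1.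
have {}l2 : u c / v c < u z2 / v z2 by apply: l2; rewrite lt_neqAle nz2.
move: h1 h2; rewrite !T//; move: (u z1 / v z1) (u c / v c) (u z2 / v z2) l1 l2 => t1 t t2 l1 l2.
(* According to its sign, the middle ratio is dominated in modulus by the right one or by the left
   one. *)
have [t0|t0] := leP 0 t => h1 h2.
  apply: le_lt_trans h2; rewrite ler_pM2l// ler_pXn2r ?nnegrE//; lra.
apply: le_lt_trans h1; rewrite ler_pM2l// -(sqrrN t) -(sqrrN t1) ler_pXn2r ?nnegrE//; lra.
Qed.

Lemma prof_zero_unique z1 z2 : 0 < v z1 -> 0 < v z2 -> P z1 = 0 -> P z2 = 0 -> z1 = z2.
Proof.
wlog z12 : z1 z2 / z1 < z2 => [W|] v1 v2 P1 P2.
  by have [h|h|//] := ltgtP z1 z2; [|apply/esym]; apply: W.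
have := prof_mP_increasing v1 v2 z12 (prof_zero_inner v1 P1) (prof_zero_inner v2 P2).
by rewrite P1 P2 !mulr0 ltxx.
Qed.

Lemma continuous_prof_P : continuous P.
Proof.
move=> x; apply: cvgD; last by apply: cvgM; [exact: cvg_cst|exact: prof_cu H x].
apply: cvgD; last exact: cvg_cst.
by apply: cvgD; apply: cvgM; [exact: cvg_cst|exact: prof_cu H x|exact: cvg_cst|exact: cvg_id].
Qed.

Lemma prof_zero_between x1 x2 : x1 <= x2 -> Num.min (P x1) (P x2) <= 0 <= Num.max (P x1) (P x2) ->
  exists2 z, x1 <= z <= x2 & P z = 0.
Proof.
move=> x12 h; have [z zx Pz] := IVT x12 (continuous_subspaceT continuous_prof_P) h.
by exists z => //; move: zx; rewrite in_itv.
Qed.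

(** Without a zero, the intermediate value theorem would give [P] one sign on [{v > 0}]; a negative
    sign is impossible to the right of [x0], a positive one to its left. *)
Lemma prof_zero_exists x0 : 0 < v x0 -> exists2 z, 0 < v z & P z = 0.
Proof.
move=> v0; have [] := pselect (exists2 z, 0 < v z & P z = 0); first by [].
move=> no; exfalso.
have nz x : 0 < v x -> P x != 0 by move=> vx; apply/eqP => Px; apply: no; exists x.
have [P0|P0|P0] := ltgtP (P x0) 0.
- apply: (prof_P_lt0_right H v0) => x x0x vx; rewrite ltNge; apply/negP => Px.
  have [|z zx Pz] := @prof_zero_between x0 x (ltW x0x); first by rewrite ge_min le_max ltW// Px orbT.
  by have := nz z (prof_convex H v0 vx zx); rewrite Pz eqxx.
- apply: (prof_P_gt0_left v0) => x xx0 vx; rewrite ltNge; apply/negP => Px.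
  have [|z zx Pz] := @prof_zero_between x x0 (ltW xx0); first by rewrite ge_min le_max Px (ltW P0) orbT.
  by have := nz z (prof_convex H vx v0 zx); rewrite Pz eqxx.
- by have := nz _ v0; rewrite P0 eqxx.
Qed.

(** The weighted [P] has a positive derivative at [z], so near [z] one has [P <= 0] on the left and
    [P >= 0] on the right. The derivative of [f] has the opposite sign, and the mean value theorem
    compares [f y] with [f z]. *)
Lemma prof_zero_local_max z : 0 < v z -> P z = 0 -> local_max f z.
Proof.
move=> vz Pz; have al0 := prof_al H.
have hz := prof_zero_inner vz Pz.
have [e e0 He] := prof_open H vz.
have [r r0 Hr] : exists2 r, 0 < r & forall y, `|y - z| < r ->
    (z < y -> prof_m al u v z * P z < prof_m al u v y * P y) /\
    (y < z -> prof_m al u v y * P y < prof_m al u v z * P z).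
  apply: (rder_gt0_near (rder_prof_mP H vz)).
  rewrite mulr_gt0 ?(prof_m_gt0 H)// divr_gt0 ?(prof_D_gt0 H)// mulr_gt0 ?exprn_gt0//; lra.
have m0 y : 0 < prof_m al u v y := prof_m_gt0 H y.
have d0 : 0 < Num.min e r by rewrite lt_min e0.
have sgn y : `|y - z| < Num.min e r -> [/\ 0 < v y, z <= y -> 0 <= P y & y <= z -> P y <= 0].
  rewrite lt_min => /andP[/He vy /Hr[]]; rewrite Pz mulr0 pmulr_rgt0// pmulr_rlt0// => h1 h2.
  by split => //; rewrite le_eqVlt => /predU1P[E|]; [rewrite -E Pz|move/h1/ltW|rewrite E Pz|move/h2/ltW].
have den y : 0 < v y -> 0 < (u y ^+ 2 + v y ^+ 2) * D y.
  by move=> vy; rewrite mulr_gt0 ?(prof_r H) ?(prof_D_gt0 H).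
exists (Num.min e r) => // y; rewrite /= distrC => yz.
have dist x : (y <= x <= z) || (z <= x <= y) -> `|x - z| < Num.min e r.
  move=> h; apply: le_lt_trans yz; rewrite ler_norml.
  have := ler_norm (y - z); have := ler_norm (- (y - z)); rewrite normrN.
  by move: h => /orP[] /andP[]; lra.
pose df x := - (v x * P x) / ((u x ^+ 2 + v x ^+ 2) * D x).
have [zy|yz'] := leP z y.
  have [x zx|c cx] := @MVT_deriv R f df z y zy.
    by apply: (rder_prof_f H); have [] := sgn x; rewrite // dist// zx orbT.
  have [vc Pc _] : [/\ 0 < v c, z <= c -> 0 <= P c & c <= z -> P c <= 0] by apply: sgn; rewrite dist// cx orbT.
  move=> E; rewrite -subr_le0 E mulr_le0_ge0 ?subr_ge0// /df mulNr oppr_le0 divr_ge0 ?(ltW (den _ vc))//.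
  by rewrite mulr_ge0 ?(ltW vc)// Pc//; case/andP: cx.
have [x zx|c cx] := @MVT_deriv R f df y z (ltW yz').
  by apply: (rder_prof_f H); have [] := sgn x; rewrite // dist// zx.
have [vc _ Pc] : [/\ 0 < v c, z <= c -> 0 <= P c & c <= z -> P c <= 0] by apply: sgn; rewrite dist// cx.
move=> E; rewrite -subr_ge0 E mulr_ge0 ?subr_ge0 ?(ltW yz')// /df divr_ge0 ?(ltW (den _ vc))//.
by rewrite oppr_ge0 pmulr_rle0// Pc//; case/andP: cx.
Qed.

Lemma profile_unimodal x0 : 0 < v x0 -> exists z,
  [/\ 0 < v z, local_max f z & forall x, 0 < v x -> local_max f x -> z = x].
Proof.
move=> v0; have [z vz Pz] := prof_zero_exists v0; exists z; split => //.
  exact: prof_zero_local_max.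
move=> x vx mx; apply: prof_zero_unique => //.
have := local_max_rder (rder_prof_f H vx) mx.
move=> /eqP; rewrite mulf_eq0 oppr_eq0 mulf_eq0 invr_eq0 mulf_eq0.
by rewrite (gt_eqF vx) (gt_eqF (prof_r H x)) (gt_eqF (prof_D_gt0 H vx)) /= orbF => /eqP.
Qed.

End TwoSides.
End ProfileSign.

Lemma density_itv_ge (R : realType) (nu : borel_probability R) (f : R -> R) (a b c : R) :
  is_density nu f -> a <= b -> 0 <= c -> (forall x, a <= x <= b -> c <= f x) ->
  ((c * (b - a))%:E <= nu `[a, b]%classic)%E.
Proof.
move=> [mf f0 fE] ab c0 cf; rewrite fE; last exact: measurable_itv.
apply: (@le_trans _ _ (\int[lebesgue_measure]_(x in `[a, b]) c%:E)%E).
  rewrite integral_cst//.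
  have E : @lebesgue_measure R `[a, b]%classic = (b - a)%:E.
    rewrite lebesgue_measure_itv/= lte_fin; case: ltP => [_|ba]; first by rewrite EFinB.
    by rewrite (_ : a = b) ?subrr//; apply/le_anti/andP.
  by rewrite [X in (_ * X)%E](_ : _ = @lebesgue_measure R `[a, b]%classic)// E EFinM.
apply: ge0_le_integral => //=.
by apply/measurable_EFinP; exact: measurable_funTS.
Qed.

(** * Unimodality of the boundary density *)

Section UnimodalDensity.
Variables (R : realType) (nu : borel_probability R) (al s : R) (F0 : R -> R[i]).
Local Notation F := (reciprocal_cauchy_transform nu).
Hypothesis al0 : 0 < al.
Hypothesis npm : ~ point_mass nu.
Hypothesis ode : forall w, 0 < Im w -> Dn F al s w * dF nu w = F w.
Hypothesis bF0 : forall x (e : R), 0 < e ->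
  exists2 d : R, 0 < d & forall x' y' : R, `|x' - x| < d -> 0 < y' < d ->
    normc (F (x' +i* y') - F0 x) <= e.

Let dFnu w : 0 < Im w -> cder F w (dF nu w). Proof. exact: cder_F. Qed.
Let ImF w : 0 < Im w -> Im w < Im (F w). Proof. exact: Im_F_gt. Qed.
Let F0n x : F0 x != 0. Proof. exact: (F0_neq0 al0 dFnu ImF ode bF0). Qed.
Let u x := Re (F0 x).
Let v x := Im (F0 x).
Let f := boundary_density F0.

Let f_density : is_density nu f.
Proof. exact: (is_density_boundary al0 npm ode bF0). Qed.

Let fE x : f x = prof_f u v x / pi.
Proof. by rewrite /f /boundary_density normc_sqr. Qed.

Let f_le x y : (f x <= f y) = (prof_f u v x <= prof_f u v y).
Proof. by rewrite !fE ler_pM2r ?invr_gt0 ?pi_gt0. Qed.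

Let f_gt0 x : (0 < f x) = (0 < v x).
Proof.
rewrite fE pmulr_lgt0 ?invr_gt0 ?pi_gt0// /prof_f pmulr_lgt0// invr_gt0.
by rewrite /u /v -normc_sqr exprn_gt0// normc_gt0.
Qed.

(** Otherwise [f >= f x1] on an interval of length [2 / f x1], which would carry mass at least 2. *)
Lemma density_drop_right x1 : 0 < f x1 -> exists2 x, x1 < x & f x < f x1.
Proof.
move=> f1; have [] := pselect (exists2 x, x1 < x & f x < f x1); first by [].
move=> no; exfalso.
have H x : x1 <= x -> f x1 <= f x.
  rewrite le_eqVlt => /predU1P[->//|xx]; rewrite leNgt; apply/negP => fx.
  by apply: no; exists x.
have h : x1 <= x1 + 2 / f x1 by rewrite lerDl divr_ge0// ltW.
have := density_itv_ge f_density h (ltW f1) (fun x xx => H x (proj1 (andP xx))).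
rewrite addrC addKr mulrC divfK ?gt_eqF// => /le_trans /(_ (probability_le1 nu (measurable_itv _))).
by rewrite lee_fin; lra.
Qed.

Lemma density_drop_left x1 : 0 < f x1 -> exists2 x, x < x1 & f x < f x1.
Proof.
move=> f1; have [] := pselect (exists2 x, x < x1 & f x < f x1); first by [].
move=> no; exfalso.
have H x : x <= x1 -> f x1 <= f x.
  rewrite le_eqVlt => /predU1P[->//|xx]; rewrite leNgt; apply/negP => fx.
  by apply: no; exists x.
have h : x1 - 2 / f x1 <= x1 by rewrite gerBl divr_ge0// ltW.
have := density_itv_ge f_density h (ltW f1) (fun x xx => H x (proj2 (andP xx))).
rewrite subKr mulrC divfK ?gt_eqF// => /le_trans /(_ (probability_le1 nu (measurable_itv _))).
by rewrite lee_fin; lra.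
Qed.

(** The derivative clauses are the real and imaginary parts of [F0' = F0 / Dn0], available where
    [v > 0] because [Im Dn0 = al v]. *)
Lemma boundary_profile : profile al s u v.
Proof.
have Dn0E x : 0 < v x -> Dn0 al s F0 x != 0 /\ F0 x / Dn0 al s F0 x =
    ((u x * prof_a al s u x + al * v x ^+ 2) / prof_D al s u v x) +i*
    (v x * (prof_a al s u x - al * u x) / prof_D al s u v x).
  move=> vx; have I0 : Im (Dn0 al s F0 x) = al * v x by exact: Im_Dn0.
  have R0 : Re (Dn0 al s F0 x) = prof_a al s u x by rewrite /Dn0 !ReD !ReZ.
  have nD : normc (Dn0 al s F0 x) ^+ 2 = prof_D al s u v x by rewrite normc_sqr R0 I0 exprMn.
  have D0 : Dn0 al s F0 x != 0 by apply: Im_gt0_neq0; rewrite I0 mulr_gt0.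
  split => //; apply: complexP; rewrite ?ReM ?ImM Re_inv Im_inv nD R0 I0 -/(u x) -/(v x) /=; ring.
split.
- exact: al0.
- exact: continuous_Re_F0 bF0.
- exact: continuous_Im_F0 bF0.
- by move=> x; exact: (Im_F0_ge0 ImF bF0).
- by move=> x; rewrite -normc_sqr exprn_gt0// normc_gt0.
- move=> x vx; have [D0 E] := Dn0E x vx.
  by apply: rder_eq (rder_Re_F0 al0 dFnu ImF ode bF0 D0) _; rewrite E.
- move=> x vx; have [D0 E] := Dn0E x vx.
  by apply: rder_eq (rder_Im_F0 al0 dFnu ImF ode bF0 D0) _; rewrite E.
- exact: (cross_boundary al0 dFnu ImF ode bF0).
- move=> x1; rewrite -f_gt0 => /density_drop_right[x xx h]; exists x => //.
  by rewrite ltNge -f_le -ltNge.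
- move=> x1; rewrite -f_gt0 => /density_drop_left[x xx h]; exists x => //.
  by rewrite ltNge -f_le -ltNge.
Qed.

Let H := boundary_profile.

Lemma boundary_support_nonempty : exists x, 0 < v x.
Proof.
have [//|no] := pselect (exists x, 0 < v x); exfalso.
have [_ fge0 fint] := f_density.
have f0 x : f x = 0.
  apply/le_anti; rewrite fge0 andbT leNgt; apply/negP; rewrite f_gt0 => vx.
  by apply: no; exists x.
have := fint setT measurableT.
rewrite probability_setT (eq_integral (fun=> 0%E)); last by move=> x _; rewrite f0.
by rewrite integral0 => /eqP; rewrite onee_eq0.
Qed.

Lemma measure_support_boundary x : 0 < v x -> measure_support nu x.
Proof.
move=> vx U oU Ux.
have fx : 0 < f x / 2 by rewrite divr_gt0// f_gt0.
have cf : continuous f by exact: (continuous_boundary_density al0 npm ode bF0).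
have [e1 /= e10 He1] := cvgr_gt (f x) (cf x) (f x / 2) (ltac:(lra)).
have [e2 /= e20 He2] := oU x Ux.
pose e := Num.min e1 e2 / 2; have m0 : 0 < Num.min e1 e2 by rewrite lt_min e10.
have : e < Num.min e1 e2 by rewrite /e; lra.
have {m0}e0 : 0 < e by rewrite divr_gt0.
rewrite lt_min => /andP[ee1 ee2]; clearbody e.
have dist y : x - e <= y <= x + e -> `|x - y| <= e by rewrite ler_norml; lra.
have xe : x - e <= x + e by lra.
have h1 y : x - e <= y <= x + e -> f x / 2 <= f y.
  by move=> /dist xy; apply: ltW; apply: He1; rewrite /=; lra.
have sub : `[x - e, x + e]%classic `<=` U.
  by move=> y; rewrite /= in_itv/= => /dist xy; apply: He2; rewrite /=; lra.
have := density_itv_ge f_density xe (ltW fx) h1.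
have mU : measurable (U : set (measurableTypeR R)) by exact: open_measurable.
move=> /le_trans /(_ (le_measure nu _ _ sub)); rewrite !inE => /(_ (measurable_itv _) mU).
by apply: lt_le_trans; rewrite lte_fin mulr_gt0//; lra.
Qed.

(** If [v x = 0] then, [{v > 0}] being convex, the open ray on one side of [x] has no mass; for [x]
    interior to the support, that ray would contain points of the support. *)
Lemma interior_measure_support x : (measure_support nu)° x <-> 0 < v x.
Proof.
split; last first.
  move=> vx; have [e e0 He] := prof_open H vx; exists e => // y /=; rewrite distrC => /He.
  exact: measure_support_boundary.
move=> [e /= e0 He]; rewrite lt_def (prof_v0 H) andbT; apply/eqP => vx.
have nx (U : set R) : open U -> (forall y, U y -> v y <= 0) -> nu U = 0%E.
  move=> oU Uv; have [_ f0 ->] := f_density; last exact: open_measurable.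
  rewrite (eq_integral (fun=> 0%E)) ?integral0// => y; rewrite inE => /Uv vy.
  by congr (_%:E); apply/le_anti; rewrite f0 andbT leNgt f_gt0 -leNgt.
have e2 : `|e / 2| < e by rewrite gtr0_norm; lra.
have [[y yx vy]|left0] := pselect (exists2 y, y < x & 0 < v y); last first.
  have := He (x - e / 2); rewrite /= subKr => /(_ e2 (`]-oo, x[%classic)).
  rewrite nx ?ltxx.
  - by move=> h; have : false by apply: h; [exact: interval_open|rewrite /= in_itv/=; lra].
  - exact: interval_open.
  - move=> y; rewrite /= in_itv/= => yx; rewrite leNgt; apply/negP => vy.
    by apply: left0; exists y.
have := He (x + e / 2); rewrite /= opprD addNKr normrN => /(_ e2 (`]x, +oo[%classic)).
rewrite nx ?ltxx.
- by move=> h; have : false by apply: h; [exact: interval_open|rewrite /= in_itv/= andbT; lra].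
- exact: interval_open.
- move=> z; rewrite /= in_itv/= andbT => xz; rewrite leNgt; apply/negP => vz.
  have : 0 < v x by apply: (prof_convex H vy vz); rewrite !ltW.
  by rewrite vx ltxx.
Qed.

Lemma unimodal_boundary : unimodal nu.
Proof.
have lm x : local_max f x <-> local_max (prof_f u v) x.
  by split; apply: filterS => y; rewrite f_le.
exists f; split.
- exact: (continuous_boundary_density al0 npm ode bF0).
- exact: f_density.
have [x0 v0] := boundary_support_nonempty.
have [z [vz mz uz]] := profile_unimodal H v0.
exists z; split; first by split; [exact/interior_measure_support|exact/lm].
by move=> x [/interior_measure_support vx /lm mx]; exact: uz.
Qed.

End UnimodalDensity.

Theorem propositionA2p2 (R : realType) (nu : borel_probability R) :
  free_stable nu -> unimodal nu.
Proof.
move=> stable; have npm : ~ point_mass nu by case: stable.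
have [al [s [al0 ode]]] := stable_ode stable.
have ImFle w : 0 < Im w -> Im w <= Im (reciprocal_cauchy_transform nu w) by exact: Im_F_ge.
have dFnu w : 0 < Im w -> cder (reciprocal_cauchy_transform nu) w (dF nu w) by exact: cder_F.
have [F0 bF0] := boundary_value al0 dFnu ImFle ode.
exact: (unimodal_boundary al0 npm ode bF0).
Qed.
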